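(* Let $(u(t),p(t))$ be the solution of the weak Biot problem and $(u_h^n,p_h^n)$, $n\ge 1$, the solution of the fully discrete scheme, both as described in the context, and assume that for $q=1,2,\infty$ and $s=1,2$ $$u\in L^{\infty}((0,T],[H_0^1(\Omega)]^d)\cap L^\infty((0,T],[H^2(\Omega)]^d),\quad \partial_t u\in L^s((0,T],[H^2(\Omega)]^d),\quad \partial_{tt}u\in L^s((0,T],[H_0^1(\Omega)]^d),$$ $$p\in L^\infty((0,T],H_0^1(\Omega))\cap L^\infty((0,T],H^2(\Omega)),\quad \partial_t p\in L^q((0,T],H_0^1(\Omega))\cap L^s((0,T],H^2(\Omega)),\quad \partial_{tt}p\in L^s((0,T],H_0^1(\Omega)).$$ Then there is a constant $c$, independent of $\tau$, $h$ and $n$, such that for every $n\ge1$ with $t_n\le T$ the following hold. (1) \begin{align*} \|(u(t_n)-u_h^n,\,p(t_n)-p_h^n)\|_{\tau,h}\le{}& \|(e_u^0,e_p^0)\|_{\tau,h}+c\Big\{\tau\Big[\int_0^{t_n}\|\partial_{tt}u\|_1\,dt+\int_0^{t_n}\varepsilon^{1/2}h|\partial_{tt}p|_1\,dt\Big]\\ &+h\Big[|u(t_n)|_2+|p(t_n)|_1+(\tau^{1/2}+\varepsilon^{1/2}h)|p(t_n)|_2+\int_0^{t_n}(|\partial_tu|_2+|\partial_tp|_1)\,dt+\int_0^{t_n}\varepsilon^{1/2}h|\partial_tp|_2\,dt\Big]\\ &+t_n\max_{1\le j\le n}\varepsilon^{1/2}h\|\nabla\partial_tp(t_j)\|\Big\}.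 \end{align*} (2) If the discrete initial data are of type (I) (discrete stabilized Stokes initial data, see context), then \begin{align*} \|p(t_n)-p_h^n\|_{a_p}\le{}&\|e_p^0\|_{a_p}+c\Big\{\tau\Big[\Big(\int_0^{t_n}\|\partial_{tt}u\|_1^2\,dt\Big)^{1/2}+\Big(\int_0^{t_n}\varepsilon h^2\|\partial_{tt}p\|_1^2\,dt\Big)^{1/2}\Big]\\ &+h\Big[|p(t_n)|_2+\Big(\int_0^{t_n}(|\partial_tu|_2+|\partial_tp|_1)^2\,dt\Big)^{1/2}+\Big(\int_0^{t_n}\varepsilon h^2|\partial_tp|_2^2\,dt\Big)^{1/2}\Big]\\ &+\sqrt{t_n}\max_{1\le j\le n}\varepsilon^{1/2}h\|\nabla\partial_tp(t_j)\|\Big\}. \end{align*} (3) If the discrete initial data are of type (II) (i.e. $\operatorname{div}u_h^0=0$ and $p_h^0=0$), then \begin{align*} \|p(t_n)-p_h^n\|_{a_p}\le{}&\frac{1}{\sqrt{2\tau}}\|(e_u^0,e_p^0)\|_{\tau,h}+c\Big\{\tau\Big[\Big(\int_0^{t_n}\|\partial_{tt}u\|_1^2\,dt\Big)^{1/2}+\Big(\int_0^{t_n}\varepsilon h^2\|\partial_{tt}p\|_1^2\,dt\Big)^{1/2}\Big]\\ &+h\Big[|p(t_n)|_2+\Big(\int_0^{t_n}(|\partial_tu|_2+|\partial_tp|_1)^2\,dt\Big)^{1/2}+\Big(\int_0^{t_n}\varepsilon h^2|\partial_tp|_2^2\,dt\Big)^{1/2}\Big]\\ &+\sqrt{t_n}\max_{1\le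 j\le n}\varepsilon^{1/2}h\|\nabla\partial_tp(t_j)\|\Big\}. \end{align*} (4) In the $L^2$-norm, \begin{align*} \|p(t_n)-p_h^n\|\le{}& c\,\|(e_u^0,e_p^0)\|_{\tau,h}+c\Big\{\tau\Big[\int_0^{t_n}\|\partial_{tt}u\|_1\,dt+\int_0^{t_n}\varepsilon^{1/2}h|\partial_{tt}p|_1\,dt\Big]+h^2|p(t_n)|_2\\ &+h\Big[\int_0^{t_n}(|\partial_tu|_2+|\partial_tp|_1)\,dt+\int_0^{t_n}\varepsilon^{1/2}h|\partial_tp|_2\,dt\Big]+t_n\max_{1\le j\le n}\varepsilon^{1/2}h\|\nabla\partial_tp(t_j)\|\Big\}. \end{align*}
   Context: Let $\Omega\subset\mathbb{R}^d$ be a bounded domain, $\lambda,\mu$ the Lamé coefficients (with $\mu>0$, $d\lambda+2\mu>0$), $K$ the (symmetric positive definite) hydraulic conductivity tensor, $\varepsilon(u)=\frac12(\nabla u+\nabla u^T)$ the strain tensor, $$a(u,v)=2\mu\int_\Omega\varepsilon(u):\varepsilon(v)+\lambda\int_\Omega\operatorname{div}u\,\operatorname{div}v,\qquad a_p(p,q)=\int_\Omega K\nabla p\cdot\nabla q,$$ $\|v\|_a=a(v,v)^{1/2}$, $\|q\|_{a_p}=a_p(q,q)^{1/2}$. $(\cdot,\cdot)$ and $\|\cdot\|=\|\cdot\|_0$ are the $L^2(\Omega)$ inner product and norm; $\|\cdot\|_k$, $|\cdot|_k$ are the norm and seminorm of $H^k(\Omega)$. (The scalar parameter $\varepsilon\ge0$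 below is unrelated to the strain tensor.) Weak Biot problem: $u(t)\in[H_0^1(\Omega)]^d$, $p(t)\in H_0^1(\Omega)$ satisfy $$a(u,v)-(\operatorname{div}v,p)=(f,v)\ \ \forall v\in[H_0^1(\Omega)]^d,\qquad -(\operatorname{div}\partial_tu,q)-a_p(p,q)=0\ \ \forall q\in H_0^1(\Omega),$$ with initial data $u(0)\in[H_0^1(\Omega)]^d$, $p(0)\in L^2(\Omega)$ solving the Stokes problem $a(u(0),v)-(\operatorname{div}v,p(0))=(f(0),v)$ for all $v\in[H_0^1(\Omega)]^d$, $-(\operatorname{div}u(0),q)=0$ for all $q\in L^2(\Omega)$. Discrete scheme: $V_h\subset[H_0^1(\Omega)]^d$, $Q_h\subset H_0^1(\Omega)$ are the spaces of either the MINI element ($V_h$: continuous piecewise linear vector functions plus one vector-valued element bubble per simplex; $Q_h$: continuous piecewise linears) or the P1-P1 element ($V_h$, $Q_h$ both continuous piecewise linear), on a simplicial mesh of size $h$. Let $\tau>0$ be the time step, $t_n=n\tau$, $\bar\partial_tw^n=(w^n-w^{n-1})/\tau$, and $\varepsilon\ge0$ a stabilization parameter ($\varepsilon>0$ for P1-P1). For $n\ge1$ find $(u_h^n,p_h^n)\in V_h\times Q_h$ with $$a(u_h^n,v_h)-(\operatorname{div}v_h,p_h^n)=(f(t_n),v_h)\ \ \forall v_h\in V_h,$$ $$-(\operatorname{div}\bar\partial_tu_h^n,q_h)-a_p(p_h^n,q_h)-\varepsilon h^2(\nabla\bar\partial_tp_h^n,\nabla q_h)=0\ \ \forall q_h\in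 Q_h.$$ Discrete initial data $(u_h^0,p_h^0)\in V_h\times Q_h$ are one of two types: (I) the solution of $a(u_h^0,v_h)-(\operatorname{div}v_h,p_h^0)=(f(0),v_h)$ for all $v_h\in V_h$ and $-(\operatorname{div}u_h^0,q_h)-\varepsilon h^2(\nabla p_h^0,\nabla q_h)=0$ for all $q_h\in Q_h$; (II) data not satisfying (I) but with $\operatorname{div}u_h^0=0$ and $p_h^0=0$. Norm: $\|(u,p)\|_{\tau,h}=\big(\|u\|_a^2+\tau\|p\|_{a_p}^2+\varepsilon h^2\|\nabla p\|^2\big)^{1/2}$. Elliptic projections $\bar u_h(t)\in V_h$, $\bar p_h(t)\in Q_h$: $a_p(\bar p_h,q_h)=a_p(p,q_h)$ for all $q_h\in Q_h$, and $a(\bar u_h,v_h)-(\operatorname{div}v_h,\bar p_h)=a(u,v_h)-(\operatorname{div}v_h,p)$ for all $v_h\in V_h$. Set $\rho_u=u-\bar u_h$, $\rho_p=p-\bar p_h$, $e_u^n=u_h^n-\bar u_h(t_n)$, $e_p^n=p_h^n-\bar p_h(t_n)$ (also for $n=0$). Standing properties of the discretization: (a) inf-sup: there are constants $c,c_1$ independent of $h,\tau$ with $\|q_h\|\le c\sup_{0\ne v_h\in V_h}\frac{(\operatorname{div}v_h,q_h)}{\|v_h\|_a}+c_1\varepsilon^{1/2}h\|\nabla q_h\|$ for all $q_h\in Q_h$ ($c_1=0$ for MINI); (b) approximation by the elliptic projections: $\|\rho_u\|_a\le ch(|u|_2+|p|_1)$, $\|\rho_p\|_1\le ch|p|_2$,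 $\|\rho_p\|_{a_p}\le ch|p|_2$, $\|\rho_p\|\le ch^2|p|_2$, and likewise for $\partial_t\rho_u,\partial_t\rho_p$ with $\partial_tu,\partial_tp$ on the right-hand sides. The constant $c$ in the claim may depend on the constants in (a), (b) and on $\Omega,d,\lambda,\mu,K$. *)

(* Defs.v *)
From HB Require Import structures.
From mathcomp Require Import all_boot all_order all_algebra.
From mathcomp Require Import all_classical all_reals all_analysis.

Set Implicit Arguments.
Unset Strict Implicit.
Unset Printing Implicit Defensive.

Import Order.TTheory GRing.Theory Num.Theory.
Import numFieldNormedType.Exports.

Local Open Scope classical_set_scope.
Local Open Scope ring_scope.

(* The product sigma-algebra on row vectors, as for tuples. *)
Section measurable_row_vector.
Context {dT : measure_display} {T : measurableType dT} (n : nat).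

Let coord : 'I_n -> 'rV[T]_n -> T := fun i x => x ord0 i.

Let row_set0 : g_sigma_preimage coord set0.
Proof. exact: sigma_algebra0. Qed.

Let row_setC A : g_sigma_preimage coord A -> g_sigma_preimage coord (~` A).
Proof. exact: sigma_algebraC. Qed.

Let row_bigcup (F : _^nat) : (forall i, g_sigma_preimage coord (F i)) ->
  g_sigma_preimage coord (\bigcup_i (F i)).
Proof. exact: sigma_algebra_bigcup. Qed.

HB.instance Definition _ := @isMeasurable.Build (measure_tuple_display dT)
  'rV[T]_n (g_sigma_preimage coord) row_set0 row_setC row_bigcup.

End measurable_row_vector.

Lemma measurable_coord dT (T : measurableType dT) n (i : 'I_n) :
  measurable_fun [set: 'rV[T]_n] (fun x : 'rV[T]_n => x ord0 i).
Proof.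
move=> _ Y mY; rewrite setTI; apply: sub_sigma_algebra => /=.
rewrite -bigcup_seq/=; exists i => /=; first by rewrite mem_index_enum.
by exists Y => //; rewrite setTI.
Qed.

Lemma measurable_fun_rV dS dT (S : measurableType dS) (T : measurableType dT)
    n (f : S -> 'rV[T]_n) :
  (forall i, measurable_fun [set: S] (fun x => f x ord0 i)) ->
  measurable_fun [set: S] f.
Proof.
move=> mf _ Y mY; rewrite setTI.
suff fS : g_sigma_preimage (fun i : 'I_n => (fun x : 'rV[T]_n => x ord0 i) \o f)
    `<=` measurable.
  apply: fS; rewrite (g_sigma_preimage_comp (fun i (x : 'rV[T]_n) => x ord0 i) f).
  by exists Y => //; rewrite setTI.
apply: smallest_sub; first exact: sigma_algebra_measurable.
rewrite -bigcup_seq => A [i /= _ [B mB <-]].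
exact: mf.
Qed.

Section lebesgue_measure_row_vector.
Context {R : realType}.

Definition rV_cons n (z : R * 'rV[R]_n) : 'rV[R]_n.+1 :=
  row_mx (z.1%:M : 'rV_1) z.2.

Lemma rV_consE n (z : R * 'rV[R]_n) (i : 'I_n.+1) :
  rV_cons z ord0 i = if unlift ord0 i is Some j then z.2 ord0 j else z.1.
Proof.
rewrite /rV_cons mxE; case: unliftP => [j|] ->.
  by case: splitP => k //= /eqP; rewrite ?ord1 // eqSS => /eqP/val_inj ->.
by case: splitP => k //= _; rewrite !ord1 mxE.
Qed.

Lemma measurable_rV_cons n :
  measurable_fun [set: R * 'rV[R]_n] (@rV_cons n).
Proof.
apply: measurable_fun_rV => i; rewrite /=.
under eq_fun do rewrite rV_consE.
case: unlift => [j|]; last exact: measurable_fst.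
exact: (measurableT_comp (@measurable_coord _ R n j)).
Qed.

Section lebesgue_step.
Local Open Scope ereal_scope.
Context (n : nat) (m : {sigma_finite_measure set 'rV[R]_n -> \bar R}).

Definition lebesgue_rV_step (A : set 'rV[R]_n.+1) : \bar R :=
  (lebesgue_measure \x m) (@rV_cons n @^-1` A).

Let pre_measurable (A : set 'rV[R]_n.+1) :
  measurable A -> measurable (@rV_cons n @^-1` A).
Proof.
by move=> mA; rewrite -[X in measurable X]setTI; exact: measurable_rV_cons.
Qed.

Let step0 : lebesgue_rV_step set0 = 0.
Proof. by rewrite /lebesgue_rV_step preimage_set0 measure0. Qed.

Let step_ge0 A : 0 <= lebesgue_rV_step A.
Proof. exact: measure_ge0. Qed.

Let step_sigma_additive : semi_sigma_additive lebesgue_rV_step.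
Proof.
move=> F mF tF mUF; rewrite /lebesgue_rV_step preimage_bigcup.
apply: measure_semi_sigma_additive.
- by move=> k; exact: pre_measurable.
- apply/trivIsetP => /= i j _ _ ij; rewrite -preimage_setI.
  by move/trivIsetP : tF => /(_ _ _ _ _ ij) ->//; rewrite preimage_set0.
- by rewrite -preimage_bigcup; exact: pre_measurable.
Qed.

HB.instance Definition _ := isMeasure.Build _ _ _
  lebesgue_rV_step step0 step_ge0 step_sigma_additive.

Let step_sigma_finite : sigma_finite setT lebesgue_rV_step.
Proof.
have /sigma_finiteP[F [FT ndF Foo]] := sigma_finiteT (@lebesgue_measure R).
have /sigma_finiteP[G [GT ndG Goo]] := sigma_finiteT m.
pose tl (x : 'rV[R]_n.+1) : 'rV[R]_n := \row_j x ord0 (lift ord0 j).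
pose g (x : 'rV[R]_n.+1) : (measurableTypeR R * 'rV[R]_n)%type := (x ord0 ord0, tl x).
have gK (z : (R * 'rV[R]_n)%type) : g (rV_cons z) = z.
  case: z => a y; rewrite /g /tl rV_consE unlift_none /=; congr (_, _).
  by apply/rowP => j; rewrite mxE rV_consE liftK.
have mg : measurable_fun setT g.
  apply/measurable_fun_pairP; split; first exact: (measurable_coord ord0).
  apply: measurable_fun_rV => j /=.
  under eq_fun do rewrite mxE.
  exact: (measurable_coord (lift ord0 j)).
exists (fun k => g @^-1` (F k `*` G k)).
  rewrite -preimage_bigcup; apply/esym/seteqP; split => // x _.
  have [i _ Fi] : (\bigcup_i F i) (g x).1 by rewrite -FT.
  have [j _ Gj] : (\bigcup_i G i) (g x).2 by rewrite -GT.
  exists (maxn i j) => //; split.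
  - by move: Fi; exact/subsetPset/ndF/leq_maxl.
  - by move: Gj; exact/subsetPset/ndG/leq_maxr.
move=> k; have [mF Fk] := Foo k; have [mG Gk] := Goo k; split.
  rewrite -[X in measurable X]setTI; apply: mg => //; exact: measurableX.
rewrite /lebesgue_rV_step -comp_preimage (_ : g \o _ = id); last first.
  by apply/funext => z; exact: gK.
rewrite preimage_id product_measure1E // lte_mul_pinfty // ge0_fin_numE //.
Qed.

HB.instance Definition _ := Measure_isSigmaFinite.Build _ _ _
  lebesgue_rV_step step_sigma_finite.

End lebesgue_step.

(* Lebesgue measure on R^n: lambda^0 is the Dirac mass at the only point, and
   lambda^{n+1} is the image of lambda \x lambda^n under (a, y) |-> row_mx a y. *)
Fixpoint lebesgue_rV n : {sigma_finite_measure set 'rV[R]_n -> \bar R} :=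
  match n with
  | 0 => \d_(0 : 'rV[R]_0)
  | n'.+1 => lebesgue_rV_step (lebesgue_rV n')
  end.

End lebesgue_measure_row_vector.

Lemma lebesgue_rV_box (R : realType) n (A : 'I_n -> set R) :
  (forall i, measurable (A i)) ->
  lebesgue_rV n [set x : 'rV[R]_n | forall i, A i (x ord0 i)] =
  (\prod_(i < n) lebesgue_measure (A i))%E.
Proof.
elim: n A => [|n ih] A mA.
  by rewrite big_ord0 /= diracE mem_set //= => -[].
rewrite big_ord_recl -ih // /= /lebesgue_rV_step -product_measure1E //; last first.
  rewrite [X in measurable X](_ : _ = \bigcap_(i in [set: 'I_n])
     ((fun x : 'rV[R]_n => x ord0 i) @^-1` A (lift ord0 i))); last first.
    by apply/seteqP; split => [x Ax i _|x Ax i]; exact: Ax.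
  apply: fin_bigcap_measurable; first exact: finite_finset.
  by move=> i _; rewrite -[X in measurable X]setTI; apply: measurable_coord.
  exact: mA.
congr (product_measure1 _ _ _); apply/seteqP; split => [[a y]/= Aay|[a y]/= [Aa Ay] i].
  split; first by have := Aay ord0; rewrite rV_consE unlift_none.
  by move=> i; have := Aay (lift ord0 i); rewrite rV_consE liftK.
by rewrite rV_consE; case: unliftP => [j|] ->.
Qed.

Section sobolev.
Context {R : realType} {d : nat} (Omega : set 'rV[R]_d).
Implicit Types (u v : 'rV[R]_d -> R) (w : 'I_d -> 'rV[R]_d -> R).

Definition inner (u v : 'rV[R]_d -> R) : R := \int[lebesgue_rV d]_(x in Omega) (u x * v x).

Definition L2norm (u : 'rV[R]_d -> R) : R := Num.sqrt (inner u u).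

Definition L2_space : set ('rV[R]_d -> R) :=
  [set u : 'rV[R]_d -> R | measurable_fun Omega u /\
    (\int[lebesgue_rV d]_(x in Omega) (u x ^+ 2)%:E < +oo)%E].

Definition partial (i : 'I_d) (u : 'rV[R]_d -> R) : 'rV[R]_d -> R :=
  fun x => 'D_(delta_mx ord0 i) u x.

Definition smooth (u : 'rV[R]_d -> R) : Prop := forall (s : seq 'I_d),
  continuous (foldr partial u s) /\
  forall (i : 'I_d) x, derivable (foldr partial u s) x (delta_mx ord0 i).

Definition test_function : set ('rV[R]_d -> R) :=
  [set phi : 'rV[R]_d -> R | [/\ smooth phi, compact (closure [set x | phi x != 0]) &
                 closure [set x | phi x != 0] `<=` Omega]].

Definition weak_partial (i : 'I_d) (u : 'rV[R]_d -> R) : set ('rV[R]_d -> R) :=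
  [set g : 'rV[R]_d -> R | L2_space g /\ forall phi, test_function phi ->
    inner u (partial i phi) = - inner g phi].

(* The weak derivative, which is unique up to a null set; an arbitrary function
   if there is none in L^2. *)
Definition wd (i : 'I_d) (u : 'rV[R]_d -> R) : 'rV[R]_d -> R := get (weak_partial i u).

Definition H1_space : set ('rV[R]_d -> R) :=
  [set u : 'rV[R]_d -> R | L2_space u /\ forall i, weak_partial i u !=set0].

Definition H2_space : set ('rV[R]_d -> R) :=
  [set u : 'rV[R]_d -> R | H1_space u /\ forall i, H1_space (wd i u)].

Definition semi1 u : R := Num.sqrt (\sum_i L2norm (wd i u) ^+ 2).

Definition norm1 u : R := Num.sqrt (L2norm u ^+ 2 + semi1 u ^+ 2).

(* The Frobenius norm of the Hessian: mixed derivatives are counted twice. *)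
Definition semi2 u : R :=
  Num.sqrt (\sum_i \sum_j L2norm (wd j (wd i u)) ^+ 2).

Definition norm2 u : R := Num.sqrt (norm1 u ^+ 2 + semi2 u ^+ 2).

Definition H10_space : set ('rV[R]_d -> R) :=
  [set u : 'rV[R]_d -> R | H1_space u /\ forall e, 0 < e ->
    exists2 phi, test_function phi & norm1 (u - phi) < e].

Definition vL2_space : set ('I_d -> 'rV[R]_d -> R) := [set w : 'I_d -> 'rV[R]_d -> R | forall i, L2_space (w i)].
Definition vH10_space : set ('I_d -> 'rV[R]_d -> R) := [set w : 'I_d -> 'rV[R]_d -> R | forall i, H10_space (w i)].
Definition vH2_space : set ('I_d -> 'rV[R]_d -> R) := [set w : 'I_d -> 'rV[R]_d -> R | forall i, H2_space (w i)].
Definition vinner (w z : 'I_d -> 'rV[R]_d -> R) : R :=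
  \sum_i inner (w i) (z i).
Definition vnorm1 w : R := Num.sqrt (\sum_i norm1 (w i) ^+ 2).
Definition vsemi2 w : R := Num.sqrt (\sum_i semi2 (w i) ^+ 2).
Definition vnorm2 w : R := Num.sqrt (\sum_i norm2 (w i) ^+ 2).

Definition strain w (i j : 'I_d) : 'rV[R]_d -> R :=
  fun x => (wd j (w i) x + wd i (w j) x) / 2.

Definition div w : 'rV[R]_d -> R := fun x => \sum_i wd i (w i) x.

Definition inner_grad u v : R := \sum_i inner (wd i u) (wd i v).

End sobolev.

Section bochner.
Context {R : realType} {V : lmodType R} (X : set V) (N : V -> R).
(* X is a space with (semi)norm N. Since its elements are functions rather than
   classes modulo equality almost everywhere, y is determined by
   [bochner_integral] only up to elements of X of norm 0. *)

Record step_function := StepFunction {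
  step_size : nat;
  step_set : 'I_step_size -> set R;
  step_val : 'I_step_size -> V }.

Definition step_in (s : step_function) : Prop :=
  forall i, measurable (@step_set s i) /\ X (step_val i).

Definition step_eval (s : step_function) (t : R) : V :=
  \sum_i (\1_(@step_set s i) t) *: step_val i.

Definition step_integral (D : set R) (s : step_function) : V :=
  \sum_i fine (lebesgue_measure (@step_set s i `&` D)) *: step_val i.

Definition step_approx (D : set R) (g : R -> V) (s : nat -> step_function) :=
  (forall k, step_in (s k)) /\
  {ae lebesgue_measure, forall t, D t ->
     X (g t) /\ N (g t - step_eval (s k) t) @[k --> \oo] --> 0}.

Definition bochner_Lq (q : \bar R) (D : set R) : set (R -> V) :=
  [set g | (exists s, step_approx D g s) /\
    ('N[lebesgue_measure]_q [ EFin \o ((fun t => N (g t)) \_ D) ] < +oo)%E].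

Definition bochner_integral (D : set R) (g : R -> V) (y : V) : Prop :=
  X y /\ exists s, [/\ step_approx D g s,
    (\int[lebesgue_measure]_(t in D) (N (g t - step_eval (s k) t))%:E)%E
       @[k --> \oo] --> 0%E &
    N (y - step_integral D (s k)) @[k --> \oo] --> 0].

(* g is the absolutely continuous representative of an element of
   W^{1,1}(0, T; X) and g' is its derivative. *)
Definition time_derivative (T : R) (g g' : R -> V) : Prop :=
  forall a b, 0 <= a -> a <= b -> b <= T ->
    bochner_integral `[a, b] g' (g b - g a).

End bochner.

Section forms.
Context {R : realType} {d : nat} (Omega : set 'rV[R]_d).
Context (lambda mu : R) (K : 'rV[R]_d -> 'M[R]_d).
Implicit Types (p q : 'rV[R]_d -> R) (u v : 'I_d -> 'rV[R]_d -> R).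

Definition domain : Prop :=
  [/\ open Omega, connected Omega, Omega !=set0 & bounded_set Omega].

Definition enorm (x : 'rV[R]_d) : R := Num.sqrt (\sum_i x ord0 i ^+ 2).

(* A tensor field that is measurable, symmetric, bounded and uniformly positive
   definite; this includes every constant symmetric positive definite tensor. *)
Definition conductivity : Prop :=
  [/\ forall i j, measurable_fun Omega (fun x => K x i j),
      forall x, Omega x -> (K x)^T = K x &
      exists k : R * R, 0 < k.1 /\ forall x, Omega x -> forall xi : 'rV[R]_d,
        k.1 * enorm xi ^+ 2 <= (xi *m K x *m xi^T) ord0 ord0
          <= k.2 * enorm xi ^+ 2].

Definition form_a u v : R :=
  2 * mu * (\int[lebesgue_rV d]_(x in Omega)
    \sum_i \sum_j strain Omega u i j x * strain Omega v i j x)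
  + lambda * (\int[lebesgue_rV d]_(x in Omega) (div Omega u x * div Omega v x)).

Definition form_ap p q : R :=
  \int[lebesgue_rV d]_(x in Omega)
    \sum_i \sum_j K x i j * wd Omega j p x * wd Omega i q x.

Definition norm_a v : R := Num.sqrt (form_a v v).
Definition norm_ap q : R := Num.sqrt (form_ap q q).

Definition norm_tau_h (eps tau h : R) u p : R :=
  Num.sqrt (norm_a u ^+ 2 + tau * norm_ap p ^+ 2
            + eps * h ^+ 2 * semi1 Omega p ^+ 2).

Definition biot_solution (T : R) (f u ut : R -> 'I_d -> 'rV[R]_d -> R)
    (p : R -> 'rV[R]_d -> R) : Prop :=
  [/\ forall t, 0 < t <= T -> vH10_space Omega (u t) /\ H10_space Omega (p t),
      forall t, 0 < t <= T -> forall v, vH10_space Omega v ->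
        form_a (u t) v - inner Omega (div Omega v) (p t)
        = vinner Omega (f t) v,
      forall t, 0 < t <= T -> forall q, H10_space Omega q ->
        - inner Omega (div Omega (ut t)) q - form_ap (p t) q = 0 &
      [/\ vH10_space Omega (u 0), L2_space Omega (p 0),
          forall v, vH10_space Omega v ->
            form_a (u 0) v - inner Omega (div Omega v) (p 0)
            = vinner Omega (f 0) v &
          forall q, L2_space Omega q -> - inner Omega (div Omega (u 0)) q = 0]].

Definition biot_regularity (T : R) (u ut utt : R -> 'I_d -> 'rV[R]_d -> R)
    (p pt ptt : R -> 'rV[R]_d -> R) : Prop :=
  let vLH10 := bochner_Lq (vH10_space Omega) (vnorm1 Omega) in
  let vLH2 := bochner_Lq (vH2_space Omega) (vnorm2 Omega) in
  let LH10 := bochner_Lq (H10_space Omega) (norm1 Omega) in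
  let LH2 := bochner_Lq (H2_space Omega) (norm2 Omega) in
  let I : set R := `]0, T]%classic in
  [/\ [/\ time_derivative (vH10_space Omega) (vnorm1 Omega) T u ut,
          time_derivative (vH10_space Omega) (vnorm1 Omega) T ut utt,
          time_derivative (H10_space Omega) (norm1 Omega) T p pt &
          time_derivative (H10_space Omega) (norm1 Omega) T pt ptt],
      [/\ vLH10 +oo%E I u, vLH2 +oo%E I u, LH10 +oo%E I p & LH2 +oo%E I p],
      forall s : \bar R, s = 1%E \/ s = 2%:E ->
        [/\ vLH2 s I ut, vLH10 s I utt, LH2 s I pt & LH10 s I ptt] &
      forall q : \bar R, [\/ q = 1%E, q = 2%:E | q = +oo%E] -> LH10 q I pt].

End forms.

Section finite_elements.
Context {R : realType} {d : nat} (Omega : set 'rV[R]_d).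

(* A d-simplex is given by its d + 1 vertices, the rows of a matrix, and a mesh
   by the list of its simplices. *)
Definition face (S : 'M[R]_(d.+1, d)) (P : pred 'I_d.+1) : set 'rV[R]_d :=
  [set x | exists l : 'rV[R]_d.+1,
    [/\ forall i, 0 <= l ord0 i, \sum_i l ord0 i = 1,
        forall i, ~~ P i -> l ord0 i = 0 & x = l *m S]].

Definition hull (S : 'M[R]_(d.+1, d)) : set 'rV[R]_d := face S predT.

Definition vertex_matrix (S : 'M[R]_(d.+1, d)) : 'M[R]_(1 + d) :=
  row_mx (const_mx 1 : 'cV_(d.+1)) S.

Definition barycentric (S : 'M[R]_(d.+1, d)) (x : 'rV[R]_d) : 'rV[R]_(1 + d) :=
  row_mx (1%:M : 'rV_1) x *m invmx (vertex_matrix S).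

Definition simplicial_mesh (Th : seq 'M[R]_(d.+1, d)) : Prop :=
  [/\ forall S, S \in Th -> vertex_matrix S \in unitmx,
      forall S, S \in Th -> interior (hull S) `<=` Omega,
      closure Omega = \bigcup_(S in [set` Th]) hull S &
      forall S S', S \in Th -> S' \in Th ->
        hull S `&` hull S' = face S [pred i | [exists j, row i S == row j S']]].

Definition mesh_size (Th : seq 'M[R]_(d.+1, d)) : R :=
  \big[Num.max/0]_(S <- Th) \big[Num.max/0]_(i < d.+1) \big[Num.max/0]_(j < d.+1)
    enorm (row i S - row j S).

(* Continuous piecewise linears vanishing on the boundary of Omega, extended by
   0 outside Omega. *)
Definition P1_space (Th : seq 'M[R]_(d.+1, d)) : set ('rV[R]_d -> R) :=
  [set q : 'rV[R]_d -> R | [/\ H10_space Omega q, continuous q, forall x, ~ Omega x -> q x = 0 &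
    forall S, S \in Th -> exists (a : 'cV[R]_d) (b : R),
      forall x, hull S x -> q x = (x *m a) ord0 ord0 + b]].

(* The product of the barycentric coordinates on S, extended by 0: outside S at
   least one barycentric coordinate is negative. *)
Definition bubble (S : 'M[R]_(d.+1, d)) : 'rV[R]_d -> R :=
  fun x => \prod_i Num.max 0 (barycentric S x ord0 i).

Inductive element := MINI | P1P1.

Definition velocity_space (E : element) (Th : seq 'M[R]_(d.+1, d)) :
    set ('I_d -> 'rV[R]_d -> R) :=
  match E with
  | MINI => [set v : 'I_d -> 'rV[R]_d -> R | vH10_space Omega v /\
      exists (w : 'I_d -> 'rV[R]_d -> R) (b : 'M[R]_(d.+1, d) -> 'I_d -> R),
        forall i, P1_space Th (w i) /\ v i = w i + \sum_(S <- Th) b S i *: bubble S]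
  | P1P1 => [set v : 'I_d -> 'rV[R]_d -> R | forall i, P1_space Th (v i)]
  end.

Definition pressure_space (Th : seq 'M[R]_(d.+1, d)) : set ('rV[R]_d -> R) :=
  P1_space Th.

Definition stabilization (E : element) (eps : R) : Prop :=
  match E with MINI => 0 <= eps | P1P1 => 0 < eps end.

End finite_elements.

Section discretization.
Context {R : realType} {d : nat} (Omega : set 'rV[R]_d).
Context (lambda mu : R) (K : 'rV[R]_d -> 'M[R]_d).
Context (Vh : set ('I_d -> 'rV[R]_d -> R)) (Qh : set ('rV[R]_d -> R)).

Local Notation vfield := ('I_d -> 'rV[R]_d -> R).
Local Notation field := ('rV[R]_d -> R).

Definition bdiff (V : lmodType R) (tau : R) (w : nat -> V) (n : nat) : V :=
  tau^-1 *: (w n - w n.-1).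

Definition discrete_scheme (T tau eps h : R) (f : R -> vfield)
    (uh : nat -> vfield) (ph : nat -> field) : Prop :=
  forall n, (1 <= n)%N -> n%:R * tau <= T ->
  [/\ Vh (uh n), Qh (ph n),
      forall v, Vh v ->
        form_a Omega lambda mu (uh n) v - inner Omega (div Omega v) (ph n)
        = vinner Omega (f (n%:R * tau)) v &
      forall q, Qh q ->
        - inner Omega (div Omega (bdiff tau uh n)) q - form_ap Omega K (ph n) q
        - eps * h ^+ 2 * inner_grad Omega (bdiff tau ph n) q = 0].

Definition initial_data_I (eps h : R) (f0 u0 : vfield) (p0 : field) : Prop :=
  (forall v, Vh v ->
     form_a Omega lambda mu u0 v - inner Omega (div Omega v) p0
     = vinner Omega f0 v) /\
  (forall q, Qh q ->
     - inner Omega (div Omega u0) q - eps * h ^+ 2 * inner_grad Omega p0 q = 0).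

(* The clause that the data violate [initial_data_I] is left out: it restricts
   nothing in the alternative I or II, and makes a result for II more general. *)
Definition initial_data_II (u0 : vfield) (p0 : field) : Prop :=
  {ae lebesgue_rV d, forall x, Omega x -> div Omega u0 x = 0} /\ p0 = 0.

Definition elliptic_projection (u : vfield) (p : field) (ub : vfield)
    (pb : field) : Prop :=
  [/\ Vh ub, Qh pb,
      forall q, Qh q -> form_ap Omega K pb q = form_ap Omega K p q &
      forall v, Vh v ->
        form_a Omega lambda mu ub v - inner Omega (div Omega v) pb
        = form_a Omega lambda mu u v - inner Omega (div Omega v) p].

Definition inf_sup (c c1 eps h : R) : Prop :=
  forall q, Qh q ->
    L2norm Omega q
    <= c * sup [set r | exists v, [/\ Vh v, v <> 0 &
                 r = inner Omega (div Omega v) q / norm_a Omega lambda mu v]]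
       + c1 * Num.sqrt eps * h * semi1 Omega q.

Definition approximation_bounds (c h : R) (ru : vfield) (rp : field)
    (u : vfield) (p : field) : Prop :=
  [/\ norm_a Omega lambda mu ru <= c * h * (vsemi2 Omega u + semi1 Omega p),
      norm1 Omega rp <= c * h * semi2 Omega p,
      norm_ap Omega K rp <= c * h * semi2 Omega p &
      L2norm Omega rp <= c * h ^+ 2 * semi2 Omega p].

(* The derivatives rut, rpt exist and are
   unique up to null sets, since the elliptic projections are bounded and
   linear; the existential only names them. *)
Definition projection_approximation (c h T : R) (u ut : R -> vfield)
    (p pt : R -> field) (ub : R -> vfield) (pb : R -> field) : Prop :=
  (forall t, 0 < t <= T ->
     approximation_bounds c h (u t - ub t) (p t - pb t) (u t) (p t)) /\
  exists (rut : R -> vfield) (rpt : R -> field),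
    [/\ time_derivative (vH10_space Omega) (vnorm1 Omega) T
          (fun t => u t - ub t) rut,
        time_derivative (H10_space Omega) (norm1 Omega) T (fun t => p t - pb t) rpt &
        {ae lebesgue_measure, forall t, 0 < t <= T ->
           approximation_bounds c h (rut t) (rpt t) (ut t) (pt t)}].

End discretization.

(* Main.v *)
Require Import Defs.
From HB Require Import structures.
From mathcomp Require Import all_boot all_order all_algebra.
From mathcomp Require Import all_classical all_reals all_analysis.
From mathcomp Require Import measurable_realfun ring lra.

(** The errors split as u(t_n) - u_h^n = rho_u - e_u^n and p(t_n) - p_h^n =
    rho_p - e_p^n through the elliptic projections. The parts rho_u, rho_p are
    bounded by the approximation properties, so everything rests on bounds for
    the discrete parts e_u^n, e_p^n. Subtracting the scheme from the continuous
    problem and using the definition of the elliptic projection gives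
    - a momentum balance a(e_u^n, v) = (div v, e_p^n) without any right-hand side
      ([momentum_error]), and
    - a mass balance which is one step of the scheme driven by the defects
      tau u'(t_n) - (ub(t_n) - ub(t_{n-1})), seen through its divergence, and
      eps h^2 times the gradient of pb(t_n) - pb(t_{n-1}) ([mass_error]).

    Stability. For a pair in momentum balance the inf-sup condition bounds the
    L^2 norm of the pressure by C (|v|_a + eps^(1/2) h |grad q|)
    ([inf_sup_stability]), so the defects can be absorbed. Write g_j for the sum
    of the two defect norms in step j.
    - Testing the mass balance with e_p^n itself yields
      |(e_u^n, e_p^n)| <= |(e_u^{n-1}, e_p^{n-1})| + 2 C g_n ([energy_stability]),
      hence the bounds in the energy norm and, once more by the inf-sup
      condition, in L^2 ([pressure_L2_stability]).
    - Testing it with e_p^n - e_p^{n-1}, which is in momentum balance with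
      e_u^n - e_u^{n-1} as soon as both time levels are, yields
      |e_p^n|_ap^2 <= |e_p^{n-1}|_ap^2 + 2 C^2 g_n^2 / tau
      ([pressure_stability]). At the first step this needs the momentum balance
      at time 0, which is what the discrete Stokes initial data provide.
    - For other initial data the first step is taken with the energy identity,
      whose term tau |e_p^1|_ap^2 is at most half the initial energy plus
      C^2 g_1^2; this is the source of the factor (2 tau)^(-1/2)
      ([pressure_smoothing]).

    Consistency. Writing tau u'(t_j) - (ub(t_j) - ub(t_{j-1})) as the increment of
    rho_u minus the Taylor remainder of u, and similarly for the pressure, bounds
    g_j by integrals over [t_{j-1}, t_j] of the second time derivatives (with a
    factor tau) and of the approximation error of the first ones (with a factor
    h), plus tau eps^(1/2) h |grad p'(t_j)| ([velocity_consistency],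
    [pressure_increment]). Summing the g_j, or the g_j^2 / tau with the
    Cauchy-Schwarz inequality on each cell, gives the rates ([defect_sum],
    [defect_sum_sqr]).

    The functional analysis behind these lines is developed first. Weak
    derivatives are chosen representatives of classes modulo null sets, so each
    (semi)norm is shown to come from a semi-inner product on the right subspace
    ([semi_inner]). This uses that the weak derivative is unique, i.e. the
    fundamental lemma of the calculus of variations, and that test functions are
    in H^1, which amounts to the vanishing of the integral of a partial derivative
    with bounded support. In time, the curves are differentiable in the sense of
    Bochner integrals; increments and Taylor remainders are bounded by pairing
    step functions with a fixed vector, and since t |-> norm (g t) is measurable
    only up to a null set, the estimates are written for integrals of nonnegative
    functions that need not be measurable. *)

Set Implicit Arguments.
Unset Strict Implicit.
Unset Printing Implicit Defensive.

Import Order.TTheory GRing.Theory Num.Theory.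
Import numFieldNormedType.Exports.

Local Open Scope classical_set_scope.
Local Open Scope ring_scope.

(** * Semi-inner products on subspaces *)

Section semi_inner_products.
Context {R : realType}.

Definition lsubspace (V : lmodType R) (X : set V) : Prop :=
  X 0 /\ forall a u v, X u -> X v -> X (a *: u + v).

Definition symform (V : lmodType R) (X : set V) (B : V -> V -> R) : Prop :=
  [/\ lsubspace X,
      forall a u v w, X u -> X v -> X w -> B (a *: u + v) w = a * B u w + B v w &
      forall u v, X u -> X v -> B u v = B v u].

(** The forms of the problem are bilinear and symmetric only on a subspace (H^1, the
    trial space...), outside of which weak derivatives are arbitrary functions; all
    norms below are seminorms on functions rather than norms on classes. *)
Definition semi_inner (V : lmodType R) (X : set V) (B : V -> V -> R) : Prop :=
  symform X B /\ forall u, X u -> 0 <= B u u.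

Definition fnorm (V : lmodType R) (B : V -> V -> R) (u : V) : R :=
  Num.sqrt (B u u).

Section subspace_theory.
Context {V : lmodType R} {X : set V} (sX : lsubspace X).

Lemma sub0 : X 0. Proof. exact: sX.1. Qed.

Lemma subD u v : X u -> X v -> X (u + v).
Proof. by move=> Xu Xv; have := sX.2 1 _ _ Xu Xv; rewrite scale1r. Qed.

Lemma subZ a u : X u -> X (a *: u).
Proof. by move=> Xu; have := sX.2 a _ _ Xu sub0; rewrite addr0. Qed.

Lemma subB u v : X u -> X v -> X (u - v).
Proof.
by move=> Xu Xv; have := sX.2 (-1) _ _ Xv Xu; rewrite scaleN1r addrC.
Qed.

Lemma sub_sum (I : Type) (r : seq I) (F : I -> V) :
  (forall i, X (F i)) -> X (\sum_(i <- r) F i).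
Proof.
move=> XF; elim: r => [|i r ih]; first by rewrite big_nil; exact: sub0.
by rewrite big_cons; apply: subD.
Qed.

End subspace_theory.

Section symform_theory.
Context {V : lmodType R} {X : set V} {B : V -> V -> R} (sB : symform X B).

Let sX : lsubspace X. Proof. by case: sB. Qed.

Lemma symform_sub : lsubspace X. Proof. exact: sX. Qed.

Lemma symformC u v : X u -> X v -> B u v = B v u.
Proof. by case: sB => _ _; apply. Qed.

Lemma symformP a u v w : X u -> X v -> X w ->
  B (a *: u + v) w = a * B u w + B v w.
Proof. by case: sB => _ + _; apply. Qed.

Lemma symformDl u v w : X u -> X v -> X w -> B (u + v) w = B u w + B v w.
Proof. by move=> Xu Xv Xw; have := symformP 1 Xu Xv Xw; rewrite scale1r mul1r. Qed.

Lemma symformBl u v w : X u -> X v -> X w -> B (u - v) w = B u w - B v w.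
Proof.
move=> Xu Xv Xw; have := symformP (-1) Xv Xu Xw.
by rewrite scaleN1r addrC mulN1r [in RHS]addrC.
Qed.

Lemma symform0l w : X w -> B 0 w = 0.
Proof.
move=> Xw; have := symformDl (sub0 sX) (sub0 sX) Xw.
by rewrite addr0; lra.
Qed.

Lemma symformZl a u w : X u -> X w -> B (a *: u) w = a * B u w.
Proof.
move=> Xu Xw; have := symformP a Xu (sub0 sX) Xw.
by rewrite addr0 symform0l // addr0.
Qed.

Lemma symform_suml (I : Type) (r : seq I) (F : I -> V) w :
  (forall i, X (F i)) -> X w -> B (\sum_(i <- r) F i) w = \sum_(i <- r) B (F i) w.
Proof.
move=> XF Xw; elim: r => [|i r ih]; first by rewrite !big_nil symform0l.
by rewrite !big_cons symformDl ?ih //; exact: sub_sum.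
Qed.

Lemma symformDr u v w : X u -> X v -> X w -> B w (u + v) = B w u + B w v.
Proof.
by move=> Xu Xv Xw; rewrite !(symformC Xw) ?symformDl //; exact: subD.
Qed.

Lemma symformBr u v w : X u -> X v -> X w -> B w (u - v) = B w u - B w v.
Proof.
by move=> Xu Xv Xw; rewrite !(symformC Xw) ?symformBl //; exact: subB.
Qed.

Lemma symformZr a u w : X u -> X w -> B w (a *: u) = a * B w u.
Proof.
by move=> Xu Xw; rewrite !(symformC Xw) ?symformZl //; exact: subZ.
Qed.

End symform_theory.

Section semi_inner_theory.
Context {V : lmodType R} {X : set V} {B : V -> V -> R} (sB : semi_inner X B).

Let sF : symform X B := sB.1.
Let sX : lsubspace X := symform_sub sF.

Lemma fnorm_ge0 u : 0 <= fnorm B u. Proof. exact: sqrtr_ge0. Qed.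

Lemma fnorm_sqr u : X u -> fnorm B u ^+ 2 = B u u.
Proof. by move=> Xu; rewrite sqr_sqrtr //; exact: sB.2. Qed.

Lemma semi_inner_CS_sqr u v : X u -> X v -> B u v ^+ 2 <= B u u * B v v.
Proof.
move=> Xu Xv.
have q t : 0 <= t ^+ 2 * B u u + 2 * t * B u v + B v v.
  have X1 : X (t *: u) := subZ sX t Xu.
  have := sB.2 _ (subD sX X1 Xv).
  rewrite (symformDl sF) ?(symformDr sF) ?(symformZl sF) ?(symformZr sF) //;
    try exact: (subD sX).
  by rewrite (symformC sF Xv Xu); congr (_ <= _); ring.
have a0 := sB.2 _ Xu; have c0 := sB.2 _ Xv.
move: (B u u) (B u v) (B v v) q a0 c0 => a b c q a0 c0.
have [a_eq0|a_neq0] := eqVneq a 0; last first.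
  have a_gt0 : 0 < a by rewrite lt_neqAle eq_sym a_neq0.
  (* the minimum over t of a t^2 + 2 b t + c *)
  have := q (- b / a).
  have -> : (- b / a) ^+ 2 * a + 2 * (- b / a) * b + c = c - b ^+ 2 / a by field.
  by rewrite subr_ge0 ler_pdivrMr // mulrC.
have [->|b0] := eqVneq b 0; first by rewrite expr0n mulr_ge0.
(* for a = 0 the affine function 2 b t + c takes the value -1 at this t *)
have := q (- (c + 1) / (2 * b)); rewrite a_eq0.
have -> : (- (c + 1) / (2 * b)) ^+ 2 * 0 + 2 * (- (c + 1) / (2 * b)) * b + c = -1.
  by field.
by rewrite oppr_ge0 ler10.
Qed.

Lemma semi_inner_CS u v : X u -> X v -> `|B u v| <= fnorm B u * fnorm B v.
Proof.
move=> Xu Xv; rewrite -sqrtrM; last exact: sB.2.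
by rewrite -sqrtr_sqr ler_wsqrtr // semi_inner_CS_sqr.
Qed.

Lemma fnormD u v : X u -> X v -> fnorm B (u + v) <= fnorm B u + fnorm B v.
Proof.
move=> Xu Xv; have XD := subD sX Xu Xv.
rewrite -(@ler_pXn2r _ 2) ?nnegrE ?addr_ge0 ?fnorm_ge0 // fnorm_sqr //.
rewrite (symformDl sF) ?(symformDr sF) // (symformC sF Xv Xu) -!fnorm_sqr //.
have := semi_inner_CS Xu Xv; have := ler_norm (B u v).
by set x := fnorm B u; set y := fnorm B v; nra.
Qed.

Lemma fnormZ a u : X u -> fnorm B (a *: u) = `|a| * fnorm B u.
Proof.
move=> Xu; have XZ := subZ sX a Xu.
rewrite /fnorm (symformZl sF) // (symformZr sF) // mulrA -expr2.
by rewrite sqrtrM ?sqr_ge0 // sqrtr_sqr.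
Qed.

Lemma fnormB u v : X u -> X v -> fnorm B (u - v) <= fnorm B u + fnorm B v.
Proof.
move=> Xu Xv; rewrite -scaleN1r; apply: le_trans (fnormD Xu (subZ sX _ Xv)) _.
by rewrite fnormZ // normrN1 mul1r.
Qed.

Lemma fnormC u v : X u -> X v -> fnorm B (u - v) = fnorm B (v - u).
Proof.
move=> Xu Xv; have -> : u - v = -1 *: (v - u) by rewrite scaleN1r opprB.
by rewrite fnormZ ?normrN1 ?mul1r //; exact: (subB sX).
Qed.

Lemma fnorm_dist u v : X u -> X v -> `|fnorm B u - fnorm B v| <= fnorm B (u - v).
Proof.
move=> Xu Xv; rewrite ler_norml lerNl opprB !lerBlDr; apply/andP; split.
  by rewrite fnormC // -{1}[v](subrK u) fnormD //; exact: (subB sX).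
by rewrite -{1}[u](subrK v) fnormD //; exact: (subB sX).
Qed.

Lemma fnorm_sum (I : Type) (r : seq I) (F : I -> V) : (forall i, X (F i)) ->
  fnorm B (\sum_(i <- r) F i) <= \sum_(i <- r) fnorm B (F i).
Proof.
move=> XF; elim: r => [|i r ih].
  by rewrite !big_nil /fnorm (symform0l sF) ?sqrtr0 //; exact: (sub0 sX).
rewrite !big_cons; apply: le_trans (fnormD _ _) _ => //; first exact: (sub_sum sX).
by rewrite lerD2l.
Qed.

Lemma fnorm_sum_sqr (n : nat) (F : 'I_n -> V) : (forall i, X (F i)) ->
  fnorm B (\sum_i F i) ^+ 2 <= n%:R * \sum_i fnorm B (F i) ^+ 2.
Proof.
move=> XF; apply: (@le_trans _ _ ((\sum_i fnorm B (F i)) ^+ 2)).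
  rewrite ler_pXn2r ?nnegrE ?fnorm_ge0 ?sumr_ge0 ?fnorm_sum // => i _.
  exact: fnorm_ge0.
elim: n F XF => [|n ih] F XF; first by rewrite !big_ord0 expr0n mulr0.
rewrite !big_ord_recr /=.
have {ih} := ih (fun i => F (widen_ord (leqnSn n) i)) (fun i => XF _).
have : 2 * (\sum_(i < n) fnorm B (F (widen_ord (leqnSn n) i))) *
    fnorm B (F ord_max) <=
    \sum_(i < n) fnorm B (F (widen_ord (leqnSn n) i)) ^+ 2 +
    n%:R * fnorm B (F ord_max) ^+ 2.
  have -> : n%:R * fnorm B (F ord_max) ^+ 2 = \sum_(i < n) fnorm B (F ord_max) ^+ 2.
    by rewrite sumr_const card_ord mulr_natl.
  rewrite mulr_sumr mulr_suml -big_split /=; apply: ler_sum => i _.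
  rewrite -subr_ge0.
  set x := fnorm _ _; set y := fnorm _ _.
  have -> : x ^+ 2 + y ^+ 2 - 2 * x * y = (x - y) ^+ 2 by ring.
  exact: sqr_ge0.
rewrite -[n.+1%:R]natr1.
move: (\sum_(i < n) fnorm B _) (\sum_(i < n) fnorm B _ ^+ 2) (fnorm B _).
by move=> s q z h1 h2; nra.
Qed.

End semi_inner_theory.

(** Weak derivatives are chosen up to null functions, so [D (a *: u + v)] and
    [a *: D u + D v] may differ pointwise; they have the same products with [Y]. *)
Definition weakly_linear (V W : lmodType R) (X : set V) (Y : set W)
    (B : W -> W -> R) (D : V -> W) : Prop :=
  (forall u, X u -> Y (D u)) /\
  forall a u v w, X u -> X v -> Y w ->
    B (D (a *: u + v)) w = a * B (D u) w + B (D v) w.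

Section constructions.
Context {V W : lmodType R} {X : set V} {Y : set W}.

Lemma symformD_form B1 B2 : symform X B1 -> symform X B2 ->
  symform X (fun u v : V => B1 u v + B2 u v).
Proof.
move=> [sX l1 c1] [_ l2 c2]; split => // [a u v w Xu Xv Xw|u v Xu Xv].
  by rewrite l1 // l2 //; ring.
by rewrite c1 // c2.
Qed.

Lemma symformZ_form k B1 : symform X B1 -> symform X (fun u v : V => k * B1 u v).
Proof.
move=> [sX l1 c1]; split => // [a u v w Xu Xv Xw|u v Xu Xv].
  by rewrite l1 //; ring.
by rewrite c1.
Qed.

Lemma symform_sum_form (I : finType) (B : I -> V -> V -> R) : lsubspace X ->
  (forall i, symform X (B i)) -> symform X (fun u v : V => \sum_i B i u v).
Proof.
move=> sX sB; split => // [a u v w Xu Xv Xw|u v Xu Xv].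
  rewrite mulr_sumr -big_split; apply: eq_bigr => i _.
  exact: symformP (sB i) _ _ _ _ Xu Xv Xw.
by apply: eq_bigr => i _; exact: symformC (sB i) _ _ Xu Xv.
Qed.

Lemma semi_innerD B1 B2 : semi_inner X B1 -> semi_inner X B2 ->
  semi_inner X (fun u v : V => B1 u v + B2 u v).
Proof.
move=> [s1 p1] [s2 p2]; split; first exact: symformD_form.
by move=> u Xu; rewrite addr_ge0 ?p1 ?p2.
Qed.

Lemma semi_inner_sum (I : finType) (B : I -> V -> V -> R) : lsubspace X ->
  (forall i, semi_inner X (B i)) -> semi_inner X (fun u v : V => \sum_i B i u v).
Proof.
move=> sX sB; split; first by apply: symform_sum_form => // i; exact: (sB i).1.
by move=> u Xu; apply: sumr_ge0 => i _; exact: (sB i).2.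
Qed.

Lemma symform_pull B D : lsubspace X -> symform Y B -> weakly_linear X Y B D ->
  symform X (fun u v => B (D u) (D v)).
Proof.
move=> sX sB [DY Dl]; split => // [a u v w Xu Xv Xw|u v Xu Xv].
  by rewrite Dl //; exact: DY.
by rewrite (symformC sB) //; exact: DY.
Qed.

Lemma semi_inner_pull B D : lsubspace X -> semi_inner Y B -> weakly_linear X Y B D ->
  semi_inner X (fun u v => B (D u) (D v)).
Proof.
move=> sX [sB pB] wD; split; first exact: symform_pull.
by move=> u Xu; apply/pB/wD.1.
Qed.

Lemma weakly_linearD B D1 D2 : lsubspace X -> symform Y B ->
  weakly_linear X Y B D1 -> weakly_linear X Y B D2 ->
  weakly_linear X Y B (fun u : V => D1 u + D2 u).
Proof.
move=> sX sB [Y1 l1] [Y2 l2]; have sY := symform_sub sB; split=> [u Xu|b u v w Xu Xv Yw].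
  by apply: subD => //; [exact: Y1|exact: Y2].
have Xuv := sX.2 b _ _ Xu Xv.
rewrite !(symformDl sB) //; try by [exact: Y1|exact: Y2].
by rewrite l1 // l2 //; ring.
Qed.

Lemma weakly_linearZ B D1 a : lsubspace X -> symform Y B ->
  weakly_linear X Y B D1 -> weakly_linear X Y B (fun u : V => a *: D1 u).
Proof.
move=> sX sB [Y1 l1]; have sY := symform_sub sB; split=> [u Xu|b u v w Xu Xv Yw].
  by apply: subZ => //; exact: Y1.
have Xuv := sX.2 b _ _ Xu Xv.
rewrite !(symformZl sB) //; try exact: Y1.
by rewrite l1 //; ring.
Qed.

Lemma weakly_linear0 B : symform Y B -> weakly_linear X Y B (fun _ : V => 0).
Proof.
move=> sB; have sY := symform_sub sB; split => [u _|a u v w _ _ Yw]; first exact: sub0.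
by rewrite (symform0l sB) // mulr0 addr0.
Qed.

Lemma weakly_linear_sum (I : Type) (r : seq I) B (D : I -> V -> W) :
  lsubspace X -> symform Y B -> (forall i, weakly_linear X Y B (D i)) ->
  weakly_linear X Y B (fun u : V => \sum_(i <- r) D i u).
Proof.
move=> sX sB lD; elim: r => [|i r ih].
  under [X in weakly_linear _ _ _ X]eq_fun do rewrite big_nil.
  exact: weakly_linear0.
under [X in weakly_linear _ _ _ X]eq_fun do rewrite big_cons.
exact: weakly_linearD.
Qed.

Lemma lsubspace_family (I : Type) : lsubspace X ->
  lsubspace [set w : I -> V | forall i, X (w i)].
Proof.
move=> sX; split => [i|a u v Xu Xv i]; first exact: sub0.
exact: sX.2.
Qed.

End constructions.

Lemma symform_subset (V : lmodType R) (X Y : set V) B : lsubspace X ->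
  X `<=` Y -> symform Y B -> symform X B.
Proof.
move=> sX XY [_ l c]; split => // [a u v w Xu Xv Xw|u v Xu Xv].
  by apply: l; exact: XY.
by apply: c; exact: XY.
Qed.

Lemma semi_inner_subset (V : lmodType R) (X Y : set V) B : lsubspace X ->
  X `<=` Y -> semi_inner Y B -> semi_inner X B.
Proof.
move=> sX XY [l c]; split; first exact: symform_subset l.
by move=> u /XY; exact: c.
Qed.

Lemma semi_inner_family (V : lmodType R) (X : set V) B (I : finType) :
  semi_inner X B ->
  semi_inner [set w : I -> V | forall i, X (w i)]
    (fun w z => \sum_i B (w i) (z i)).
Proof.
move=> sB; have sX := symform_sub sB.1.
apply: semi_inner_sum => [|i]; first exact: lsubspace_family.
apply: (@semi_inner_pull _ _ _ X B (fun w => w i)) => //.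
  exact: lsubspace_family.
split=> [w|a u v w Xu Xv Xw]; first exact.
by rewrite (symformP sB.1).
Qed.

End semi_inner_products.

(** * Integrals of nonnegative functions without measurability *)

Section lower_integral.
Context {d : measure_display} {T : measurableType d} {R : realType}.
Context (mu : {measure set T -> \bar R}).
Implicit Types (D E F : set T) (f g : T -> R).
Import HBNNSimple.

Lemma ae_mono (P Q : T -> Prop) : (forall x, P x -> Q x) ->
  {ae mu, forall x, P x} -> {ae mu, forall x, Q x}.
Proof. by move=> PQ; apply: filterS. Qed.

Lemma ae_mono2 (P1 P2 Q : T -> Prop) : (forall x, P1 x -> P2 x -> Q x) ->
  {ae mu, forall x, P1 x} -> {ae mu, forall x, P2 x} -> {ae mu, forall x, Q x}.
Proof. by move=> PQ; apply: filterS2. Qed.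

Local Notation I D f := (\int[mu]_(x in D) (f x)%:E)%E.

Lemma lint_ge0 D f : (forall x, 0 <= f x) -> (0 <= I D f)%E.
Proof. by move=> f0; apply: integral_ge0 => x _; rewrite lee_fin. Qed.

(** Nearly optimal simple minorants reduce statements on arbitrary nonnegative
    functions to measurable ones. *)
Lemma lint_minorant D f (e : R) : (forall x, 0 <= f x) -> (I D f < +oo)%E -> 0 < e ->
  exists h : {nnsfun T >-> R},
    [/\ forall x, h x <= f x, forall x, ~ D x -> h x = 0 &
        (I D f <= I setT h + e%:E)%E].
Proof.
move=> f0 ffin e0; have I0 := lint_ge0 D f0.
have Ifin : (I D f \is a fin_num) by rewrite ge0_fin_numE.
move: Ifin; rewrite ge0_integralE; last by move=> x _; rewrite lee_fin.
move=> Ifin; have [_ [h /= hf <-]] := ub_ereal_sup_adherent e0 Ifin.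
rewrite EFinN lteBlDr // => /ltW le_I; exists h; split.
- move=> x; have := hf x; rewrite patchE; case: ifP => _; rewrite lee_fin //.
  by move/le_trans; apply.
- move=> x Dx; have := hf x; rewrite patchE memNset // lee_fin => hx.
  by apply/eqP; rewrite eq_le hx fun_ge0.
- by rewrite integralT_nnsfun.
Qed.

(** The integral of a nonnegative function is the supremum of the integrals of its
    simple minorants, whether or not the function is measurable. Cutting a minorant
    of [f] to zero on the exceptional null set gives a minorant of [g]. *)
Lemma le_lint D E f g : (forall x, 0 <= f x) -> (forall x, 0 <= g x) ->
  {ae mu, forall x, D x -> E x /\ f x <= g x} -> (I D f <= I E g)%E.
Proof.
move=> f0 g0 [N [mN muN fgN]].
rewrite !ge0_integralE; try by move=> x _; rewrite lee_fin.
apply: ge_ereal_sup => _ [h /= hf <-].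
pose h' := proj_nnsfun h (measurableC mN).
have h'E x : h' x = h x * \1_(~` N) x by [].
apply: le_ereal_sup_tmp; exists (sintegral mu h').
  exists h' => // x; rewrite h'E indicE patchE.
  have [Nx|Nx] := boolP (x \in ~` N); last first.
    by rewrite mulr0; case: ifP; rewrite lee_fin.
  rewrite mulr1; have := hf x; rewrite patchE.
  case: ifP => [Dx|_] hx; last first.
    by apply: le_trans hx _; case: ifP; rewrite lee_fin.
  have [Ex fgx] : E x /\ f x <= g x.
    apply: contrapT => c; move: Nx; rewrite inE; apply; apply: fgN => /= c'.
    by apply: c; apply: c'; rewrite inE in Dx.
  by rewrite mem_set // (le_trans hx) // lee_fin.
rewrite -!integralT_nnsfun; apply: ae_ge0_le_integral => //.
- by move=> x _; rewrite lee_fin fun_ge0.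
- exact/measurable_EFinP.
- by move=> x _; rewrite lee_fin fun_ge0.
- exact/measurable_EFinP.
- exists N; split => // x c; apply: contrapT => Nx; apply: c => _ /=.
  have hE : h x = h' x by rewrite h'E indicE mem_set ?mulr1.
  by rewrite lee_fin le_eqVlt; apply/orP; left; apply/eqP; exact: hE.
Qed.

(** Subadditivity fails for general nonnegative functions (think of the indicators of
    a non-measurable set and of its complement); it is enough that both summands are
    almost everywhere equal to measurable functions. *)
Lemma lint_subadd D f g1 g2 (m1 m2 : T -> R) : measurable D ->
  (forall x, 0 <= f x) -> (forall x, 0 <= g1 x) -> (forall x, 0 <= g2 x) ->
  (forall x, 0 <= m1 x) -> (forall x, 0 <= m2 x) ->
  measurable_fun D m1 -> measurable_fun D m2 ->
  {ae mu, forall x, D x -> g1 x = m1 x} -> {ae mu, forall x, D x -> g2 x = m2 x} ->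
  {ae mu, forall x, D x -> f x <= g1 x + g2 x} ->
  (I D f <= I D g1 + I D g2)%E.
Proof.
move=> mD f0 g10 g20 m10 m20 mm1 mm2 e1 e2 fg.
apply: (@le_trans _ _ (I D (fun x => m1 x + m2 x))).
  apply: le_lint => //; first by move=> x; rewrite addr_ge0.
  apply: filterS3 e1 e2 fg => x h1 h2 h3 Dx; split => //.
  by rewrite -h1 // -h2 // h3.
under eq_integral do rewrite EFinD.
rewrite ge0_integralD //; try by [move=> x _; rewrite lee_fin|exact/measurable_EFinP].
by apply: leeD; apply: le_lint => //; [apply: filterS e1|apply: filterS e2] => x h Dx;
  rewrite h.
Qed.

Definition lfin D f : Prop := (I D f < +oo)%E.

Lemma RintegralE D f : (forall x, 0 <= f x) -> lfin D f ->
  (\int[mu]_(x in D) f x)%:E = I D f.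
Proof. by move=> f0 ffin; rewrite /Rintegral fineK // ge0_fin_numE ?lint_ge0. Qed.

Lemma Rint_ge0 D f : (forall x, 0 <= f x) -> 0 <= \int[mu]_(x in D) f x.
Proof. by move=> f0; rewrite fine_ge0 ?lint_ge0. Qed.

Lemma le_lfin D E f g : (forall x, 0 <= f x) -> (forall x, 0 <= g x) ->
  {ae mu, forall x, D x -> E x /\ f x <= g x} -> lfin E g -> lfin D f.
Proof. by move=> f0 g0 fg; apply: le_lt_trans; exact: le_lint. Qed.

Lemma le_Rint D E f g : (forall x, 0 <= f x) -> (forall x, 0 <= g x) ->
  {ae mu, forall x, D x -> E x /\ f x <= g x} -> lfin E g ->
  \int[mu]_(x in D) f x <= \int[mu]_(x in E) g x.
Proof.
move=> f0 g0 fg gfin; rewrite -lee_fin !RintegralE //; first exact: le_lint.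
exact: le_lfin gfin.
Qed.

Lemma Rint_minorant D f (e : R) : (forall x, 0 <= f x) -> lfin D f -> 0 < e ->
  exists h : {nnsfun T >-> R},
    [/\ forall x, h x <= f x, forall x, ~ D x -> h x = 0, lfin setT h &
        \int[mu]_(x in D) f x <= \int[mu]_(x in setT) h x + e].
Proof.
move=> f0 ffin e0; have [h [hf hD hI]] := lint_minorant f0 ffin e0.
exists h; have fh : lfin setT h.
  rewrite /lfin integral_mkcond patch_setT; apply: le_lt_trans ffin.
  rewrite [leRHS]integral_mkcond.
  rewrite (_ : _ \_ D = EFin \o (f \_ D)); last first.
    by rewrite restrict_EFin.
  apply: le_lint => [x|x|].
  - exact: fun_ge0.
  - by rewrite patchE; case: ifP.
  - apply/aeW => x _; split => //; rewrite patchE; case: ifPn => [//|].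
    by move/negP; rewrite inE => /hD ->.
by split=> //; rewrite -lee_fin EFinD !RintegralE.
Qed.

Lemma measurable_nnsfunE (h : {nnsfun T >-> R}) : measurable_fun setT (EFin \o h).
Proof. exact/measurable_EFinP. Qed.

Lemma le_RintZ D E f g (k : R) : 0 <= k -> (forall x, 0 <= f x) -> (forall x, 0 <= g x) ->
  {ae mu, forall x, D x -> E x /\ f x <= k * g x} -> lfin E g ->
  lfin D f /\ \int[mu]_(x in D) f x <= k * \int[mu]_(x in E) g x.
Proof.
move=> k0 f0 g0 fg gfin.
suff : (I D f <= k%:E * I E g)%E.
  move=> le; have Df : lfin D f.
    by apply: le_lt_trans le _; rewrite lte_mul_pinfty ?lee_fin.
  by split => //; rewrite -lee_fin EFinM !RintegralE.
have [k_eq0|kn0] := eqVneq k 0.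
  rewrite k_eq0 mul0e.
  apply: le_trans (_ : I D f <= I D (cst 0%R))%E _; last by rewrite integral0.
  apply: le_lint => //; apply: filterS fg => x h Dx; split => //.
  by have [_ +] := h Dx; rewrite k_eq0 mul0r.
have kp : 0 < k by rewrite lt_neqAle eq_sym kn0.
rewrite [X in (X <= _)%E]ge0_integralE; last by move=> x _; rewrite lee_fin.
apply: ge_ereal_sup => _ [h /= hf <-].
have hD x : ~ D x -> h x = 0.
  move=> Dx; have := hf x; rewrite patchE memNset // lee_fin => hx.
  by apply/eqP; rewrite eq_le hx fun_ge0.
rewrite -integralT_nnsfun.
have ki0 : 0 <= k^-1 by rewrite invr_ge0.
have -> : I setT h = (k%:E * I setT (fun x => (k^-1 * h x)%R))%E.
  under [in RHS]eq_integral do rewrite EFinM.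
  rewrite ge0_integralZl_EFin //; last exact: measurable_nnsfunE.
    by rewrite muleA -EFinM divff // mul1e.
  by move=> x _; rewrite lee_fin fun_ge0.
apply: lee_wpmul2l; rewrite ?lee_fin //.
rewrite [leRHS]integral_mkcond (_ : _ \_ E = EFin \o (g \_ E)); last first.
  by rewrite restrict_EFin.
apply: le_lint => [x|x|].
- by rewrite mulr_ge0 ?fun_ge0.
- by rewrite patchE; case: ifP.
- apply: filterS fg => x fgx _; split => //.
  have [Dx|Dx] := pselect (D x); last first.
    by rewrite hD // mulr0 patchE; case: ifP.
  have [Ex le] := fgx Dx; rewrite patchE mem_set // ler_pdivrMl //.
  by apply: le_trans le; have := hf x; rewrite patchE mem_set // lee_fin.
Qed.

(** Only superadditivity over disjoint sets survives without measurability: the sum of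
    two simple minorants is a simple minorant. *)
Lemma Rint_superadd D E F f : (forall x, 0 <= f x) -> D `&` E `<=` set0 ->
  D `<=` F -> E `<=` F -> lfin F f ->
  \int[mu]_(x in D) f x + \int[mu]_(x in E) f x <= \int[mu]_(x in F) f x.
Proof.
move=> f0 DE DF EF ffin.
have fD : lfin D f by apply: le_lfin ffin => //; apply/aeW => x /DF.
have fE : lfin E f by apply: le_lfin ffin => //; apply/aeW => x /EF.
apply/ler_addgt0Pr => e e0; have e2 : 0 < e / 2 by rewrite divr_gt0.
have [h1 [h1f h1D fin1 le1]] := Rint_minorant f0 fD e2.
have [h2 [h2f h2E fin2 le2]] := Rint_minorant f0 fE e2.
apply: (@le_trans _ _ (\int[mu]_x (h1 x) + \int[mu]_x (h2 x) + e)).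
  by rewrite [in leRHS](splitr e); lra.
rewrite lerD2r -lee_fin EFinD !RintegralE //; try by move=> x; exact: fun_ge0.
rewrite -ge0_integralD //; try exact: measurable_nnsfunE;
  try by move=> x _; rewrite lee_fin fun_ge0.
rewrite [leRHS]integral_mkcond (_ : _ \_ F = EFin \o (f \_ F)); last first.
  by rewrite restrict_EFin.
under eq_integral do rewrite -EFinD.
apply: le_lint => [x|x|].
- by rewrite addr_ge0 ?fun_ge0.
- by rewrite patchE; case: ifP.
apply/aeW => x _; split => //; rewrite patchE.
have [Dx|Dx] := pselect (D x).
  have Ex : ~ E x by move=> Ex; apply: (DE x).
  by rewrite (mem_set (DF _ Dx)) h2E // addr0.
rewrite h1D // add0r.
have [Ex|Ex] := pselect (E x); first by rewrite (mem_set (EF _ Ex)).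
by rewrite h2E //; case: ifP.
Qed.

(** The Cauchy-Schwarz inequality with the constant function: integrate
    2 c h <= f^2 + c^2 for simple minorants h of f, then optimize over c. *)
Lemma Rint_CS D f (l : R) : measurable D -> mu D = l%:E -> (forall x, 0 <= f x) ->
  lfin D f -> lfin D (fun x => f x ^+ 2) ->
  (\int[mu]_(x in D) f x) ^+ 2 <= l * \int[mu]_(x in D) f x ^+ 2.
Proof.
move=> mD muD f0 ffin f2fin.
have l0 : 0 <= l by rewrite -lee_fin -muD.
have key (c : R) : 0 <= c ->
    2 * c * \int[mu]_(x in D) f x <= \int[mu]_(x in D) f x ^+ 2 + c ^+ 2 * l.
  move=> c0; apply/ler_addgt0Pr => e e0.
  have e'0 : 0 < e / (2 * c + 1) by rewrite divr_gt0 // ltr_wpDl // mulr_ge0.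
  have [h [hf hD hfin le]] := Rint_minorant f0 ffin e'0.
  have h0 x : 0 <= h x by exact: fun_ge0.
  have hle : 2 * c * \int[mu]_x h x <= \int[mu]_(x in D) f x ^+ 2 + c ^+ 2 * l.
    rewrite -lee_fin EFinM EFinD !RintegralE //; last by move=> x; exact: sqr_ge0.
    rewrite -ge0_integralZl_EFin //; last 3 first.
    - by move=> x _; rewrite lee_fin.
    - exact: measurable_nnsfunE.
    - by rewrite mulr_ge0.
    under eq_integral do rewrite -EFinM.
    apply: (@le_trans _ _ (I D (fun x => h x ^+ 2) + I D (cst (c ^+ 2)))%E); last first.
      have -> : I D (cst (c ^+ 2)) = (c ^+ 2 * l)%:E.
        by rewrite [RHS]EFinM -muD -(integral_cst mu mD (c ^+ 2)%:E).
      apply: leeD2r.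
      apply: le_lint => [x|x|]; try exact: sqr_ge0.
      by apply/aeW => x Dx; split => //; rewrite ler_pXn2r ?nnegrE.
    rewrite -ge0_integralD //; last 4 first.
    - by move=> x _; rewrite lee_fin sqr_ge0.
    - apply/measurable_EFinP; apply: measurable_funX.
      exact: (measurable_funS measurableT).
    - by move=> x _; rewrite lee_fin sqr_ge0.
    - by apply/measurable_EFinP; exact: (measurable_cst (c ^+ 2)).
    under [X in (_ <= X)%E]eq_integral do rewrite -EFinD.
    rewrite [X in (_ <= X)%E]integral_mkcond.
    rewrite (_ : _ \_ D = EFin \o ((fun x => h x ^+ 2 + c ^+ 2) \_ D)); last first.
      by rewrite restrict_EFin.
    apply: le_lint => [x|x|].
    - by rewrite !mulr_ge0.
    - by rewrite patchE; case: ifP => // _; rewrite addr_ge0 ?sqr_ge0.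
    - apply/aeW => x _; split => //; rewrite patchE.
      have [Dx|Dx] := pselect (D x); last by rewrite hD // mulr0; case: ifP => // _; rewrite addr_ge0 ?sqr_ge0.
      rewrite mem_set // -subr_ge0.
      have -> : h x ^+ 2 + c ^+ 2 - 2 * c * h x = (h x - c) ^+ 2 by ring.
      exact: sqr_ge0.
  apply: le_trans (_ : _ <= 2 * c * (\int[mu]_x h x + e / (2 * c + 1))) _.
    by rewrite ler_wpM2l // mulr_ge0.
  rewrite mulrDr lerD // mulrCA ler_piMr ?(ltW e0) //.
  by rewrite ler_pdivrMr ?mul1r ?lerDl // ltr_wpDl // mulr_ge0.
have A0 := Rint_ge0 D f0; have Q0 := Rint_ge0 D (fun x => sqr_ge0 (f x)).
move: (Rintegral _ _ _) (Rintegral _ _ _) A0 Q0 key => Q A A0 Q0 key.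
have [l_eq0|ln0] := eqVneq l 0; last first.
  have lp : 0 < l by rewrite lt_neqAle eq_sym ln0.
  have := key (A / l) (divr_ge0 A0 l0).
  have -> : 2 * (A / l) * A = 2 * A ^+ 2 / l by field.
  have -> : (A / l) ^+ 2 * l = A ^+ 2 / l by field.
  move=> h; have : A ^+ 2 / l <= Q by lra.
  by rewrite ler_pdivrMr // mulrC.
have [->|An0] := eqVneq A 0; first by rewrite expr0n mulr_ge0.
have Ap : 0 < A by rewrite lt_neqAle eq_sym An0.
have c0 : 0 <= (Q + 1) / (2 * A) by rewrite divr_ge0 ?addr_ge0 ?mulr_ge0.
have := key _ c0; rewrite l_eq0 mulr0.
have -> : 2 * ((Q + 1) / (2 * A)) * A = Q + 1 by field.
by rewrite addr0 gerDl ler10.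
Qed.

End lower_integral.

(** * Smooth bump functions on boxes *)

Section flat_function.
Context {R : realType}.

(** For each n this vanishes to infinite order at 0 and its derivative is a
    combination of [flat n.+1] and [flat n.+2], so [flat 0], i.e. exp (- 1 / t) for
    t > 0, is smooth. *)
Definition flat (n : nat) (t : R) : R :=
  if 0 < t then t^-1 ^+ n * expR (- t^-1) else 0.

Lemma flat_ge0 n t : 0 <= flat n t.
Proof.
rewrite /flat; case: ltP => // t0.
by rewrite mulr_ge0 ?expR_ge0 // exprn_ge0 // invr_ge0 ltW.
Qed.

Lemma flat0_le1 t : flat 0 t <= 1.
Proof.
rewrite /flat; case: ltP => // t0; rewrite expr0 mul1r -expR0 ler_expR.
by rewrite oppr_le0 invr_ge0 ltW.
Qed.

(** With s = 1 / t this is s^(n+2) / (n+2)! <= exp s. The square gives a zero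
    derivative at the origin. *)
Lemma flat_le_sqr n t : `|flat n t| <= (n.+2)`!%:R * t ^+ 2.
Proof.
rewrite ger0_norm ?flat_ge0 // /flat; case: ltP => t0; last first.
  by rewrite mulr_ge0 ?sqr_ge0.
have s0 : 0 < t^-1 by rewrite invr_gt0.
rewrite -[X in _ <= _ * X ^+ 2]invrK; move: (t^-1) s0 => s s0.
have := expR_ge1Dxn n.+1 (ltW s0); set F : R := n.+2`!%:R.
have F0 : 0 < F by rewrite ltr0n fact_gt0.
move=> le; have {le} : s ^+ n.+2 / F <= expR s by lra.
rewrite ler_pdivrMr // => le.
rewrite expRN ler_pdivrMr ?expR_gt0 // exprVn mulrAC ler_pdivlMr ?exprn_gt0 //.
by rewrite -exprD addn2 mulrC.
Qed.

Lemma is_derive_flat n (t : R) :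
  is_derive t 1 (flat n) (- n%:R * flat n.+1 t + flat n.+2 t).
Proof.
have [t0|t0|->] := ltgtP t 0.
- rewrite {2 3}/flat !ltNge (ltW t0) /= mulr0 addr0.
  apply: (@near_eq_is_derive _ _ _ (cst 0)).
  near=> x; rewrite /flat ltNge (_ : x <= 0) //=.
  by rewrite ltW //; near: x; exact: lt_nbhsl.
- rewrite {2 3}/flat t0.
  apply: (@near_eq_is_derive _ _ _
      ((fun x : R => x^-1) ^+ n * (expR \o (- (fun x : R => x^-1))))).
    near=> x; have -> : flat n x = x^-1 ^+ n * expR (- x^-1).
      by rewrite /flat (_ : 0 < x) //; near: x; exact: lt_nbhsr.
    by rewrite mulrfctE exprfctE.
  have dV : is_derive t 1 (fun x : R => x^-1) (- t ^- 2).
    have := @is_deriveV _ id t 1 1; rewrite gt_eqF //= => /(_ isT (is_derive_id _ _)).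
    by rewrite scaler1.
  have dE : is_derive t 1 (expR \o (- (fun x : R => x^-1))) (expR (- t^-1) * t ^- 2).
    have dN : is_derive t 1 (- (fun x : R => x^-1)) (t ^- 2).
      by rewrite -[X in is_derive _ _ _ X]opprK; exact: is_deriveN.
    exact: is_derive1_comp.
  apply: is_derive_eq.
  rewrite /= !fctE /GRing.scale /=.
  case: n => [|n].
    by rewrite !expr0; field; rewrite gt_eqF.
  rewrite -pred_Sn !exprVn !exprS; field.
  by rewrite expf_neq0 gt_eqF.
- rewrite {2 3}/flat ltxx mulr0 addr0.
  apply/is_derive1_caratheodory; exists (fun z => flat n z / z).
  have f0 k : flat k 0 = 0 by rewrite /flat ltxx.
  split; last by rewrite f0 mul0r.
    move=> z; rewrite f0 !subr0; have [->|z0] := eqVneq z 0.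
      by rewrite f0 mulr0.
    by rewrite mulfVK.
  apply/cvgrPdist_le => /= e e0; rewrite f0 mul0r.
  have F0 : (0 : R) < n.+2`!%:R by rewrite ltr0n fact_gt0.
  near=> x; rewrite sub0r normrN normrM normfV.
  have [->|x0] := eqVneq x 0; first by rewrite f0 normr0 mul0r ltW.
  rewrite ler_pdivrMr ?normr_gt0 //; apply: le_trans (flat_le_sqr _ _) _.
  rewrite -real_normK ?num_real // expr2 mulrA ler_wpM2r //.
  rewrite mulrC -ler_pdivlMr //; near: x.
  exact: (nbhs0_le (V := R) (divr_gt0 e0 F0)).
Unshelve. all: by end_near. Qed.

Lemma flat_continuous n : continuous (flat n).
Proof.
move=> x; apply/differentiable_continuous/derivable1_diffP.
by have [] := is_derive_flat n x.
Qed.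

Lemma flat0_cvg (t : R) :
  flat 0 (k.+1%:R * t) @[k --> \oo] --> ((0 < t)%R%:R : R).
Proof.
have [t0|t0] := ltP 0 t; last first.
  under eq_fun do rewrite /flat ltNge mulr_ge0_le0 //=.
  exact: cvg_cst.
under eq_fun do rewrite /flat mulr_gt0 //= expr0 mul1r invfM.
have : - (k.+1%:R^-1 * t^-1) @[k --> \oo] --> - (0 * t^-1).
  by apply: cvgN; apply: cvgMr_tmp; exact: cvg_harmonic.
rewrite mul0r oppr0 -expR0 => c.
exact: (cvg_comp _ _ c (@continuous_expR R 0)).
Qed.

End flat_function.

Section smooth_functions.
Context {R : realType} {d : nat}.
Implicit Types (u v : 'rV[R]_d -> R).

(** Smoothness as a sequence of conditions that can be proved by induction: products
    of C^m functions are C^m by the Leibniz rule. *)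
Fixpoint Ck (m : nat) (u : 'rV[R]_d -> R) : Prop :=
  continuous u /\
  if m is m'.+1 then
    forall i, (forall x, derivable u x (delta_mx ord0 i)) /\ Ck m' (partial i u)
  else True.

Lemma smooth_partial u i : smooth u -> smooth (partial i u).
Proof. by move=> su s; rewrite -foldr_rcons; exact: su. Qed.

Lemma smoothE u : smooth u <-> forall m, Ck m u.
Proof.
split=> [su m|Cu s].
  elim: m u su => [|m ih] u su; first by split => //; exact: (su [::]).1.
  split; first exact: (su [::]).1.
  by move=> i; split; [exact: (su [::]).2|exact/ih/smooth_partial].
have : Ck (size s).+1 u by [].
clear Cu; elim/last_ind: s u => [|s i ih] u.
  by move=> [cu du]; split => // i x; exact: (du i).1.
by rewrite foldr_rcons size_rcons => -[cu du]; apply: ih; exact: (du i).2.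
Qed.

Lemma CkW m u : Ck m.+1 u -> Ck m u.
Proof.
elim: m u => [|m ih] u [cu du]; first by split.
by split => // i; split; [exact: (du i).1|exact/ih/(du i).2].
Qed.

Lemma Ck_continuous m u : Ck m u -> continuous u.
Proof. by case: m => [|m] []. Qed.

Lemma CkD m u v : Ck m u -> Ck m v -> Ck m (u + v).
Proof.
elim: m u v => [|m ih] u v [cu du] [cv dv].
  by split => // x; apply: continuousD; [exact: cu|exact: cv].
split => [x|i]; first by apply: continuousD; [exact: cu|exact: cv].
split=> [x|]; first by apply: derivableD; [exact: (du i).1|exact: (dv i).1].
have -> : partial i (u + v) = partial i u + partial i v.
  by apply/funext => x; rewrite /partial deriveD //; [exact: (du i).1|exact: (dv i).1].
by apply: ih; [exact: (du i).2|exact: (dv i).2].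
Qed.

Lemma Ck_cst m (a : R) : Ck m (cst a).
Proof.
elim: m a => [|m ih] a; first by split => //; exact: cst_continuous.
split => [|i]; first exact: cst_continuous.
split => [x|]; first exact: derivable_cst.
have -> : partial i (cst a) = cst 0; last exact: ih.
by apply/funext => x; rewrite /partial derive_cst.
Qed.

Lemma CkM m u v : Ck m u -> Ck m v -> Ck m (u * v).
Proof.
elim: m u v => [|m ih] u v.
  move=> [cu _] [cv _]; split => // x.
  by apply: continuousM; [exact: cu|exact: cv].
move=> Cu Cv; case: (Cu) (Cv) => cu du [cv dv].
split => [x|i]; first by apply: continuousM; [exact: cu|exact: cv].
split=> [x|]; first by apply: derivableM; [exact: (du i).1|exact: (dv i).1].
have -> : partial i (u * v) = u * partial i v + v * partial i u.
  by apply/funext => x; rewrite /partial deriveM //; [exact: (du i).1|exact: (dv i).1].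
apply: CkD; apply: ih; try exact: CkW.
  exact: (dv i).2.
exact: (du i).2.
Qed.

Lemma CkZ m a u : Ck m u -> Ck m (a *: u).
Proof.
move=> Cu; have -> : a *: u = cst a * u by [].
by apply: CkM => //; exact: Ck_cst.
Qed.

Lemma Ck_prod m (I : Type) (r : seq I) (F : I -> 'rV[R]_d -> R) :
  (forall i, Ck m (F i)) -> Ck m (\prod_(i <- r) F i).
Proof.
move=> CF; elim: r => [|i r ih]; first by rewrite big_nil; exact: Ck_cst.
by rewrite big_cons; exact: CkM.
Qed.

Lemma is_derive_coord (g : R -> R) (dg : R) (i j : 'I_d) (x : 'rV[R]_d) :
  is_derive (x ord0 i) 1 g dg ->
  is_derive x (delta_mx ord0 j) (fun y : 'rV[R]_d => g (y ord0 i))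
    ((i == j)%:R * dg).
Proof.
move=> [dgx dgE]; have [ij|ij] := eqVneq i j; last first.
  rewrite mul0r.
  have E h : g ((h *: delta_mx ord0 j + x) ord0 i) = g (x ord0 i).
    by rewrite !mxE eqxx (negbTE ij) mulr0 add0r.
  have c : (fun h : R => h^-1 *: (((fun y : 'rV[R]_d => g (y ord0 i)) \o shift x)
      (h *: delta_mx ord0 j) - g (x ord0 i))) @ 0^' --> (0 : R).
    under eq_fun do rewrite /= E subrr scaler0.
    exact: cvg_cst.
  by split; [apply/cvg_ex; exists 0|apply: cvg_lim].
subst j; rewrite mul1r.
have E : (fun h : R => h^-1 *: (((fun y : 'rV[R]_d => g (y ord0 i)) \o shift x)
      (h *: delta_mx ord0 i) - g (x ord0 i))) =
    (fun h : R => h^-1 *: ((g \o shift (x ord0 i)) (h *: 1) - g (x ord0 i))).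
  by apply/funext => h; rewrite /= !mxE !eqxx.
by split; rewrite /derivable /derive E; [exact: dgx|exact: dgE].
Qed.

Definition coord_flat (n : nat) (i : 'I_d) (a b : R) : 'rV[R]_d -> R :=
  fun x => flat n (a * x ord0 i + b).

Lemma Ck_coord_flat m n i a b : Ck m (coord_flat n i a b).
Proof.
elim: m n => [|m ih] n.
  split => // x; apply: (@continuous_comp _ _ _
    (fun x : 'rV[R]_d => a * x ord0 i + b) (flat n)); last exact: flat_continuous.
  apply: continuousD; last exact: cst_continuous.
  by apply: continuousM; [exact: cst_continuous|exact: coord_continuous].
have cn : continuous (coord_flat n i a b) by exact: (Ck_continuous (ih n)).
split => // j.
have D x : is_derive x (delta_mx ord0 j) (coord_flat n i a b)
    ((i == j)%:R * ((- n%:R * coord_flat n.+1 i a b x + coord_flat n.+2 i a b x) * a)).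
  apply: is_derive_coord (fun t => flat n (a * t + b)) _ _ _ _ _.
  apply: (@is_derive1_comp _ (flat n) (fun t => a * t + b)).
    exact: is_derive_flat.
  have -> : (fun t : R => a * t + b) = (a \*: id) + cst b by [].
  by apply: is_derive_eq; rewrite addr0 /GRing.scale /= mulr1.
split=> [x|]; first by case: (D x).
have -> : partial j (coord_flat n i a b) =
    ((i == j)%:R * a * - n%:R) *: coord_flat n.+1 i a b +
    ((i == j)%:R * a) *: coord_flat n.+2 i a b.
  apply/funext => x; rewrite /partial; case: (D x) => _ ->.
  transitivity ((i == j)%:R * a * (- n%:R) * coord_flat n.+1 i a b x +
    (i == j)%:R * a * coord_flat n.+2 i a b x); last by [].
  ring.
by apply: CkD; apply: CkZ; exact: ih.
Qed.

(** These smooth functions increase to the indicator function of the open box as k goes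
    to infinity, so integrals against test functions determine integrals over boxes. *)
Definition box_bump (a b : 'I_d -> R) (k : nat) : 'rV[R]_d -> R :=
  \prod_i (coord_flat 0 i k.+1%:R (- (k.+1%:R * a i)) *
           coord_flat 0 i (- k.+1%:R) (k.+1%:R * b i)).

Definition open_box (a b : 'I_d -> R) : set 'rV[R]_d :=
  [set x | forall i, a i < x ord0 i < b i].

Definition closed_box (a b : 'I_d -> R) : set 'rV[R]_d :=
  [set x | forall i, a i <= x ord0 i <= b i].

Lemma box_bump_smooth a b k : smooth (box_bump a b k).
Proof.
by apply/smoothE => m; apply: Ck_prod => i; apply: CkM; exact: Ck_coord_flat.
Qed.

Lemma box_bumpE a b k x : box_bump a b k x =
  \prod_i (flat 0 (k.+1%:R * (x ord0 i - a i)) * flat 0 (k.+1%:R * (b i - x ord0 i))).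
Proof.
rewrite /box_bump; elim/big_ind2 : _ => [//|u r v s <- <- //|i _].
by rewrite [LHS]/GRing.mul /= /coord_flat; congr (flat _ _ * flat _ _); ring.
Qed.

Lemma box_bump_ge0 a b k x : 0 <= box_bump a b k x.
Proof. by rewrite box_bumpE prodr_ge0 // => i _; rewrite mulr_ge0 ?flat_ge0. Qed.

Lemma box_bump_le1 a b k x : box_bump a b k x <= 1.
Proof.
rewrite box_bumpE; apply: prodr_ile1 => // i _.
by rewrite !mulr_ge0 ?flat_ge0 // mulr_ile1 ?flat_ge0 ?flat0_le1.
Qed.

Lemma box_bump_out a b k x : ~ open_box a b x -> box_bump a b k x = 0.
Proof.
move=> /existsNP[i /negP]; rewrite negb_and -!leNgt => h.
rewrite box_bumpE (bigD1 i) //=; suff -> : flat 0 (k.+1%:R * (x ord0 i - a i)) *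
  flat 0 (k.+1%:R * (b i - x ord0 i)) = 0 :> R by rewrite mul0r.
have k0 : (0 : R) < k.+1%:R by [].
by case/orP: h => h; apply/eqP; rewrite mulf_eq0 /flat !pmulr_rgt0 // !subr_gt0;
  rewrite ![in _ < _]ltNge h /= eqxx ?orbT.
Qed.

Lemma cvg_prod_seq (I : Type) (r : seq I) (f : I -> nat -> R) (l : I -> R) :
  (forall i, f i @ \oo --> l i) ->
  (fun k => \prod_(i <- r) f i k) @ \oo --> \prod_(i <- r) l i.
Proof.
move=> fl; elim: r => [|i r ih].
  rewrite big_nil (_ : (fun k => _) = cst 1); first exact: cvg_cst.
  by apply/funext => k; rewrite big_nil.
rewrite big_cons (_ : (fun k => _) = (fun k => f i k * \prod_(j <- r) f j k)).
  exact: cvgM.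
by apply/funext => k; rewrite big_cons.
Qed.

Lemma box_bump_cvg a b x :
  box_bump a b k x @[k --> \oo] --> (\1_(open_box a b) x : R).
Proof.
have [xb|xb] := pselect (open_box a b x); last first.
  rewrite indicE memNset //; under eq_fun do rewrite box_bump_out //.
  exact: cvg_cst.
rewrite indicE mem_set //=.
have -> : (1 : R) = \prod_(i < d) ((0 < x ord0 i - a i)%R%:R * (0 < b i - x ord0 i)%R%:R).
  rewrite big1 // => i _; have /andP[ai bi] := xb i.
  by rewrite !subr_gt0 ai bi mulr1.
under eq_fun do rewrite box_bumpE.
apply: (cvg_prod_seq (f := fun i k => flat 0 (k.+1%:R * (x ord0 i - a i)) *
  flat 0 (k.+1%:R * (b i - x ord0 i)))) => i.
by apply: cvgM; exact: flat0_cvg.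
Qed.

Lemma closed_boxE a b : closed_box a b =
  [set x : 'rV[R]_d | forall i, `[a i, b i]%classic (x ord0 i)].
Proof.
apply/seteqP; split => x xb i; first by rewrite /= in_itv /=; exact: xb.
by have := xb i; rewrite /= in_itv.
Qed.

Lemma compact_closed_box a b : compact (closed_box a b).
Proof.
rewrite closed_boxE; apply: (@rV_compact R d (fun i => `[a i, b i]%classic)) => i.
exact: segment_compact.
Qed.

Lemma bump_test_function (Omega : set 'rV[R]_d) a b k :
  closed_box a b `<=` Omega -> test_function Omega (box_bump a b k).
Proof.
move=> abO.
have cc := compact_closed (@norm_hausdorff R 'rV[R]_d) (@compact_closed_box a b).
have sub : closure [set x | box_bump a b k x != 0] `<=` closed_box a b.
  rewrite (closure_id (closed_box a b)).1 //; apply: closureS => x /= /eqP xb i.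
  have [xab|/(@box_bump_out _ _ k)//] := pselect (open_box a b x).
  by have /andP[ai bi] := xab i; rewrite !ltW.
split; [exact: box_bump_smooth| |exact: subset_trans abO].
apply: (subclosed_compact _ _ sub); first exact: closed_closure.
exact: compact_closed_box.
Qed.

End smooth_functions.

(** * Open sets of R^d and their measure *)

Section boxes.
Context {R : realType} {d : nat}.
Implicit Types (a b : 'I_d -> R) (U : set 'rV[R]_d).

Lemma measurable_product_set (A : 'I_d -> set R) :
  (forall i, measurable (A i)) ->
  measurable [set x : 'rV[R]_d | forall i, A i (x ord0 i)].
Proof.
move=> mA; rewrite [X in measurable X](_ : _ = \bigcap_(i in [set: 'I_d])
     ((fun x : 'rV[R]_d => x ord0 i) @^-1` A i)); last first.
  by apply/seteqP; split => [x Ax i _|x Ax i]; exact: Ax.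
apply: fin_bigcap_measurable; first exact: finite_finset.
by move=> i _; rewrite -[X in measurable X]setTI; apply: measurable_coord.
Qed.

Lemma open_boxE a b : open_box a b =
  [set x : 'rV[R]_d | forall i, `]a i, b i[%classic (x ord0 i)].
Proof.
apply/seteqP; split => x xb i; first by rewrite /= in_itv /=; exact: xb.
by have := xb i; rewrite /= in_itv.
Qed.

Lemma measurable_open_box a b : measurable (open_box a b).
Proof.
by rewrite open_boxE; apply: (@measurable_product_set (fun i => `]a i, b i[%classic)).
Qed.

(** The boxes with rational centre and radius 1 / (n + 1) whose closure lies in [U]
    cover [U]; the closure condition is what makes a bump on the box a test function
    on [U]. Countability comes from an enumeration of the pairs (centre, n), the
    empty set standing for the codes that are not used. *)
Lemma open_box_cover U : open U -> exists B : nat -> set 'rV[R]_d,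
  (forall k, B k = set0 \/ exists a b, closed_box a b `<=` U /\ B k = open_box a b) /\
  U = \bigcup_k B k.
Proof.
move=> oU.
pose lo (z : {ffun 'I_d -> rat} * nat) i : R := ratr (z.1 i) - z.2.+1%:R^-1.
pose hi (z : {ffun 'I_d -> rat} * nat) i : R := ratr (z.1 i) + z.2.+1%:R^-1.
pose B k := if unpickle k is Some z then
  (if pselect (closed_box (lo z) (hi z) `<=` U) then open_box (lo z) (hi z) else set0)
  else set0.
exists B; split.
  move=> k; rewrite /B; case: unpickle => [z|]; last by left.
  by case: pselect => [h|h]; [right; exists (lo z), (hi z)|left].
apply/seteqP; split => [x Ux|x [k _]]; last first.
  rewrite /B; case: unpickle => [z|//]; case: pselect => // h xb; apply: (h) => i.
  by have := xb i => /andP[l1 l2]; rewrite !ltW.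
have /nbhs_ballP[e /= e0 xeU] : nbhs x U by exact: open_nbhs_nbhs.
have [n ne] : exists n : nat, n.+1%:R^-1 < e / 2.
  have e2 : 0 < e / 2 by rewrite divr_gt0.
  have [n _ /(_ n (leqnn n))] := near_infty_natSinv_lt (PosNum e2).
  by exists n.
have q_ex i : exists q : rat, ratr q \in `]x ord0 i - n.+1%:R^-1, x ord0 i + n.+1%:R^-1[.
  apply: rat_in_itvoo; rewrite ltrBlDr -addrA ltrDl.
  by rewrite addr_gt0 // invr_gt0.
pose q : {ffun 'I_d -> rat} := [ffun i => projT1 (cid (q_ex i))].
have qP i : x ord0 i - n.+1%:R^-1 < ratr (q i) < x ord0 i + n.+1%:R^-1.
  by rewrite ffunE; case: cid => /= r; rewrite in_itv.
exists (pickle (q, n)) => //; rewrite /B pickleK.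
case: pselect => [h|h]; last first.
  exfalso; apply: h => y yb; apply: xeU; split => // i0 i; rewrite (_ : i0 = ord0); last exact: ord1.
  rewrite /ball /= ltr_norml; have := yb i; have := qP i; rewrite /lo /hi /=.
  by move: (n.+1%:R^-1) ne => r ne /andP[? ?] /andP[? ?]; apply/andP; split; lra.
move=> i; have := qP i; rewrite /lo /hi /=.
by move: (n.+1%:R^-1) => r /andP[? ?]; apply/andP; split; lra.
Qed.

Lemma measurable_open_rV U : open U -> measurable U.
Proof.
move=> /open_box_cover[B [BP ->]]; apply: bigcupT_measurable => k.
by have [->|[a [b [_ ->]]]] := BP k; [exact: measurable0|exact: measurable_open_box].
Qed.

Lemma measurable_continuous_rV (D : set 'rV[R]_d) (u : 'rV[R]_d -> R) :
  continuous u -> measurable_fun D u.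
Proof.
move=> cu; apply: (@measurable_funS _ _ _ _ setT) => //.
apply: (measurability _ (RGenOInfty.measurableE R)) => _ [_ [x ->] <-].
rewrite setTI; apply: measurable_open_rV; apply: open_comp; first by move=> *; exact: cu.
exact: interval_open.
Qed.

(** A bounded set lies in a cube, whose measure is the product of its sides. *)
Lemma lebesgue_rV_bounded (D : set 'rV[R]_d) : measurable D -> bounded_set D ->
  (lebesgue_rV d D < +oo)%E.
Proof.
move=> mD [M [_ /(_ (`|M| + 1))]] /=.
rewrite (le_lt_trans (ler_norm M)) ?ltrDl // => /(_ isT) DM.
pose A (i : 'I_d) : set R := `[- (`|M| + 1), `|M| + 1]%classic.
have mA : measurable [set x : 'rV[R]_d | forall i, A i (x ord0 i)].
  by apply: measurable_product_set => i; exact: measurable_itv.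
apply: (@le_lt_trans _ _ (lebesgue_rV d [set x : 'rV[R]_d | forall i, A i (x ord0 i)])).
  apply: le_measure; rewrite ?inE // => x /DM xM i.
  rewrite /A /= in_itv /= -ler_norml; apply: le_trans xM.
  rewrite [`|x|]mx_normrE.
  exact: (le_bigmax _ (fun ij => `|x ij.1 ij.2|) (ord0, i)).
rewrite lebesgue_rV_box; last by move=> i; exact: measurable_itv.
have Afin i : lebesgue_measure (A i) \is a fin_num.
  by rewrite /A lebesgue_measure_itv /=; case: ifP.
by rewrite ltey_eq; apply/orP; left; elim/big_ind: _ => // *; exact: fin_numM.
Qed.

End boxes.

(** * The L^2 inner product *)

Section L2_theory.
Context {R : realType} {d : nat} (Omega : set 'rV[R]_d).
Hypotheses (oO : open Omega) (bO : bounded_set Omega).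
Local Notation mu := (lebesgue_rV d).
Implicit Types (u v w z : 'rV[R]_d -> R).

Lemma domain_measurable : measurable Omega.
Proof. exact: measurable_open_rV. Qed.
Local Notation mO := domain_measurable.

Lemma domain_finite : (mu Omega < +oo)%E.
Proof. exact: lebesgue_rV_bounded mO bO. Qed.

Lemma L2_mulr_integrable u v : L2_space Omega u -> L2_space Omega v ->
  mu.-integrable Omega (EFin \o (fun x => u x * v x)).
Proof.
move=> [mu_ fu] [mv fv].
have m2 w : measurable_fun Omega w -> measurable_fun Omega (fun x => (w x ^+ 2)%:E).
  by move=> mw; apply/measurable_EFinP; exact: measurable_funX.
have i2 w : measurable_fun Omega w -> (\int[mu]_(x in Omega) (w x ^+ 2)%:E < +oo)%E ->
    mu.-integrable Omega (fun x => (w x ^+ 2)%:E).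
  move=> mw fw; apply/integrableP; split; first exact: m2.
  by under eq_integral do rewrite gee0_abs ?lee_fin ?sqr_ge0 //.
apply: (le_integrable mO (g := fun x => (u x ^+ 2)%:E + (v x ^+ 2)%:E)%E).
- by apply/measurable_EFinP; exact: measurable_funM.
- move=> x _ /=; rewrite lee_fin [leRHS]ger0_norm ?addr_ge0 ?sqr_ge0 //.
  rewrite normrM -[u x ^+ 2]real_normK ?num_real // -[v x ^+ 2]real_normK ?num_real //.
  by have := normr_ge0 (u x); have := normr_ge0 (v x); nra.
- by apply: integrableD; [exact: mO|exact: i2|exact: i2].
Qed.

Lemma L2_cst (a : R) : L2_space Omega (cst a).
Proof.
split; first exact: measurable_cst.
rewrite (_ : (fun x => _) = cst (a ^+ 2)%:E) // integral_cst //; last exact: mO.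
by rewrite lte_mul_pinfty ?lee_fin ?sqr_ge0 // domain_finite.
Qed.

Lemma L2_integrable u : L2_space Omega u -> mu.-integrable Omega (EFin \o u).
Proof.
move=> /L2_mulr_integrable /(_ (L2_cst 1)); congr (_.-integrable _ _).
by apply/funext => x /=; rewrite mulr1.
Qed.

Let integral_sqrZ w (k : R) : measurable_fun Omega w -> 0 <= k ->
  (\int[mu]_(x in Omega) (k%:E * (w x ^+ 2)%:E) =
   k%:E * \int[mu]_(x in Omega) (w x ^+ 2)%:E)%E.
Proof.
move=> mw k0; rewrite ge0_integralZl_EFin //; first exact: mO.
- by move=> x _; rewrite lee_fin sqr_ge0.
- by apply/measurable_EFinP; exact: measurable_funX.
Qed.

Lemma L2_subspace : lsubspace (L2_space Omega).
Proof.
split; first exact: (L2_cst 0).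
move=> a u v [mu_ fu] [mv fv]; split.
  by apply: measurable_funD => //; apply: measurable_funM => //; exact: measurable_cst.
have m2 w : measurable_fun Omega w -> measurable_fun Omega (fun x => (w x ^+ 2)%:E).
  by move=> mw; apply/measurable_EFinP; exact: measurable_funX.
apply: (@le_lt_trans _ _ (\int[mu]_(x in Omega)
   ((2 * a ^+ 2)%:E * (u x ^+ 2)%:E + 2%:E * (v x ^+ 2)%:E)))%E.
  apply: ge0_le_integral => //; first exact: mO.
  - by move=> x _; rewrite lee_fin sqr_ge0.
  - apply: m2; apply: measurable_funD => //; apply: measurable_funM => //.
  - by apply: emeasurable_funD; apply: measurable_funeM; exact: m2.
  - move=> x _; rewrite -!EFinM -EFinD lee_fin.
    rewrite -subr_ge0 (_ : _ - _ = (a * u x - v x) ^+ 2) ?sqr_ge0 //.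
    rewrite [((a *: u) + v) x](_ : _ = a * u x + v x) //; ring.
rewrite ge0_integralD; last 5 first.
- exact: mO.
- by move=> x _; apply: mule_ge0; rewrite lee_fin ?sqr_ge0 // mulr_ge0 // sqr_ge0.
- by apply: measurable_funeM; exact: m2.
- by move=> x _; apply: mule_ge0; rewrite lee_fin ?sqr_ge0.
- by apply: measurable_funeM; exact: m2.
rewrite !integral_sqrZ //; last by rewrite mulr_ge0 ?sqr_ge0.
by rewrite lte_add_pinfty // lte_mul_pinfty // lee_fin // mulr_ge0 // sqr_ge0.
Qed.

Lemma L2_bounded_mul (k u : 'rV[R]_d -> R) (C : R) : measurable_fun Omega k ->
  (forall x, Omega x -> `|k x| <= C) -> L2_space Omega u ->
  L2_space Omega (fun x => k x * u x).
Proof.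
move=> mk kC [mu_ fu]; split; first exact: measurable_funM.
have m2 w : measurable_fun Omega w -> measurable_fun Omega (fun x => (w x ^+ 2)%:E).
  by move=> mw; apply/measurable_EFinP; exact: measurable_funX.
apply: (@le_lt_trans _ _ (\int[mu]_(x in Omega) ((C ^+ 2)%:E * (u x ^+ 2)%:E)))%E.
  apply: ge0_le_integral => //; first exact: mO.
  - by move=> x _; rewrite lee_fin sqr_ge0.
  - by apply: m2; exact: measurable_funM.
  - by apply: measurable_funeM; exact: m2.
  - move=> x Ox; rewrite -EFinM lee_fin exprMn ler_wpM2r ?sqr_ge0 //.
    by rewrite -[k x ^+ 2]real_normK ?num_real // ler_pXn2r ?nnegrE ?kC // (le_trans _ (kC _ Ox)).
rewrite integral_sqrZ ?sqr_ge0 //.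
by rewrite lte_mul_pinfty // lee_fin sqr_ge0.
Qed.

Lemma inner_semi_inner : semi_inner (L2_space Omega) (inner Omega).
Proof.
split; last by move=> u _; apply: Rint_ge0 => x; rewrite -expr2 sqr_ge0.
split; first exact: L2_subspace.
- move=> a u v w Lu Lv Lw; rewrite /inner.
  under eq_Rintegral => x _.
    rewrite [((a *: u) + v) x](_ : _ = a * u x + v x) // mulrDl -mulrA; over.
  rewrite RintegralD; [|exact: mO| |exact: L2_mulr_integrable]; last first.
    have := integrableZl mO a (L2_mulr_integrable Lu Lw).
    by apply: eq_integrable; [exact: mO|move=> x _ /=; rewrite EFinM].
  by rewrite RintegralZl //; [exact: mO|exact: L2_mulr_integrable].
- by move=> u v _ _; apply: eq_Rintegral => x _; rewrite mulrC.
Qed.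

Lemma inner_ae_eq u v w : measurable_fun Omega u -> measurable_fun Omega v ->
  measurable_fun Omega w -> {ae mu, forall x, Omega x -> u x = v x} ->
  inner Omega u w = inner Omega v w.
Proof.
move=> mu_ mv mw uv; rewrite /inner /Rintegral; congr fine.
apply: ae_eq_integral; first exact: mO.
- by apply/measurable_EFinP; exact: measurable_funM.
- by apply/measurable_EFinP; exact: measurable_funM.
- by apply: filterS uv => x h /h ->.
Qed.

End L2_theory.

(** * The fundamental lemma of the calculus of variations *)

Section fundamental_lemma.
Context {R : realType} {d : nat} (Omega : set 'rV[R]_d).
Hypotheses (oO : open Omega) (bO : bounded_set Omega).
Local Notation mu := (lebesgue_rV d).
Local Notation mO := (domain_measurable oO).
Implicit Types (u v w z phi : 'rV[R]_d -> R).

Lemma test_continuous phi : test_function Omega phi -> continuous phi.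
Proof. by case=> /(_ [::]) []. Qed.

Lemma test_bounded phi : test_function Omega phi ->
  exists C, forall x, `|phi x| <= C.
Proof.
move=> tphi; have [_ cK _] := tphi.
have cphi := test_continuous tphi.
have : compact (phi @` closure [set x | phi x != 0]).
  by apply: continuous_compact => //; exact: continuous_subspaceT.
move=> /compact_bounded[M [_ /(_ (`|M| + 1))]].
rewrite (le_lt_trans (ler_norm M)) ?ltrDl // => /(_ isT) KM.
exists (`|M| + 1) => x; have [x0|x0] := eqVneq (phi x) 0.
  by rewrite x0 normr0 addr_ge0.
by apply: KM; exists x => //; exact: subset_closure.
Qed.

Lemma test_L2 phi : test_function Omega phi -> L2_space Omega phi.
Proof.
move=> tphi; have [C phiC] := test_bounded tphi.
rewrite (_ : phi = fun x => phi x * cst 1 x); last first.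
  by apply/funext => x; rewrite /= mulr1.
apply: (@L2_bounded_mul _ _ _ oO phi (cst 1) C) => //.
  exact: measurable_continuous_rV (test_continuous tphi).
exact: L2_cst.
Qed.

Lemma partial_support phi i :
  [set x | partial i phi x != 0] `<=` closure [set x | phi x != 0].
Proof.
move=> x /= dx; apply: contrapT => nx; move/eqP: dx; apply.
rewrite /partial (@near_eq_derive _ _ _ _ (cst 0)) ?derive_cst //.
have h : nbhs x (~` closure [set x | phi x != 0]).
  apply: open_nbhs_nbhs; split => //; apply: closed_openC; exact: closed_closure.
apply: filterS h => y ny; apply/eqP; apply: contrapT => /negP y0; apply: ny.
exact: subset_closure.
Qed.

Lemma test_partial phi i : test_function Omega phi ->
  test_function Omega (partial i phi).
Proof.
move=> [sphi cK KO].
have sub : closure [set x | partial i phi x != 0] `<=` closure [set x | phi x != 0].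
  rewrite [X in _ `<=` X](closure_id _).1; last exact: closed_closure.
  by apply: closureS; exact: partial_support.
split; first exact: smooth_partial.
- by apply: (subclosed_compact _ cK sub); exact: closed_closure.
- exact: subset_trans KO.
Qed.

Section orthogonal_to_tests.
Variable z : 'rV[R]_d -> R.
Hypothesis Lz : L2_space Omega z.
Hypothesis z_test : forall phi, test_function Omega phi -> inner Omega z phi = 0.

Let iz : mu.-integrable Omega (EFin \o z).
Proof. exact: L2_integrable. Qed.

(** Dominated convergence along the bumps of the box. *)
Lemma integral_open_box0 a b : closed_box a b `<=` Omega ->
  (\int[mu]_(x in open_box a b) (z x)%:E = 0)%E.
Proof.
move=> abO.
have obO : open_box a b `<=` Omega.
  by move=> x xb; apply: abO => i; have /andP[? ?] := xb i; rewrite !ltW.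
pose f k x := (z x * box_bump a b k x)%:E.
have mz : measurable_fun Omega z by case: Lz.
have [|||||_ _] := @dominated_convergence _ _ _ mu Omega mO f
  (fun x => (z x * \1_(open_box a b) x)%:E) (fun x => `|(z x)%:E|%E).
- move=> k; apply/measurable_EFinP; apply: measurable_funM => //.
  by apply: measurable_continuous_rV; apply: test_continuous; exact: bump_test_function.
- apply/measurable_EFinP; apply: measurable_funM => //.
  by apply: measurable_indic; exact: measurable_open_box.
- apply/aeW => x _; apply: cvg_EFin; first by apply: nearW => k.
  by apply: cvgM; [exact: cvg_cst|exact: box_bump_cvg].
- exact: integrable_abse.
- apply/aeW => x k _; rewrite /f lee_fin normrM ler_piMr //.
  by rewrite ger0_norm ?box_bump_ge0 // box_bump_le1.
rewrite [X in X @ _ --> _](_ : _ = cst 0%E); last first.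
  apply/funext => k; have tk := bump_test_function k abO.
  have := z_test tk; rewrite /inner /Rintegral /f /= => h.
  rewrite -[LHS]fineK ?h //.
  have L := L2_mulr_integrable oO Lz (test_L2 tk).
  by have := integrable_fin_num mO L.
move=> h; have {h} := cvg_unique _ h (cvg_cst _) => <-//.
rewrite -[in LHS](setIidr obO) integral_mkcondr; apply: eq_integral => x _.
by rewrite patchE indicE; case: ifP => _; rewrite ?mulr1 ?mulr0.
Qed.

(* a pi-system of orthants generating the Borel sets *)
Let G : set (set 'rV[R]_d) :=
  [set A | exists l : 'I_d -> R, A = [set x : 'rV[R]_d | forall i, l i < x ord0 i]].

Let G_setI : setI_closed G.
Proof.
move=> _ _ [l ->] [m ->]; exists (fun i => Num.max (l i) (m i)).
apply/seteqP; split => x /=.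
  by move=> [lx mx] i; rewrite gt_max lx mx.
by move=> lmx; split => i; have := lmx i; rewrite gt_max => /andP[].
Qed.

Let measurable_G : (@measurable _ 'rV[R]_d) `<=` <<s G >>.
Proof.
apply: smallest_sub; first exact: smallest_sigma_algebra.
rewrite -bigcup_seq => A [i /= _ [B mB <-]]; rewrite setTI.
pose H : set (set R) := [set C | <<s G >> ((fun x : 'rV[R]_d => x ord0 i) @^-1` C)].
have sG : sigma_algebra setT <<s G >> by exact: smallest_sigma_algebra.
have [G0 GC GU] := sG.
have sH : sigma_algebra setT H.
  split; rewrite /H /=; first by rewrite preimage_set0.
  - by move=> C HC; rewrite setTD; have := GC _ HC; rewrite setTD.
  - by move=> F HF; rewrite preimage_bigcup; exact: GU.
suff : (@measurable _ R) `<=` H by move=> /(_ _ mB).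
have -> : (@measurable _ R) = <<s @RGenOInfty.G R >> by exact: RGenOInfty.measurableE.
apply: smallest_sub => // _ [x ->].
rewrite /H /=.
rewrite (_ : _ @^-1` _ = \bigcup_(k : nat) [set y : 'rV[R]_d | forall j,
    (if j == i then x else - k%:R) < y ord0 j]); last first.
  apply/seteqP; split => y.
    rewrite /= in_itv /= andbT => xy.
    have [k ky] : exists k : nat, forall j, - k%:R < y ord0 j.
      exists (Num.truncn `|y|).+1 => j; rewrite ltrNl.
      apply: le_lt_trans (truncnS_gt _); rewrite -normrN.
      apply: le_trans (ler_norm _) _; rewrite normrN [leRHS]mx_normrE normrN.
      exact: (le_bigmax _ (fun ij => `|y ij.1 ij.2|) (ord0, j)).
    by exists k => // j; case: eqP => [->|_].
  by move=> [k _ /(_ i)]; rewrite eqxx /= in_itv /= andbT.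
apply: GU => k; apply: sub_sigma_algebra.
by exists (fun j => if j == i then x else - k%:R).
Qed.

(** Intersecting an orthant with a box gives a box, so the measurable sets E for which
    the integral vanishes form a Dynkin system containing a generating pi-system. *)
Lemma integral_measurable_box0 a b E : closed_box a b `<=` Omega -> measurable E ->
  (\int[mu]_(x in E `&` open_box a b) (z x)%:E = 0)%E.
Proof.
move=> abO mE.
have obO : open_box a b `<=` Omega.
  by move=> x xb; apply: abO => i; have /andP[? ?] := xb i; rewrite !ltW.
have mb := measurable_open_box a b.
have izb F : F `<=` open_box a b -> measurable F ->
    mu.-integrable F (EFin \o z).
  move=> Fb mF; apply: (integrableS mO mF) iz.
  exact: subset_trans obO.
pose H : set (set 'rV[R]_d) := [set A | measurable A /\
  (\int[mu]_(x in A `&` open_box a b) (z x)%:E = 0)%E].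
suff : <<s G >> `<=` H by move=> /(_ E (measurable_G mE)) [].
rewrite -setI_closed_g_dynkin_g_sigma_algebra //; apply: smallest_sub.
  split.
  - by split => //; rewrite setTI integral_open_box0.
  - move=> A [mA A0]; split; first exact: measurableC.
    have mAb := measurableI _ _ mA mb.
    have mCb := measurableI _ _ (measurableC mA) mb.
    have := integral_setU mu (f := EFin \o z) mAb mCb.
    rewrite -setIUl setUv setTI integral_open_box0 //= A0 add0e => <- //.
      by have /integrableP[] := izb _ (@subset_refl _ _) mb.
    rewrite disj_set2E; apply/eqP; rewrite setIACA setICr set0I //.
  - move=> F tF HF; have mF k : measurable (F k) by case: (HF k).
    split; first exact: bigcupT_measurable.
    rewrite setI_bigcupl integral_bigcup.
    + by rewrite eseries0 // => k _ _; case: (HF k).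
    + by apply: trivIset_setIr.
    + by move=> k; exact: measurableI.
    + apply: izb; first by rewrite -setI_bigcupl; exact: subIsetr.
      by apply: bigcupT_measurable => k; exact: measurableI.
move=> _ [l ->]; split.
  rewrite (_ : mkset _ = [set x : 'rV[R]_d | forall i, `]l i, +oo[%classic (x ord0 i)]).
    apply: (@measurable_product_set _ _ (fun i => `]l i, +oo[%classic)) => i.
    exact: measurable_itv.
  apply/seteqP; split => x h i; first by have := h i; rewrite /= in_itv /= andbT.
  by have := h i; rewrite /= in_itv /= andbT.
rewrite (_ : _ `&` _ = open_box (fun i => Num.max (l i) (a i)) b).
  apply: integral_open_box0 => x xb; apply: abO => i.
  by have := xb i; rewrite ge_max => /andP[/andP[_ ->] ->].
apply/seteqP; split => x /=.
  by move=> [lx ab] i; have /andP[? ?] := ab i; rewrite gt_max lx; apply/andP; split.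
by move=> h; split => i; have := h i; rewrite gt_max => /andP[/andP[? ?] ?] //; apply/andP.
Qed.

(** A function whose integral over every measurable subset of a box vanishes is zero
    almost everywhere on the box, and countably many boxes cover the domain. *)
Lemma fundamental_lemma : {ae mu, forall x, Omega x -> z x = 0}.
Proof.
have [B [BP OB]] := open_box_cover oO.
have aeB k : mu.-negligible (B k `&` [set x | z x != 0]).
  have [->|[a [b [abO ->]]]] := BP k; first by rewrite set0I; exact: negligible_set0.
  have mb := measurable_open_box a b.
  have obO : open_box a b `<=` Omega.
    by move=> x xb; apply: abO => i; have /andP[? ?] := xb i; rewrite !ltW.
  have : ae_eq mu (open_box a b) (EFin \o z) (cst 0%E).
    apply: integral_ae_eq => //.
    - exact: (integrableS mO mb obO).
    move=> E Eb mE; rewrite integral0 -(setIidl Eb).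
    exact: integral_measurable_box0.
  apply: negligibleS => x [xb z0] /(_ xb) [z0']; move/eqP: z0; apply.
  exact: z0'.
apply: negligibleS (negligible_bigcup aeB) => x /= /not_implyP[].
by rewrite {1}OB => -[k _ Bx] z0; exists k => //; split => //; exact/eqP.
Qed.

End orthogonal_to_tests.
End fundamental_lemma.

(** * Integrals of partial derivatives *)

Section integral_of_derivative.
Context {R : realType}.

Lemma rV_cons_tail_shift n (t h : R) (y : 'rV[R]_n) (j : 'I_n) :
  rV_cons (t, h *: delta_mx ord0 j + y) =
  h *: delta_mx ord0 (lift ord0 j) + rV_cons (t, y).
Proof.
apply/rowP => k; rewrite [RHS]mxE !rV_consE [X in _ = X + _]mxE [X in _ = _ * X + _]mxE eqxx /=.
case: unliftP => [l ->|->] /=; last by rewrite mulr0 add0r.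
by rewrite !mxE eqxx /= (inj_eq lift_inj).
Qed.

Lemma rV_cons_head_shift n (t h : R) (y : 'rV[R]_n) :
  rV_cons (h *: 1 + t, y) = h *: delta_mx ord0 ord0 + rV_cons (t, y).
Proof.
apply/rowP => k; rewrite [RHS]mxE !rV_consE [X in _ = X + _]mxE [X in _ = _ * X + _]mxE eqxx /=.
by case: unliftP => [l ->|->] //=; rewrite ?mulr0 ?mulr1 ?add0r.
Qed.

Lemma rV_cons_ball n (t s e : R) (y z : 'rV[R]_n) : ball t e s -> ball y e z ->
  ball (rV_cons (t, y)) e (rV_cons (s, z)).
Proof.
move=> ts [e0 yz]; split => // i j; rewrite (_ : i = ord0); last exact: ord1.
by rewrite !rV_consE; case: unliftP => [k _|_] /=.
Qed.

Lemma continuous_rV_cons_head n (y : 'rV[R]_n) :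
  continuous (fun t : R => rV_cons (t, y)).
Proof.
move=> t A /= /(nbhs_ballP (rV_cons (t, y)))[e e0 eA].
by apply/(nbhs_ballP t); exists e => // s ts; apply/eA/rV_cons_ball => //; exact: ballxx.
Qed.

Lemma continuous_rV_cons_tail n (t : R) :
  continuous (fun y : 'rV[R]_n => rV_cons (t, y)).
Proof.
move=> y A /= /(nbhs_ballP (rV_cons (t, y)))[e e0 eA].
by apply/(nbhs_ballP y); exists e => // z yz; apply/eA/rV_cons_ball => //; exact: ballxx.
Qed.

Lemma integral_partial0_R (F f : R -> R) (M : R) :
  (forall t : R, is_derive t 1 F (f t)) -> continuous f ->
  (forall t, M < `|t| -> F t = 0 /\ f t = 0) ->
  (\int[lebesgue_measure]_t (f t)%:E = 0)%E.
Proof.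
move=> dF cf FM; pose N := `|M| + 1.
have MN : M < N by rewrite /N (le_lt_trans (ler_norm M)) // ltrDl.
have N0 : 0 < N by rewrite /N ltr_wpDl.
have -> : (\int[lebesgue_measure]_t (f t)%:E =
    \int[lebesgue_measure]_(t in `[(- N)%R, N]) (f t)%:E)%E.
  rewrite [RHS]integral_mkcond; apply: eq_integral => t _; rewrite patchE.
  case: ifPn => //; rewrite notin_setE /= in_itv /= => /negP.
  rewrite -ler_norml -ltNge => Nt; have [_ ->//] := FM t (lt_trans MN Nt).
have cF : continuous F.
  by move=> t; apply/differentiable_continuous/derivable1_diffP; case: (dF t).
rewrite (@continuous_FTC2 _ f F).
- have NM : M < `|N| by rewrite gtr0_norm.
  have NM' : M < `|- N| by rewrite normrN.
  by rewrite (FM _ NM).1 (FM _ NM').1 subee.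
- by rewrite gtrN.
- exact: continuous_subspaceT.
- split; first by move=> t _; case: (dF t).
    by apply: cvg_at_right_filter; exact: cF.
  by apply: cvg_at_left_filter; exact: cF.
- by move=> t _; rewrite derive1E; case: (dF t).
Qed.

Lemma integrable_compact_support n (g : 'rV[R]_n -> R) (M : R) : continuous g ->
  (forall (x : 'rV[R]_n) j, M < `|x ord0 j| -> g x = 0) ->
  (lebesgue_rV n).-integrable setT (EFin \o g).
Proof.
move=> cg gM; pose D := closed_box (fun _ : 'I_n => - M) (fun _ => M) : set 'rV[R]_n.
have cD : compact D by exact: compact_closed_box.
have mD : measurable D.
  rewrite /D closed_boxE.
  apply: (@measurable_product_set _ _ (fun i => `[- M, M]%classic)) => i.
  exact: measurable_itv.
have gD x : ~ D x -> g x = 0.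
  by move=> /existsNP[i /negP]; rewrite -ler_norml -ltNge; exact: gM.
have finD := lebesgue_rV_bounded mD (compact_bounded cD).
have : compact (g @` D) by apply: continuous_compact => //; exact: continuous_subspaceT.
move=> /compact_bounded[C [_ /(_ (`|C| + 1))]].
rewrite (le_lt_trans (ler_norm C)) ?ltrDl // => /(_ isT) DC.
apply/integrableP; split; first by apply/measurable_EFinP; exact: measurable_continuous_rV.
apply: (@le_lt_trans _ _ (\int[lebesgue_rV n]_(x in D) (cst (`|C| + 1)%:E x)))%E; last first.
  by rewrite integral_cst // lte_mul_pinfty // lee_fin addr_ge0.
rewrite [leRHS]integral_mkcond; apply: ge0_le_integral => //.
- by apply/measurable_EFinP; apply: measurableT_comp => //; exact: measurable_continuous_rV.
- by apply/(measurable_restrictT _ mD); exact: measurable_cst.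
- move=> x _ /=; rewrite patchE; case: ifPn => [|/negP].
    by rewrite inE => Dx; rewrite lee_fin; apply: DC; exists x.
  by rewrite inE => /gD ->; rewrite normr0.
Qed.

(** By Fubini's theorem, coordinate by coordinate: the induction splits off the first
    coordinate. If the derivative is along it, the inner integral is that of a
    derivative on the line, otherwise it vanishes by induction. *)
Lemma integral_partial0 n (F g : 'rV[R]_n -> R) (i : 'I_n) (M : R) :
  (forall x, is_derive x (delta_mx ord0 i) F (g x)) -> continuous g ->
  (forall (x : 'rV[R]_n) j, M < `|x ord0 j| -> F x = 0 /\ g x = 0) ->
  (\int[lebesgue_rV n]_x (g x)%:E = 0)%E.
Proof.
elim: n F g i => [|n ih] F g i dF cg FM; first by case: i dF.
have ig := integrable_compact_support cg (fun x j h => (FM x j h).2).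
have mg : measurable_fun setT g by exact: measurable_continuous_rV.
have mc : measurable_fun [set: measurableTypeR R * 'rV[R]_n] (@rV_cons R n).
  exact: measurable_rV_cons.
pose m2 : {measure set (measurableTypeR R * 'rV[R]_n) -> \bar R} :=
  product_measure1 (@lebesgue_measure R) (lebesgue_rV n).
pose G (z : R * 'rV[R]_n) : \bar R := (g (rV_cons z))%:E.
have iG : (lebesgue_measure \x lebesgue_rV n)%E.-integrable setT G.
  apply/integrableP; split.
    by apply/measurable_EFinP; apply: (measurableT_comp mg); exact: mc.
  have /integrableP[_] := ig; apply: le_lt_trans.
  have := @ge0_integral_pushforward _ _ _ _ _ _ mc
    m2 setT (fun x => `|(g x)%:E|%E) measurableT.
  rewrite preimage_setT => <- //.
  apply: measurableT_comp => //; apply/measurable_EFinP; exact: mg.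
have -> : (\int[lebesgue_rV n.+1]_x (g x)%:E =
    \int[lebesgue_measure \x lebesgue_rV n]_z G z)%E.
  have := @integral_pushforward _ _ _ _ _ _ mc
    m2 setT (EFin \o g).
  rewrite preimage_setT; apply => //; apply/measurable_EFinP; exact: mg.
case: (unliftP ord0 i) => [j ij|i0].
  rewrite -integral12_prod_meas1 // /fubini_F.
  rewrite integral0_eq // => t _; apply: (ih (fun y => F (rV_cons (t, y))) _ j).
  - move=> y; have [dx dE] := dF (rV_cons (t, y)).
    have E : (fun h : R => h^-1 *: (((fun y => F (rV_cons (t, y))) \o shift y)
       (h *: delta_mx ord0 j) - F (rV_cons (t, y)))) =
      (fun h : R => h^-1 *: ((F \o shift (rV_cons (t, y)))
         (h *: delta_mx ord0 i) - F (rV_cons (t, y)))).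
      by apply/funext => h /=; rewrite rV_cons_tail_shift ij.
    by split; rewrite /derivable /derive E; [exact: dx|exact: dE].
  - move=> y; apply: (@continuous_comp _ _ _ (fun y => rV_cons (t, y)) g).
      exact: continuous_rV_cons_tail.
    exact: cg.
  - by move=> y k yk; apply: (FM _ (lift ord0 k)); rewrite rV_consE liftK.
rewrite -integral21_prod_meas1 // /fubini_G.
rewrite integral0_eq // => y _; apply: (@integral_partial0_R (fun t => F (rV_cons (t, y))) _ M).
- move=> t; have [dx dE] := dF (rV_cons (t, y)).
  have E : (fun h : R => h^-1 *: (((fun t => F (rV_cons (t, y))) \o shift t)
       (h *: 1) - F (rV_cons (t, y)))) =
    (fun h : R => h^-1 *: ((F \o shift (rV_cons (t, y)))
         (h *: delta_mx ord0 i) - F (rV_cons (t, y)))).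
    by apply/funext => h /=; rewrite rV_cons_head_shift i0.
  by split; rewrite /derivable /derive E; [exact: dx|exact: dE].
- move=> t; apply: (@continuous_comp _ _ _ (fun t => rV_cons (t, y)) g).
    exact: continuous_rV_cons_head.
  exact: cg.
- by move=> t tM; apply: (FM _ ord0); rewrite rV_consE unlift_none.
Qed.

End integral_of_derivative.

(** * The Sobolev spaces H^1 and H^1_0 *)

Section sobolev_theory.
Context {R : realType} {d : nat} (Omega : set 'rV[R]_d).
Hypotheses (oO : open Omega) (bO : bounded_set Omega).
Local Notation mu := (lebesgue_rV d).
Local Notation mO := (domain_measurable oO).
Local Notation L2 := (L2_space Omega).
Local Notation H1 := (H1_space Omega).
Local Notation H2 := (H2_space Omega).
Local Notation sL2 := (L2_subspace oO bO).
Local Notation sip := (inner_semi_inner oO bO).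
Local Notation sf := (inner_semi_inner oO bO).1.
Implicit Types (u v w z phi psi : 'rV[R]_d -> R).

Lemma test_out phi x : test_function Omega phi -> ~ Omega x -> phi x = 0.
Proof.
move=> [_ _ KO] Ox; apply/eqP; apply: contrapT => /negP x0; apply: Ox.
exact/KO/subset_closure.
Qed.

Lemma test_zero : test_function Omega 0.
Proof.
have supp0 : [set x : 'rV[R]_d | (0 : 'rV[R]_d -> R) x != 0] = set0.
  by apply/seteqP; split => x //=; rewrite eqxx.
split; first by apply/smoothE => m; exact: Ck_cst.
  by rewrite supp0 closure0; exact: compact0.
by rewrite supp0 closure0.
Qed.

Lemma test_lin a phi psi : test_function Omega phi -> test_function Omega psi ->
  test_function Omega (a *: phi + psi).
Proof.
move=> [s1 c1 K1] [s2 c2 K2].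
have sub : closure [set x | (a *: phi + psi) x != 0] `<=`
    closure [set x | phi x != 0] `|` closure [set x | psi x != 0].
  rewrite -closureU; apply: closureS => x /= nz.
  have [p0|p0] := eqVneq (phi x) 0; last by left.
  right => /=; apply: contra nz => /eqP q0.
  by rewrite [_ x](_ : _ = a * phi x + psi x) // p0 q0 mulr0 addr0.
split.
- apply/smoothE => m; apply: CkD; first by apply: CkZ; exact: (smoothE _).1.
  exact: (smoothE _).1.
- apply: (subclosed_compact _ (compactU c1 c2) sub); exact: closed_closure.
- by move=> x /sub[/K1|/K2].
Qed.

Lemma test_support_bounded phi : test_function Omega phi ->
  exists M : R, forall (x : 'rV[R]_d) j, M < `|x ord0 j| -> phi x = 0.
Proof.
move=> [_ /compact_bounded[C [_ CK]] _]; have := CK (`|C| + 1).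
rewrite (le_lt_trans (ler_norm C)) ?ltrDl // => /(_ isT) KC.
exists (`|C| + 1) => x j xj; apply/eqP; apply: contrapT => /negP x0.
have clx : closure [set x | phi x != 0] x by exact: subset_closure.
have := KC x clx; rewrite /= leNgt => /negP; apply.
apply: lt_le_trans xj _; rewrite [leRHS]mx_normrE.
exact: (le_bigmax _ (fun ij => `|x ij.1 ij.2|) (ord0, j)).
Qed.

(** Integration by parts: the integral of the partial derivative of the product
    [phi * psi] vanishes by [integral_partial0]. *)
Lemma test_weak_partial phi i : test_function Omega phi ->
  weak_partial Omega i phi (partial i phi).
Proof.
move=> tphi; have tdphi := test_partial i tphi.
split; first exact: test_L2.
move=> psi tpsi; have tdpsi := test_partial i tpsi.
pose g x := phi x * partial i psi x + psi x * partial i phi x.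
have [M phiM] := test_support_bounded tphi.
have [M' dphiM] := test_support_bounded tdphi.
have dphipsi x : is_derive x (delta_mx ord0 i) (phi * psi) (g x).
  have [sphi _ _] := tphi; have [spsi _ _] := tpsi.
  have d1 := (sphi [::]).2 i x; have d2 := (spsi [::]).2 i x.
  by split; [exact: derivableM|rewrite deriveM].
have cg : continuous g.
  have -> : g = phi * partial i psi + psi * partial i phi by [].
  move=> x; apply: continuousD; apply: continuousM.
  - exact: (test_continuous tphi).
  - exact: (test_continuous tdpsi).
  - exact: (test_continuous tpsi).
  - exact: (test_continuous tdphi).
have := @integral_partial0 R d (phi * psi) g i (Num.max M M') dphipsi cg.
have g0 (x : 'rV[R]_d) (j : 'I_d) : Num.max M M' < `|x ord0 j| -> (phi * psi) x = 0 /\ g x = 0.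
  rewrite gt_max => /andP[/phiM p0 /dphiM q0].
  by rewrite /g mulrfctE p0 q0 !mul0r mulr0 addr0.
move=> /(_ g0) intg0.
have LM f1 f2 : test_function Omega f1 -> test_function Omega f2 ->
    mu.-integrable Omega (EFin \o (fun x => f1 x * f2 x)).
  by move=> t1 t2; apply: (L2_mulr_integrable oO); exact: test_L2.
have : inner Omega phi (partial i psi) + inner Omega psi (partial i phi) = 0.
  rewrite /inner -RintegralD; [|exact: mO|exact: LM|exact: LM].
  rewrite /Rintegral -[RHS]/(fine 0%E); congr fine; rewrite -intg0.
  rewrite integral_mkcond; apply: eq_integral => x _; rewrite patchE.
  case: ifPn => //; rewrite notin_setE => Ox.
  by rewrite /g !(test_out _ Ox) // mul0r addr0.
move=> /eqP; rewrite addr_eq0 => /eqP ->; congr (- _).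
by apply: (symformC sf); exact: test_L2.
Qed.

Lemma wdP u i : H1 u -> weak_partial Omega i u (wd Omega i u).
Proof. by move=> [_ /(_ i) [g wg]]; apply: getPex; exists g. Qed.

Lemma wd_L2 u i : H1 u -> L2 (wd Omega i u).
Proof. by move=> /(wdP i) []. Qed.

Lemma H1_L2 u : H1 u -> L2 u. Proof. by case. Qed.

(** The difference of two weak derivatives is orthogonal to all test functions. *)
Lemma weak_partial_unique u i g1 g2 w : weak_partial Omega i u g1 ->
  weak_partial Omega i u g2 -> L2 w -> inner Omega g1 w = inner Omega g2 w.
Proof.
move=> [L1 p1] [Lg2 p2] Lw; have LB := subB sL2 L1 Lg2.
have [m1 _] := L1; have [m2 _] := Lg2; have [mw _] := Lw.
have aez := @fundamental_lemma R d Omega oO bO (g1 - g2) LB.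
apply: inner_ae_eq => //.
have : forall phi, test_function Omega phi -> inner Omega (g1 - g2) phi = 0.
  move=> phi tphi; rewrite (symformBl sf L1 Lg2 (test_L2 oO bO tphi)).
  by apply/eqP; rewrite subr_eq0 -eqr_opp -p1 // p2.
move=> /aez; apply: filterS => x h /h /eqP.
by rewrite [_ x](_ : _ = g1 x - g2 x) // subr_eq0 => /eqP.
Qed.

Lemma weak_partial_lin a u v i g k : L2 u -> L2 v ->
  weak_partial Omega i u g -> weak_partial Omega i v k ->
  weak_partial Omega i (a *: u + v) (a *: g + k).
Proof.
move=> Lu Lv [Lg pg] [Lk pk]; split; first exact: sL2.2.
move=> phi tphi; have Lp := test_L2 oO bO tphi.
have Ldp := test_L2 oO bO (test_partial i tphi).
by rewrite !(symformP sf) // pg // pk //; ring.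
Qed.

(** A weak derivative depends on the class of the function only. As equal sets of
    weak derivatives have the same chosen element, this turns equality almost
    everywhere of [u] and [v] into equality of their derivatives [wd]. *)
Lemma weak_partial_eq u v i : (forall w, L2 w -> inner Omega u w = inner Omega v w) ->
  weak_partial Omega i u = weak_partial Omega i v.
Proof.
move=> uv; apply/seteqP; split => g [Lg pg]; split => // phi tphi;
  have Ldp := test_L2 oO bO (test_partial i tphi); by rewrite ?uv ?pg // -uv ?pg.
Qed.

Lemma H1_subspace : lsubspace H1.
Proof.
split.
  have t0 := test_zero.
  by split; [exact: test_L2|move=> i; exists (partial i 0); exact: test_weak_partial].
move=> a u v [Lu du] [Lv dv]; split; first exact: sL2.2.
move=> i; have [g wg] := du i; have [k wk] := dv i.
by exists (a *: g + k); exact: weak_partial_lin.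
Qed.

Lemma wd_weakly_linear i : weakly_linear H1 L2 (inner Omega) (wd Omega i).
Proof.
split=> [u|a u v w Hu Hv Lw]; first exact: wd_L2.
rewrite (@weak_partial_unique (a *: u + v) i _ (a *: wd Omega i u + wd Omega i v) w) //.
- by rewrite (symformP sf) //; exact: wd_L2.
- by apply: wdP; exact: H1_subspace.2.
- by apply: weak_partial_lin; (exact: H1_L2 || exact: wdP).
Qed.

Lemma inner_grad_semi_inner : semi_inner H1 (inner_grad Omega).
Proof.
apply: semi_inner_sum; first exact: H1_subspace.
move=> i; apply: (semi_inner_pull H1_subspace sip); exact: wd_weakly_linear.
Qed.

Definition form1 u v : R := inner Omega u v + inner_grad Omega u v.

Lemma form1_semi_inner : semi_inner H1 form1.
Proof.
apply: semi_innerD; last exact: inner_grad_semi_inner.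
exact: semi_inner_subset H1_subspace H1_L2 sip.
Qed.

Lemma L2normE u : L2norm Omega u = fnorm (inner Omega) u. Proof. by []. Qed.

Lemma semi1E u : H1 u -> semi1 Omega u = fnorm (inner_grad Omega) u.
Proof.
move=> Hu; congr Num.sqrt; apply: eq_bigr => i _.
by rewrite L2normE (fnorm_sqr sip) //; exact: wd_L2.
Qed.

Lemma norm1E u : H1 u -> norm1 Omega u = fnorm form1 u.
Proof.
move=> Hu; congr Num.sqrt; rewrite L2normE (fnorm_sqr sip) ?semi1E //; last by case: Hu.
by rewrite (fnorm_sqr inner_grad_semi_inner).
Qed.

Lemma test_H1 phi : test_function Omega phi -> H1 phi.
Proof.
move=> tphi; split; first exact: test_L2.
by move=> i; exists (partial i phi); exact: test_weak_partial.
Qed.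

Lemma H10_H1 u : H10_space Omega u -> H1 u. Proof. by case. Qed.

Lemma H10_subspace : lsubspace (H10_space Omega).
Proof.
have sH := H1_subspace; have s1 := form1_semi_inner.
split.
  split; first exact: sH.1.
  have N0 : norm1 Omega 0 = 0.
    rewrite norm1E; last exact: (sub0 sH).
    by rewrite /fnorm (symform0l s1.1 (sub0 sH)) sqrtr0.
  by move=> e e0; exists 0; [exact: test_zero|rewrite subrr N0].
move=> a u v [Hu du] [Hv dv]; split; first exact: sH.2.
move=> e e0; have e2 : 0 < e / 2 by rewrite divr_gt0.
(* |a| + 1 instead of |a|, which may be zero *)
have a1 : 0 < `|a| + 1 by rewrite ltr_wpDl.
have [phi tphi up] := du _ (divr_gt0 e2 a1); have [psi tpsi vp] := dv _ e2.
exists (a *: phi + psi); first exact: test_lin.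
have Hp := subB sH Hu (test_H1 tphi); have Hq := subB sH Hv (test_H1 tpsi).
have -> : a *: u + v - (a *: phi + psi) = a *: (u - phi) + (v - psi).
  by rewrite scalerBr opprD addrACA.
rewrite norm1E; last exact: sH.2.
apply: (le_lt_trans (fnormD s1 (subZ sH a Hp) Hq)).
rewrite (fnormZ s1) // -!norm1E // [e]splitr; apply: ltr_leD (ltW vp) => //.
apply: (@le_lt_trans _ _ ((`|a| + 1) * norm1 Omega (u - phi))).
  by rewrite ler_wpM2r ?sqrtr_ge0 // lerDl.
by rewrite mulrC -ltr_pdivlMr.
Qed.

End sobolev_theory.

(** * Second derivatives and vector fields *)

Section second_order.
Context {R : realType} {d : nat} (Omega : set 'rV[R]_d).
Hypotheses (oO : open Omega) (bO : bounded_set Omega).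
Local Notation mu := (lebesgue_rV d).
Local Notation mO := (domain_measurable oO).
Local Notation L2 := (L2_space Omega).
Local Notation H1 := (H1_space Omega).
Local Notation H2 := (H2_space Omega).
Local Notation sL2 := (L2_subspace oO bO).
Local Notation sip := (inner_semi_inner oO bO).
Local Notation sf := (inner_semi_inner oO bO).1.
Local Notation sH1 := (H1_subspace oO bO).
Implicit Types (u v w z phi psi : 'rV[R]_d -> R).

Lemma weak_partial_wd_lin a u v i j : H1 u -> H1 v ->
  weak_partial Omega j (wd Omega i (a *: u + v)) =
  weak_partial Omega j (a *: wd Omega i u + wd Omega i v).
Proof.
move=> Hu Hv; apply: weak_partial_eq => // w Lw.
have [_ l] := wd_weakly_linear oO bO i.
by rewrite l // (symformP sf) //; exact: wd_L2.
Qed.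

(** An equality of functions, although the inner derivatives agree only almost
    everywhere: see [weak_partial_eq]. *)
Lemma wd_wd_lin a u v i j : H1 u -> H1 v ->
  wd Omega j (wd Omega i (a *: u + v)) = wd Omega j (a *: wd Omega i u + wd Omega i v).
Proof.
move=> Hu Hv.
exact: (congr1 (fun X => get X) (weak_partial_wd_lin a i j Hu Hv)).
Qed.

Lemma H2_subspace : lsubspace H2.
Proof.
have key a u v i : H1 u -> H1 v -> H1 (wd Omega i u) -> H1 (wd Omega i v) ->
    H1 (wd Omega i (a *: u + v)).
  move=> Hu Hv Du Dv; split; first by apply: wd_L2 => //; exact: sH1.2.
  move=> j; rewrite weak_partial_wd_lin //.
  by have [_] := sH1.2 a _ _ Du Dv; apply.
split.
  split; first exact: sH1.1.
  move=> i; have H0 := sH1.1.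
  split; first exact: wd_L2.
  move=> j; have := @weak_partial_eq _ _ _ oO bO (wd Omega i 0) 0 j.
  have l0 w : L2 w -> inner Omega (wd Omega i 0) w = 0.
    move=> Lw; have [_ l] := wd_weakly_linear oO bO i.
    by have := l 1 0 0 w H0 H0 Lw; rewrite scaler0 addr0 mul1r; lra.
  move=> -> => [|w Lw]; first by have [_] := H0; apply.
  by rewrite l0 // (symform0l sf).
move=> a u v [Hu Du] [Hv Dv]; split; first exact: sH1.2.
by move=> i; apply: key.
Qed.

Definition form2 u v : R :=
  \sum_i \sum_j inner Omega (wd Omega j (wd Omega i u)) (wd Omega j (wd Omega i v)).

Lemma wd2_weakly_linear i j :
  weakly_linear H2 L2 (inner Omega) (fun u => wd Omega j (wd Omega i u)).
Proof.
have [dj lj] := wd_weakly_linear oO bO j.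
split=> [u [_ /(_ i)]|a u v w [Hu Du] [Hv Dv] Lw]; first exact: dj.
by rewrite wd_wd_lin // lj.
Qed.

Lemma form2_semi_inner : semi_inner H2 form2.
Proof.
have sH2 := H2_subspace.
pose B i j u v := inner Omega (wd Omega j (wd Omega i u)) (wd Omega j (wd Omega i v)).
apply: (semi_inner_sum (B := fun i u v => \sum_j B i j u v) sH2) => i.
apply: (semi_inner_sum (B := B i) sH2) => j.
exact: (semi_inner_pull sH2 sip (wd2_weakly_linear i j)).
Qed.

Lemma semi2E u : H2 u -> semi2 Omega u = fnorm form2 u.
Proof.
move=> Hu; congr Num.sqrt; apply: eq_bigr => i _; apply: eq_bigr => j _.
rewrite L2normE (fnorm_sqr sip) //; exact: (wd2_weakly_linear i j).1.
Qed.

Local Notation vfield := ('I_d -> 'rV[R]_d -> R).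
Definition vH1_space : set vfield := [set w : vfield | forall i, H1 (w i)].
Definition vform1 (w z : vfield) : R := \sum_i form1 Omega (w i) (z i).
Definition vform2 (w z : vfield) : R := \sum_i form2 (w i) (z i).
Lemma vH1_subspace : lsubspace vH1_space.
Proof. exact: lsubspace_family sH1. Qed.

Lemma vH10_subspace : lsubspace (vH10_space Omega).
Proof. exact: lsubspace_family (H10_subspace oO bO). Qed.

Lemma vH10_vH1 : vH10_space Omega `<=` vH1_space.
Proof. by move=> w Hw i; exact: (H10_H1 (Hw i)). Qed.

Lemma vform1_semi_inner : semi_inner vH1_space vform1.
Proof. exact: semi_inner_family (form1_semi_inner oO bO). Qed.

Lemma vform2_semi_inner : semi_inner (vH2_space Omega) vform2.
Proof. exact: semi_inner_family form2_semi_inner. Qed.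

Lemma vnorm1E (w : vfield) : vH1_space w -> vnorm1 Omega w = fnorm vform1 w.
Proof.
move=> Hw; congr Num.sqrt; apply: eq_bigr => i _.
by rewrite (norm1E oO bO) // (fnorm_sqr (form1_semi_inner oO bO)).
Qed.

Lemma vsemi2E (w : vfield) : vH2_space Omega w -> vsemi2 Omega w = fnorm vform2 w.
Proof.
move=> Hw; congr Num.sqrt; apply: eq_bigr => i _.
by rewrite semi2E // (fnorm_sqr form2_semi_inner).
Qed.

Lemma wd_family_weakly_linear i j :
  weakly_linear vH1_space L2 (inner Omega) (fun w : vfield => wd Omega i (w j)).
Proof.
have [D l] := wd_weakly_linear oO bO i.
by split=> [w Hw|a u v w Hu Hv Lw]; [exact: D|exact: l].
Qed.

Lemma strainE (w : vfield) i j : strain Omega w i j =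
  2^-1 *: wd Omega j (w i) + 2^-1 *: wd Omega i (w j).
Proof.
by apply/funext => x; rewrite /strain mulrDl [X in X + _ = _]mulrC [X in _ + X = _]mulrC.
Qed.

Lemma strain_weakly_linear i j :
  weakly_linear vH1_space L2 (inner Omega) (fun w : vfield => strain Omega w i j).
Proof.
have -> : (fun w : vfield => strain Omega w i j) =
    (fun w : vfield => 2^-1 *: wd Omega j (w i) + 2^-1 *: wd Omega i (w j)).
  by apply/funext => w; exact: strainE.
apply: weakly_linearD; [exact: vH1_subspace|exact: sf| |];
  apply: weakly_linearZ; try exact: vH1_subspace; try exact: sf;
  exact: wd_family_weakly_linear.
Qed.

Lemma divE (w : vfield) : div Omega w = \sum_i wd Omega i (w i).
Proof. by apply/funext => x; rewrite fct_sumE. Qed.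

Lemma div_weakly_linear : weakly_linear vH1_space L2 (inner Omega) (div Omega).
Proof.
have -> : div Omega = fun w : vfield => \sum_i wd Omega i (w i).
  by apply/funext => w; exact: divE.
apply: weakly_linear_sum; [exact: vH1_subspace|exact: sf|move=> i].
exact: wd_family_weakly_linear.
Qed.

Lemma div_L2 (w : vfield) : vH1_space w -> L2 (div Omega w).
Proof. exact: div_weakly_linear.1. Qed.

End second_order.

(** * The elasticity and Darcy forms *)

Section elasticity_and_darcy.
Context {R : realType} {d : nat} (Omega : set 'rV[R]_d).
Hypotheses (oO : open Omega) (bO : bounded_set Omega).
Local Notation leb := (lebesgue_rV d).
Local Notation mO := (domain_measurable oO).
Local Notation L2 := (L2_space Omega).
Local Notation H1 := (H1_space Omega).
Local Notation vH1 := (vH1_space Omega).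
Local Notation sL2 := (L2_subspace oO bO).
Local Notation sip := (inner_semi_inner oO bO).
Local Notation sf := (inner_semi_inner oO bO).1.
Local Notation sH1 := (H1_subspace oO bO).
Local Notation vfield := ('I_d -> 'rV[R]_d -> R).
Implicit Types (u v w : vfield) (p q : 'rV[R]_d -> R).

Lemma Rintegral_sum_L2 (I : Type) (r : seq I) (F G : I -> 'rV[R]_d -> R) :
  (forall i, L2 (F i)) -> (forall i, L2 (G i)) ->
  \int[leb]_(x in Omega) (\sum_(i <- r) F i x * G i x) =
  \sum_(i <- r) inner Omega (F i) (G i) /\
  leb.-integrable Omega (EFin \o (fun x => \sum_(i <- r) F i x * G i x)).
Proof.
move=> LF LG; elim: r => [|i r [ihE ihI]].
  rewrite big_nil (_ : (fun x => _) = cst 0); last first.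
    by apply/funext => x; rewrite big_nil.
  by split; [rewrite Rintegral_cst ?mul0r //; exact: mO|exact: integrable0].
rewrite big_cons (_ : (fun x => _) =
  (fun x => F i x * G i x + \sum_(j <- r) F j x * G j x)); last first.
  by apply/funext => x; rewrite big_cons.
have iFG := L2_mulr_integrable oO (LF i) (LG i).
split; first by rewrite RintegralD ?ihE //; exact: mO.
by have := integrableD mO iFG ihI; apply: eq_integrable; [exact: mO|move=> x _].
Qed.

Section elasticity.
Variables (lambda mu : R).
Hypotheses (mu0 : 0 < mu) (lm0 : 0 < d%:R * lambda + 2 * mu) (d0 : (0 < d)%N).

Definition strain_form u v : R :=
  \sum_i \sum_j inner Omega (strain Omega u i j) (strain Omega v i j).
Definition div_form u v : R := inner Omega (div Omega u) (div Omega v).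

Lemma strain_form_semi_inner : semi_inner vH1 strain_form.
Proof.
have sV := vH1_subspace oO bO.
pose B i j u v := inner Omega (strain Omega u i j) (strain Omega v i j).
apply: (semi_inner_sum (B := fun i u v => \sum_j B i j u v) sV) => i.
apply: (semi_inner_sum (B := B i) sV) => j.
exact: (semi_inner_pull sV sip (strain_weakly_linear oO bO i j)).
Qed.

Lemma div_form_semi_inner : semi_inner vH1 div_form.
Proof.
exact: (semi_inner_pull (vH1_subspace oO bO) sip (div_weakly_linear oO bO)).
Qed.

Local Notation form_a := (form_a Omega lambda mu).
Local Notation norm_a := (norm_a Omega lambda mu).

Lemma form_aE u v : vH1 u -> vH1 v ->
  form_a u v = 2 * mu * strain_form u v + lambda * div_form u v.
Proof.
move=> Hu Hv; congr (_ * _ + _).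
have LS w i j : vH1 w -> L2 (strain Omega w i j).
  by move=> Hw; exact: ((strain_weakly_linear oO bO i j).1 _ Hw).
rewrite /strain_form pair_big /=.
have [<- _] := Rintegral_sum_L2 (index_enum _)
  (F := fun ij => strain Omega u ij.1 ij.2) (G := fun ij => strain Omega v ij.1 ij.2)
  (fun ij => LS _ _ _ Hu) (fun ij => LS _ _ _ Hv).
by apply: eq_Rintegral => x _; rewrite pair_big.
Qed.

Lemma div_form_le_strain u : vH1 u -> div_form u u <= d%:R * strain_form u u.
Proof.
move=> Hu; pose F i := wd Omega i (u i).
have LF i : L2 (F i) by exact: (wd_L2 _ (Hu i)).
rewrite /div_form -(fnorm_sqr sip) ?divE; last exact: (sub_sum sL2).
apply: le_trans (fnorm_sum_sqr sip LF) _; rewrite ler_wpM2l //.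
apply: ler_sum => i _; rewrite (fnorm_sqr sip) // (bigD1 i) //=.
have -> : strain Omega u i i = F i.
  apply/funext => x; rewrite /strain /F -mulr2n -[_ *+ 2]mulr_natr mulfK //.
rewrite lerDl sumr_ge0 // => j _; apply: sip.2.
exact: ((strain_weakly_linear oO bO i j).1 _ Hu).
Qed.

Lemma form_a_symform : symform vH1 form_a.
Proof.
have s1 := symformZ_form (2 * mu) strain_form_semi_inner.1.
have s2 := symformZ_form lambda div_form_semi_inner.1.
have [sV l c] := symformD_form s1 s2; split; first exact: sV.
  move=> a u v w Hu Hv Hw; have Huv := sV.2 a _ _ Hu Hv.
  rewrite (form_aE Huv Hw) (form_aE Hu Hw) (form_aE Hv Hw); exact: l.
by move=> u v Hu Hv; rewrite (form_aE Hu Hv) (form_aE Hv Hu); exact: c.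
Qed.

(** The divergence is the trace of the strain, so |div u|^2 <= d |strain u|^2. Under
    the condition d lambda + 2 mu > 0 the constant on the left is positive, and the
    elastic energy controls the divergence even if lambda < 0. *)
Lemma div_form_le_form_a u : vH1 u ->
  (2 * mu / d%:R + lambda) * div_form u u <= form_a u u.
Proof.
move=> Hu; rewrite form_aE // mulrDl lerD2r.
have dR : (0 : R) < d%:R by rewrite ltr0n.
rewrite mulrAC ler_pdivrMr // -[leRHS]mulrA; apply: ler_wpM2l.
  by rewrite mulr_ge0 // ltW.
by rewrite mulrC; exact: div_form_le_strain.
Qed.

Lemma div_constant_gt0 : 0 < 2 * mu / d%:R + lambda.
Proof.
have dR : (0 : R) < d%:R by rewrite ltr0n.
rewrite (_ : _ + _ = (d%:R * lambda + 2 * mu) / d%:R) ?divr_gt0 //.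
by field; rewrite gt_eqF.
Qed.

Lemma form_a_semi_inner : semi_inner vH1 form_a.
Proof.
split; first exact: form_a_symform.
move=> u Hu; apply: le_trans (div_form_le_form_a Hu).
by rewrite mulr_ge0 ?(ltW div_constant_gt0) // div_form_semi_inner.2.
Qed.

Lemma div_le_norm_a u : vH1 u ->
  L2norm Omega (div Omega u) <=
  Num.sqrt (2 * mu / d%:R + lambda)^-1 * norm_a u.
Proof.
move=> Hu; have k0 := div_constant_gt0.
rewrite -sqrtrM ?invr_ge0 ?(ltW k0) // ler_wsqrtr // mulrC ler_pdivlMr // mulrC.
exact: div_form_le_form_a.
Qed.

Lemma sqr_midpoint (s x y : R) : 0 <= s -> s <= 2^-1 * x + 2^-1 * y ->
  s ^+ 2 <= 2^-1 * x ^+ 2 + 2^-1 * y ^+ 2.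
Proof. by move=> s0 sxy; have := sqr_ge0 (x - y); nra. Qed.

(** The strain is the mean of the gradient and its transpose, which have the same norm. *)
Lemma strain_form_le_vform1 u : vH1 u -> strain_form u u <= vform1 Omega u u.
Proof.
move=> Hu; pose n i j := inner Omega (wd Omega j (u i)) (wd Omega j (u i)).
have LF i j : L2 (wd Omega j (u i)) by exact: (wd_L2 _ (Hu i)).
apply: (@le_trans _ _ (\sum_i \sum_j n i j)); last first.
  apply: ler_sum => i _; rewrite /form1 lerDr; apply: sip.2.
  exact: H1_L2 (Hu i).
have -> : \sum_i \sum_j n i j = \sum_i \sum_j (2^-1 * n i j + 2^-1 * n j i).
  under [RHS]eq_bigr do rewrite big_split /=; rewrite big_split /=.
  rewrite [X in _ = _ + X]exchange_big /= -big_split; apply: eq_bigr => i _.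
  by rewrite -big_split; apply: eq_bigr => j _ /=; rewrite -mulrDl; field.
apply: ler_sum => i _; apply: ler_sum => j _.
have Lst := (strain_weakly_linear oO bO i j).1 _ Hu.
have La : L2 (2^-1 *: wd Omega j (u i)) by exact: (subZ sL2).
have Lb : L2 (2^-1 *: wd Omega i (u j)) by exact: (subZ sL2).
have i2 : (0 : R) <= 2^-1 by rewrite invr_ge0.
have ab : fnorm (inner Omega) (strain Omega u i j) <=
    2^-1 * fnorm (inner Omega) (wd Omega j (u i)) +
    2^-1 * fnorm (inner Omega) (wd Omega i (u j)).
  rewrite strainE; apply: le_trans (fnormD sip La Lb) _; apply: lerD.
    by rewrite (fnormZ sip _ (LF i j)) (ger0_norm i2).
  by rewrite (fnormZ sip _ (LF j i)) (ger0_norm i2).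
have ha : n i j = fnorm (inner Omega) (wd Omega j (u i)) ^+ 2.
  by rewrite (fnorm_sqr sip (LF i j)).
have hb : n j i = fnorm (inner Omega) (wd Omega i (u j)) ^+ 2.
  by rewrite (fnorm_sqr sip (LF j i)).
have hs : inner Omega (strain Omega u i j) (strain Omega u i j) =
    fnorm (inner Omega) (strain Omega u i j) ^+ 2 by rewrite (fnorm_sqr sip Lst).
rewrite ha hb hs; exact: (sqr_midpoint (fnorm_ge0 _) ab).
Qed.

Lemma form_a_le_vform1 u : vH1 u ->
  form_a u u <= (2 * mu + `|lambda| * d%:R) * vform1 Omega u u.
Proof.
move=> Hu; rewrite form_aE //.
have S0 := strain_form_semi_inner.2 _ Hu; have D0 := div_form_semi_inner.2 _ Hu.
have SV := strain_form_le_vform1 Hu; have DS := div_form_le_strain Hu.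
rewrite [leRHS]mulrDl; apply: lerD.
  by apply: ler_wpM2l => //; rewrite mulr_ge0 // ltW.
apply: (@le_trans _ _ (`|lambda| * div_form u u)).
  by rewrite ler_wpM2r // ler_norm.
by rewrite -mulrA ler_wpM2l //; apply: le_trans DS _; rewrite ler_wpM2l.
Qed.

Lemma norm_a_le_vnorm1 u : vH1 u ->
  norm_a u <= Num.sqrt (2 * mu + `|lambda| * d%:R) * vnorm1 Omega u.
Proof.
move=> Hu; rewrite (vnorm1E oO bO Hu) -sqrtrM; last first.
  by rewrite addr_ge0 // mulr_ge0 // ltW.
exact/ler_wsqrtr/form_a_le_vform1.
Qed.

End elasticity.

Section darcy.
Variable K : 'rV[R]_d -> 'M[R]_d.
Hypothesis HK : conductivity Omega K.

(** The upper bound on the quadratic form of K bounds its entries, by the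
    Cauchy-Schwarz inequality for the semi-inner product given by K x. *)
Lemma conductivity_bound : exists C : R,
  forall i j x, Omega x -> `|K x i j| <= C.
Proof.
have [_ Ksym [k [k0 Kk]]] := HK.
exists (Num.sqrt k.2 * Num.sqrt k.2) => i j x Ox.
pose B (a b : 'rV[R]_d) : R := (a *m K x *m b^T) ord0 ord0.
have sB : semi_inner setT B.
  split; first split.
  - by split.
  - by move=> s a b c _ _ _; rewrite /B !mulmxDl -!scalemxAl !mxE.
  - move=> a b _ _; rewrite /B.
    transitivity ((a *m K x *m b^T)^T ord0 ord0); first by rewrite [RHS]mxE.
    by rewrite !trmx_mul trmxK Ksym // mulmxA.
  - move=> a _; have /andP[+ _] := Kk _ Ox a; apply: le_trans.
    by rewrite mulr_ge0 ?sqr_ge0 // ltW.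
have e i' j' : B (delta_mx ord0 i') (delta_mx ord0 j') = K x i' j'.
  by rewrite /B -rowE trmx_delta -colE !mxE.
have kii i' : fnorm B (delta_mx ord0 i') <= Num.sqrt k.2.
  rewrite ler_wsqrtr // /B; have /andP[_] := Kk _ Ox (delta_mx ord0 i').
  rewrite /enorm sqr_sqrtr ?sumr_ge0 // => [|l _]; last exact: sqr_ge0.
  rewrite (bigD1 i') //= big1 ?addr0 ?mxE ?eqxx ?expr1n ?mulr1 // => l li.
  by rewrite mxE eqxx (negbTE li) expr0n.
rewrite -e; apply: le_trans (semi_inner_CS sB I I) _.
by apply: ler_pM; rewrite ?sqrtr_ge0.
Qed.

Lemma K_mul_L2 i j p : L2 p -> L2 (fun x => K x i j * p x).
Proof.
have [C KC] := conductivity_bound; have [mK _ _] := HK.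
by apply: (L2_bounded_mul oO) => // x; exact: KC.
Qed.

Lemma form_apE p q : H1 p -> H1 q -> form_ap Omega K p q =
  \sum_i \sum_j inner Omega (wd Omega j p) (fun x => K x i j * wd Omega i q x).
Proof.
move=> Hp Hq; rewrite pair_big /=.
have [<- _] := Rintegral_sum_L2 (index_enum _)
  (F := fun ij : 'I_d * 'I_d => wd Omega ij.2 p)
  (G := fun ij => fun x => K x ij.1 ij.2 * wd Omega ij.1 q x)
  (fun ij => wd_L2 _ Hp) (fun ij => K_mul_L2 _ _ (wd_L2 _ Hq)).
apply: eq_Rintegral => x _; rewrite pair_big /=; apply: eq_bigr => ij _.
by rewrite mulrCA mulrA.
Qed.

Lemma form_ap_semi_inner : semi_inner H1 (form_ap Omega K).
Proof.
have [_ Ksym [k [k0 Kk]]] := HK.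
split; first split; first exact: sH1.
- move=> a p p' q Hp Hp' Hq; rewrite !form_apE //; last exact: sH1.2.
  rewrite mulr_sumr -big_split; apply: eq_bigr => i _ /=.
  rewrite mulr_sumr -big_split; apply: eq_bigr => j _ /=.
  by apply: (wd_weakly_linear oO bO j).2 => //; apply: K_mul_L2; exact: wd_L2.
- move=> p q Hp Hq.
  rewrite (form_apE Hp Hq) (form_apE Hq Hp) [LHS]exchange_big.
  apply: eq_bigr => i _; apply: eq_bigr => j _.
  apply: eq_Rintegral => x; rewrite inE => Ox.
  have Kij : K x j i = K x i j by rewrite -[in RHS](Ksym _ Ox) mxE.
  have swap (a e b : R) : a * (e * b) = b * (e * a) by ring.
  rewrite Kij; exact: swap.
- move=> p Hp; apply: Rintegral_ge0 => x Ox.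
  pose v := \row_j wd Omega j p x; have /andP[+ _] := Kk _ Ox v.
  have -> : (v *m K x *m v^T) ord0 ord0 =
      \sum_i \sum_j K x i j * wd Omega j p x * wd Omega i p x.
    rewrite -mulmxA mxE; apply: eq_bigr => i _; rewrite !mxE mulr_sumr.
    apply: eq_bigr => j _; rewrite !mxE.
    have swap (a e b : R) : a * (e * b) = e * b * a by ring.
    exact: swap.
  move=> le; apply: le_trans le.
  by rewrite mulr_ge0 ?sqr_ge0 // ltW.
Qed.

End darcy.
End elasticity_and_darcy.

(** * The finite element spaces *)

Section discrete_spaces.
Context {R : realType} {d : nat} (Omega : set 'rV[R]_d).
Hypotheses (oO : open Omega) (bO : bounded_set Omega).
Variable Th : seq 'M[R]_(d.+1, d).

Lemma P1_subspace : lsubspace (P1_space Omega Th).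
Proof.
have [H0 Hl] := H10_subspace oO bO.
split; first split => //.
- exact: cst_continuous.
- by move=> S _; exists 0, 0 => x _; rewrite mulmx0 mxE addr0.
move=> a p q [Hp cp p0 pS] [Hq cq q0 qS]; split.
- exact: Hl.
- move=> x; apply: continuousD; last exact: cq.
  by apply: continuousM; [exact: cst_continuous|exact: cp].
- by move=> x Ox; rewrite [LHS](_ : _ = a * p x + q x) // p0 // q0 // mulr0 addr0.
- move=> S SS; have [a1 [b1 e1]] := pS S SS; have [a2 [b2 e2]] := qS S SS.
  exists (a *: a1 + a2), (a * b1 + b2) => x xS.
  rewrite [LHS](_ : _ = a * p x + q x) // e1 // e2 //.
  by rewrite mulmxDr -scalemxAr !mxE; ring.
Qed.

Lemma P1_H10 : P1_space Omega Th `<=` H10_space Omega.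
Proof. by move=> q []. Qed.

Lemma velocity_vH10 E : velocity_space Omega E Th `<=` vH10_space Omega.
Proof. by case: E => [v []//|v Pv i]; exact: P1_H10. Qed.

Lemma velocity_subspace E : lsubspace (velocity_space Omega E Th).
Proof.
have sP := P1_subspace; have sV := vH10_subspace oO bO.
case: E; last exact: lsubspace_family sP.
split.
  split; first exact: sub0 sV.
  exists 0, (fun _ _ => 0) => i; split; first exact: sub0 sP.
  by rewrite big1 ?addr0 // => S _; rewrite scale0r.
move=> a u v [Hu [wu [bu Du]]] [Hv [wv [bv Dv]]]; split; first exact: sV.2.
exists (a *: wu + wv), (fun S i => a * bu S i + bv S i) => i.
have [Pu uE] := Du i; have [Pv vE] := Dv i; split; first exact: sP.2.
rewrite [LHS](_ : _ = a *: u i + v i) // uE vE.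
rewrite [X in _ = X + _](_ : _ = a *: wu i + wv i) //.
rewrite scalerDr addrACA scaler_sumr -big_split; congr (_ + _).
by apply: eq_bigr => S _ /=; rewrite scalerDl scalerA.
Qed.

End discrete_spaces.

(** * Bochner integrals of step functions *)

Section bochner_theory.
Context {R : realType} {V : lmodType R} (X : set V) (N : V -> R).
Context (B : V -> V -> R) (C : R).
Hypotheses (sB : semi_inner X B) (N_ge0 : forall u, 0 <= N u) (C0 : 0 <= C).
Hypothesis BN : forall u, X u -> fnorm B u <= C * N u.
Local Notation sX := (symform_sub sB.1).
Local Notation leb := (@lebesgue_measure R).
Implicit Types (s : @step_function R V) (g : R -> V).

Lemma step_eval_in s t : step_in X s -> X (step_eval s t).
Proof.
move=> hs; apply: (sub_sum sX) => i; apply: (subZ sX).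
by case: (hs i).
Qed.

Lemma measurable_form_step s s' : step_in X s -> step_in X s' ->
  measurable_fun setT (fun t : R => B (step_eval s t) (step_eval s' t)).
Proof.
move=> hs hs'; rewrite (_ : (fun t => _) = fun t : R => \sum_i \sum_j
    ((\1_(@step_set R V s i) t) * (\1_(@step_set R V s' j) t) *
      B (step_val i) (step_val j))); last first.
  apply/funext => t; rewrite (symform_suml sB.1); last 2 first.
  - by move=> i; apply: (subZ sX); case: (hs i).
  - exact: step_eval_in.
  apply: eq_bigr => i _; have Xi : X (step_val i) by case: (hs i).
  rewrite (symformZl sB.1) //; last exact: step_eval_in.
  rewrite (symformC sB.1) //; last exact: step_eval_in.
  rewrite (symform_suml sB.1) //; last by move=> j; apply: (subZ sX); case: (hs' j).
  rewrite mulr_sumr; apply: eq_bigr => j _; have Xj : X (step_val j) by case: (hs' j).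
  by rewrite (symformZl sB.1) // (symformC sB.1) // mulrA.
apply: measurable_sum => i; apply: measurable_sum => j.
apply: measurable_funM; last exact: measurable_cst.
by apply: measurable_funM; apply: measurable_indic; [case: (hs i)|case: (hs' j)].
Qed.

Lemma measurable_fnorm_step s s' : step_in X s -> step_in X s' ->
  measurable_fun setT (fun t : R => fnorm B (step_eval s t - step_eval s' t)).
Proof.
move=> hs hs'.
have -> : (fun t : R => fnorm B (step_eval s t - step_eval s' t)) =
    Num.sqrt \o (fun t => B (step_eval s t) (step_eval s t) -
      2 * B (step_eval s t) (step_eval s' t) + B (step_eval s' t) (step_eval s' t)).
  apply/funext => t /=; congr Num.sqrt.
  have Xs := step_eval_in t hs; have Xs' := step_eval_in t hs'.
  have XB := subB sX Xs Xs'.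
  rewrite (symformBl sB.1) // !(symformBr sB.1) // (symformC sB.1 Xs' Xs); ring.
apply: measurableT_comp; first by apply: continuous_measurable_fun; exact: sqrt_continuous.
apply: measurable_funD; last exact: measurable_form_step.
apply: measurable_funB; first exact: measurable_form_step.
by apply: measurable_funM; [exact: measurable_cst|exact: measurable_form_step].
Qed.

(** Off a null set the norm is a pointwise limit of norms of step functions, which
    are measurable since they are square roots of sums of indicator functions. *)
Lemma fnorm_ae_measurable D g (s : nat -> step_function) s' :
  measurable D -> step_approx X N D g s -> step_in X s' ->
  exists m : R -> R, [/\ forall t, 0 <= m t, measurable_fun setT m &
    {ae leb, forall t, D t -> fnorm B (g t - step_eval s' t) = m t}].
Proof.
move=> mD [hs [N0 [mN0 muN0 aeN0]]] hs'.
have mA : measurable (D `\` N0) by exact: measurableD.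
pose m t := fnorm B (g t - step_eval s' t) * \1_(D `\` N0) t.
exists m; split.
- by move=> t; rewrite mulr_ge0 ?fnorm_ge0.
- apply: (@measurable_fun_cvg _ _ _ setT
    (fun k t => fnorm B (step_eval (s k) t - step_eval s' t) * \1_(D `\` N0) t)).
    move=> k; apply: measurable_funM; last exact: measurable_indic.
    exact: measurable_fnorm_step.
  move=> t _; rewrite /m indicE; case: (boolP (t \in _)) => [|_]; last first.
    by rewrite mulr0; under eq_fun do rewrite mulr0; exact: cvg_cst.
  rewrite inE => -[Dt N0t]; rewrite mulr1; under eq_fun do rewrite mulr1.
  have [Xgt gc] : X (g t) /\ N (g t - step_eval (s k) t) @[k --> \oo] --> 0.
    by apply: contrapT => c; apply: N0t; apply: aeN0 => /(_ Dt).
  have Xs k : X (step_eval (s k) t) by exact: step_eval_in.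
  have Xs' : X (step_eval s' t) by exact: step_eval_in.
  apply/cvgrPdist_le => e e0.
  have Cc : C * N (g t - step_eval (s k) t) @[k --> \oo] --> C * 0.
    by apply: cvgMl_tmp.
  rewrite mulr0 in Cc; move/cvgrPdist_le : Cc => /(_ e e0).
  apply: filterS => k; rewrite sub0r normrN ger0_norm ?mulr_ge0 // => le_e.
  apply: le_trans le_e; apply: le_trans (BN (subB sX Xgt (Xs k))).
  have -> : g t - step_eval (s k) t =
      (g t - step_eval s' t) - (step_eval (s k) t - step_eval s' t).
    by rewrite opprB addrA subrK.
  exact: (fnorm_dist sB (subB sX Xgt Xs') (subB sX (Xs k) Xs')).
- exists N0; split => // t /= c; apply: contrapT => N0t; apply: c => Dt.
  by rewrite /m indicE mem_set // mulr1.
Qed.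

Lemma const_step z : X z -> exists s' : @step_function R V,
  step_in X s' /\ forall t, step_eval s' t = z.
Proof.
move=> Xz; exists (@StepFunction R V 1 (fun _ => setT) (fun _ => z)); split.
  by move=> i; split => //; exact: measurableT.
by move=> t; rewrite /step_eval big_ord1 indicE in_setT scale1r.
Qed.

Section interval.
Variables (a b : R).
Hypothesis ab : a <= b.
Local Notation D := (`[a, b]%classic : set R).

Let mD : measurable (D : set (measurableTypeR R)). Proof. exact: measurable_itv. Qed.

Lemma lebesgue_segment : leb D = (b - a)%:E.
Proof.
rewrite lebesgue_measure_itv /= lte_fin; case: ltP => // ba.
by have -> : a = b; [apply/eqP; rewrite eq_le ab ba|rewrite subrr].
Qed.

Lemma segment_lty : (leb D < +oo)%E.
Proof. by rewrite lebesgue_segment ltry. Qed.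

Lemma lfin_bounded (f : R -> R) (M : R) : (forall t, 0 <= f t) ->
  (forall t, D t -> f t <= M) -> lfin leb D f.
Proof.
move=> f0 fM; apply: (@le_lt_trans _ _ (\int[leb]_(t in D) (`|M|)%:E))%E.
  apply: le_lint => //; apply/aeW => t Dt; split => //.
  by apply: le_trans (fM t Dt) _; exact: ler_norm.
rewrite (_ : (fun _ => _) = cst (`|M|)%:E) // integral_cst //.
by rewrite lte_mul_pinfty ?lee_fin // segment_lty.
Qed.

Lemma integrable_bounded (f : R -> R) (M : R) : measurable_fun setT f ->
  (forall t, `|f t| <= M) -> leb.-integrable D (EFin \o f).
Proof.
move=> mf fM; apply/integrableP; split.
  by apply/measurable_EFinP; exact: measurable_funS mf.
by apply: (@lfin_bounded (fun t => `|f t|) M).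
Qed.

Lemma Rint_segment_cst (c : R) : \int[leb]_(t in D) cst c t = (b - a) * c.
Proof.
rewrite Rintegral_cst // mulrC; congr (_ * _).
exact: (congr1 fine lebesgue_segment).
Qed.

Lemma Rint_le_cst (f : R -> R) (M : R) : (forall t, 0 <= f t) -> 0 <= M ->
  (forall t, D t -> f t <= M) -> \int[leb]_(t in D) f t <= (b - a) * M.
Proof.
move=> f0 M0 fM.
apply: (@le_trans _ _ (\int[leb]_(t in D) cst M t)).
  apply: le_Rint => //; first by apply/aeW => t Dt; split => //; exact: fM.
  by apply: (@lfin_bounded _ M).
by rewrite Rint_segment_cst.
Qed.

(** Let w be the integral of s - z. Pairing with w exchanges the form and the integral,
    so B w w is the integral of B (s t - z) w, which is at most fnorm B w times the
    integral of fnorm B (s t - z). The steps may overlap. *)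
Lemma fnorm_step_integral s z : step_in X s -> X z ->
  fnorm B (step_integral D s - (b - a) *: z) <=
  \int[leb]_(t in D) fnorm B (step_eval s t - z).
Proof.
move=> hs Xz; set w := _ - _.
have XI : X (step_integral D s).
  by apply: (sub_sum sX) => i; apply: (subZ sX); case: (hs i).
have Xw : X w by apply: (subB sX) => //; exact: (subZ sX).
have Xs t : X (step_eval s t) by exact: step_eval_in.
have [s' [hs' s'E]] := const_step Xz.
have Xv (i : 'I_(step_size s)) : X (step_val i) by case: (hs i).
have mA (i : 'I_(step_size s)) : measurable (@step_set R V s i) by case: (hs i).
have bound : exists M, 0 <= M /\ forall t, fnorm B (step_eval s t - z) <= M.
  exists (\sum_i fnorm B (@step_val R V s i) + fnorm B z); split.
    by rewrite addr_ge0 ?fnorm_ge0 ?sumr_ge0 // => i _; exact: fnorm_ge0.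
  move=> t; apply: le_trans (fnormB sB (Xs t) Xz) _; rewrite lerD2r.
  apply: le_trans (fnorm_sum sB _ _) _; first by move=> i; exact: (subZ sX).
  apply: ler_sum => i _; rewrite (fnormZ sB) // ler_piMl ?fnorm_ge0 //.
  by rewrite indicE; case: (_ \in _); rewrite ?normr1 ?normr0.
have [M [M0 boundM]] := bound.
have mf : measurable_fun setT (fun t => fnorm B (step_eval s t - z)).
  by have := measurable_fnorm_step hs hs'; under eq_fun do rewrite s'E.
have if_ : leb.-integrable D (EFin \o (fun t => fnorm B (step_eval s t - z))).
  by apply: (@integrable_bounded _ M) => // t; rewrite ger0_norm ?fnorm_ge0.
have ind1 (A : set R) t : `|\1_A t| <= 1 :> R.
  by rewrite indicE; case: (_ \in _); rewrite ?normr1 ?normr0.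
have ii (A : set R) c : measurable A ->
    leb.-integrable D (EFin \o (fun t => \1_A t * c)) /\
    \int[leb]_(t in D) (\1_A t * c) = fine (leb (A `&` D)) * c.
  move=> mA'; have i1 : leb.-integrable D (EFin \o (\1_A : R -> R)).
    by apply: (@integrable_bounded _ 1) => //; exact: measurable_indic.
  split.
    apply: (@integrable_bounded _ `|c|).
      by apply: measurable_funM; [exact: measurable_indic|exact: measurable_cst].
    by move=> t; rewrite normrM ler_piMl.
  rewrite RintegralZr //; congr (_ * _); rewrite /Rintegral; congr fine.
  exact: integral_indic.
have isum (r : seq 'I_(step_size s)) :
    leb.-integrable D (EFin \o (fun t =>
      \sum_(i <- r) \1_(@step_set R V s i) t * B (step_val i) w)) /\
    \int[leb]_(t in D) (\sum_(i <- r) \1_(@step_set R V s i) t * B (step_val i) w) =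
    \sum_(i <- r) fine (leb (@step_set R V s i `&` D)) * B (step_val i) w.
  elim: r => [|i r [ih1 ih2]].
    rewrite big_nil (_ : (fun t => _) = cst 0); last first.
      by apply/funext => t; rewrite big_nil.
    by split; [exact: integrable0|rewrite Rintegral_cst // mul0r].
  rewrite big_cons (_ : (fun t => _) = (fun t => \1_(@step_set R V s i) t * B (step_val i) w +
    \sum_(j <- r) \1_(@step_set R V s j) t * B (step_val j) w)); last first.
    by apply/funext => t; rewrite big_cons.
  have [i1 i2] := ii _ (B (step_val i) w) (mA i); split.
    by have := integrableD mD i1 ih1; apply: eq_integrable.
  by rewrite RintegralD // ih2 i2.
have [iS SE] := isum (index_enum _).
have iz : leb.-integrable D (EFin \o (cst (B z w))).
  by apply: (@integrable_bounded _ `|B z w|) => //; exact: measurable_cst.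
have FE t : B (step_eval s t - z) w =
    (\sum_i \1_(@step_set R V s i) t * B (step_val i) w) - B z w.
  rewrite (symformBl sB.1 (Xs t) Xz Xw) (symform_suml sB.1) //.
    by congr (_ - _); apply: eq_bigr => i _; rewrite (symformZl sB.1).
  by move=> i; exact: (subZ sX).
have iF : leb.-integrable D (EFin \o (fun t => B (step_eval s t - z) w)).
  by have := integrableB mD iS iz; apply: eq_integrable => // t _ /=; rewrite FE.
have BE : B w w = \int[leb]_(t in D) B (step_eval s t - z) w.
  under eq_Rintegral => t _ do rewrite FE.
  rewrite RintegralB // SE Rint_segment_cst.
  rewrite [in LHS]/w (symformBl sB.1) // ?(symformZl sB.1) //; last exact: (subZ sX).
  rewrite (symform_suml sB.1) //; last by move=> i; exact: (subZ sX).
  congr (_ - _).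
  by apply: eq_bigr => i _; rewrite (symformZl sB.1).
have le : fnorm B w ^+ 2 <= (\int[leb]_(t in D) fnorm B (step_eval s t - z)) * fnorm B w.
  rewrite (fnorm_sqr sB) // BE -RintegralZr //; apply: le_Rintegral => //.
    by have := integrableZr mD (fnorm B w) if_; apply: eq_integrable.
  move=> t _; apply: le_trans (ler_norm _) _.
  by apply: (semi_inner_CS sB) => //; exact: (subB sX).
have [w0|w0] := eqVneq (fnorm B w) 0.
  by rewrite w0; apply: Rint_ge0 => t; exact: fnorm_ge0.
by move: le; rewrite expr2 ler_pM2r // lt_neqAle eq_sym w0 fnorm_ge0.
Qed.

End interval.
End bochner_theory.

(** * Increments and Taylor remainders of curves *)

Section bochner_bounds.
Context {R : realType} {V : lmodType R} (X : set V) (N : V -> R).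
Context (B : V -> V -> R) (C : R).
Hypotheses (sB : semi_inner X B) (N_ge0 : forall u, 0 <= N u) (C0 : 0 <= C).
Hypothesis BN : forall u, X u -> fnorm B u <= C * N u.
Local Notation sX := (symform_sub sB.1).
Local Notation leb := (@lebesgue_measure R).
Implicit Types (g : R -> V).

Lemma bochner_integral_ae_in D g y : bochner_integral X N D g y ->
  {ae leb, forall t, D t -> X (g t)}.
Proof.
move=> [_ [s [[_ gs] _ _]]]; apply: ae_mono gs => t gt Dt.
by have [] := gt Dt.
Qed.

Lemma ereal_small (u : nat -> \bar R) (v : nat -> R) (e : R) : 0 < e ->
  (forall k, 0 <= u k)%E -> (forall k, 0 <= v k) ->
  u k @[k --> \oo] --> 0%E -> v k @[k --> \oo] --> 0 ->
  exists k, (u k <= e%:E)%E /\ v k <= e.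
Proof.
move=> e0 u0 v0 /fine_cvgP[ufin uc] vc.
move/cvgrPdist_le : uc => /(_ e e0) ue; move/cvgrPdist_le : vc => /(_ e e0) ve.
have [k _ H] : \forall k \near \oo, [/\ u k \is a fin_num, `|0 - fine (u k)| <= e &
    `|0 - v k| <= e] by apply: filterS3 ufin ue ve => k *; split.
have [ufk uek vek] := H k (leqnn k); exists k; split.
  rewrite -(fineK ufk) lee_fin; move: uek.
  by rewrite sub0r normrN ger0_norm // fine_ge0.
by move: vek; rewrite sub0r normrN ger0_norm.
Qed.

(** Passing to the limit in [fnorm_step_integral] along an approximating sequence of
    step functions; [z] is a constant that will be 0 or a value of the derivative. *)
Lemma fnorm_bochner_le (a b : R) g y z : a <= b ->
  bochner_integral X N `[a, b] g y -> X z ->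
  lfin leb `[a, b] (fun t => fnorm B (g t - z)) ->
  fnorm B (y - (b - a) *: z) <= \int[leb]_(t in `[a, b]) fnorm B (g t - z).
Proof.
move=> ab [Xy [s [sg cI cy]]] Xz fz.
have mD : measurable (`[a, b]%classic : set (measurableTypeR R)) by exact: measurable_itv.
have f0 (h : R -> V) t : 0 <= fnorm B (h t) by exact: fnorm_ge0.
apply/ler_addgt0Pr => e e0.
(* an error of this size enters twice, each time multiplied by C *)
have e'0 : 0 < e / (2 * C + 1) by rewrite divr_gt0 // ltr_wpDl // mulr_ge0.
have [|k [le1 le2]] := ereal_small e'0 _ (fun k => N_ge0 _) cI cy.
  by move=> k; apply: lint_ge0 => t; exact: N_ge0.
have [hs gs] := sg; have hsk := hs k.
have [z' [hz' z'E]] := const_step Xz.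
have XI : X (step_integral `[a, b] (s k)).
  by apply: (sub_sum sX) => i; apply: (subZ sX); case: (hsk i).
have Xbz : X ((b - a) *: z) by exact: (subZ sX).
have Nfin : lfin leb `[a, b] (fun t => N (g t - step_eval (s k) t)).
  by apply: le_lt_trans le1 _; rewrite ltry.
have [fgs gsN] : lfin leb `[a, b] (fun t => fnorm B (g t - step_eval (s k) t)) /\
    \int[leb]_(t in `[a, b]) fnorm B (g t - step_eval (s k) t) <=
    C * \int[leb]_(t in `[a, b]) N (g t - step_eval (s k) t).
  apply: le_RintZ => //; first by move=> t; exact: fnorm_ge0.
  apply: ae_mono gs => t gt Dt; split => //; apply: BN.
  by apply: (subB sX); [case: (gt Dt)|exact: (step_eval_in sB)].
have le1' : \int[leb]_(t in `[a, b]) N (g t - step_eval (s k) t) <= e / (2 * C + 1).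
  by rewrite -lee_fin RintegralE.
have [m1 [m10 mm1 ae1]] := fnorm_ae_measurable sB N_ge0 C0 BN mD sg hsk.
have [m2 [m20 mm2 ae2]] := fnorm_ae_measurable sB N_ge0 C0 BN mD sg hz'.
have step_le : \int[leb]_(t in `[a, b]) fnorm B (step_eval (s k) t - z) <=
    \int[leb]_(t in `[a, b]) fnorm B (g t - step_eval (s k) t) +
    \int[leb]_(t in `[a, b]) fnorm B (g t - z).
  have key : (\int[leb]_(t in `[a, b]) (fnorm B (step_eval (s k) t - z))%:E <=
    \int[leb]_(t in `[a, b]) (fnorm B (g t - step_eval (s k) t))%:E +
    \int[leb]_(t in `[a, b]) (fnorm B (g t - z))%:E)%E.
    apply: (lint_subadd mD _ _ _ m10 m20) => //; try by move=> t; exact: fnorm_ge0.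
    - exact: (measurable_funS measurableT (@subsetT _ _) mm1).
    - exact: (measurable_funS measurableT (@subsetT _ _) mm2).
    - by apply: ae_mono ae2 => t h Dt; rewrite -h // z'E.
    - apply: ae_mono gs => t gt Dt; have [Xg _] := gt Dt.
      have Xs := step_eval_in sB t hsk.
      rewrite (fnormC sB Xg Xs).
      have -> : step_eval (s k) t - z = (step_eval (s k) t - g t) + (g t - z).
        by rewrite addrA subrK.
      by apply: (fnormD sB); exact: (subB sX).
  rewrite -lee_fin EFinD !RintegralE //; try by move=> t; exact: fnorm_ge0.
  apply: le_lt_trans key _; rewrite lte_add_pinfty //.
have -> : y - (b - a) *: z = (y - step_integral `[a, b] (s k)) +
    (step_integral `[a, b] (s k) - (b - a) *: z) by rewrite addrA subrK.
have XyI := subB sX Xy XI.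
apply: le_trans (fnormD sB XyI (subB sX XI Xbz)) _.
have le3 := fnorm_step_integral sB ab hsk Xz.
have le4 : fnorm B (y - step_integral `[a, b] (s k)) <= C * (e / (2 * C + 1)).
  by apply: le_trans (BN XyI) _; apply: ler_wpM2l.
have le5 : C * \int[leb]_(t in `[a, b]) N (g t - step_eval (s k) t) <=
    C * (e / (2 * C + 1)) by apply: ler_wpM2l.
have le6 : 2 * (C * (e / (2 * C + 1))) <= e.
  rewrite !mulrA ler_pdivrMr ?ltr_wpDl ?mulr_ge0 // mulrC.
  by rewrite ler_wpM2l ?(ltW e0) // lerDl.
apply: le_trans (lerD le4 (le_trans le3 (le_trans step_le (lerD (le_trans gsN le5) (lexx _))))) _.
by rewrite addrA addrC lerD2l; apply: le_trans le6; rewrite [leRHS]mulr_natl mulr2n.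
Qed.

Section derivatives.
Variables (T : R) (g g' : R -> V).
Hypothesis dg : time_derivative X N T g g'.

Lemma fnorm_increment (a b : R) : 0 <= a -> a <= b -> b <= T ->
  lfin leb `[a, b] (fun t => fnorm B (g' t)) ->
  fnorm B (g b - g a) <= \int[leb]_(t in `[a, b]) fnorm B (g' t).
Proof.
move=> a0 ab bT fin.
have E (f : R -> V) : (fun t => fnorm B (f t - 0)) = (fun t => fnorm B (f t)).
  by apply/funext => t; rewrite subr0.
have := fnorm_bochner_le ab (dg a0 ab bT) (sub0 sX).
by rewrite scaler0 subr0 E; apply.
Qed.

(** The derivative lies in [X] almost everywhere, hence at some time s <= t, and the
    increment from s to t lies in [X] because [g'] is itself differentiable. *)
Lemma derivative_in (g'' : R -> V) t : time_derivative X N T g' g'' ->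
  0 < t <= T -> X (g' t).
Proof.
move=> dg' /andP[t0 tT].
have := bochner_integral_ae_in (dg (lexx 0) (ltW t0) tT).
move=> [N0 [mN0 muN0 h]].
have [s [st N0s]] : exists s, `[0, t]%classic s /\ ~ N0 s.
  apply: contrapT => /forallNP H.
  pose D : set (measurableTypeR R) := `[0, t]%classic.
  have sub : D `<=` N0.
    by move=> s st; apply: contrapT => N0s; apply: (H s).
  have : (leb D <= leb N0)%E.
    by apply: le_measure; rewrite ?inE //; exact: measurable_itv.
  rewrite /D muN0 lebesgue_measure_itv /= lte_fin t0 lee_fin subr0.
  by rewrite leNgt t0.
have Xs : X (g' s) by apply: contrapT => Xs; apply: N0s; apply: h => /(_ st).
move: st; rewrite /= in_itv /= => /andP[s0 st].
have [Xd _] := dg' s t s0 st tT.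
by rewrite -(subrK (g' s) (g' t)); exact: (subD sX).
Qed.

(** The remainder is the integral of [g' t - g' b], and this increment is at most the
    integral of the second derivative. *)
Lemma fnorm_taylor (g'' : R -> V) (a b : R) : time_derivative X N T g' g'' ->
  0 <= a -> a < b -> b <= T -> lfin leb `[a, b] (fun t => fnorm B (g'' t)) ->
  fnorm B (g b - g a - (b - a) *: g' b) <=
  (b - a) * \int[leb]_(t in `[a, b]) fnorm B (g'' t).
Proof.
move=> dg' a0 ab bT fin.
have Xb : X (g' b) by apply: derivative_in dg' _; rewrite bT (le_lt_trans a0 ab).
set A := \int[leb]_(t in _) _.
have A0 : 0 <= A by apply: Rint_ge0 => t; exact: fnorm_ge0.
have f0 (h : R -> V) t : 0 <= fnorm B (h t) by exact: fnorm_ge0.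
have le t : `[a, b]%classic t -> fnorm B (g' t - g' b) <= A.
  rewrite /= in_itv /= => /andP[at_ tb].
  have t0 := le_trans a0 at_; have [Xd _] := dg' t b t0 tb bT.
  have sub s : `[t, b]%classic s -> `[a, b]%classic s.
    by rewrite /= !in_itv /= => /andP[ts ->]; rewrite (le_trans at_ ts).
  have fin' : lfin leb `[t, b] (fun s => fnorm B (g'' s)).
    by apply: le_lfin fin => //; apply/aeW => s /sub.
  have -> : fnorm B (g' t - g' b) = fnorm B (g' b - g' t).
    have -> : g' t - g' b = -1 *: (g' b - g' t) by rewrite scaleN1r opprB.
    by rewrite (fnormZ sB _ Xd) normrN1 mul1r.
  apply: (@le_trans _ _ (\int[leb]_(s in `[t, b]) fnorm B (g'' s))).
    have E : (fun s => fnorm B (g'' s - 0)) = (fun s => fnorm B (g'' s)).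
      by apply/funext => s; rewrite subr0.
    have := fnorm_bochner_le tb (dg' t b t0 tb bT) (sub0 sX).
    by rewrite scaler0 subr0 E; apply.
  by apply: le_Rint => //; apply/aeW => s /sub.
have fin2 : lfin leb `[a, b] (fun t => fnorm B (g' t - g' b)).
  by apply: (lfin_bounded (ltW ab) _ le) => t; exact: fnorm_ge0.
apply: le_trans (fnorm_bochner_le (ltW ab) (dg a0 (ltW ab) bT) Xb fin2) _.
by apply: Rint_le_cst => //; [exact: ltW|move=> t; exact: fnorm_ge0].
Qed.

End derivatives.
End bochner_bounds.

(** * Energy inequalities for one time step *)

Section energy_steps.
Context {R : realType}.
Implicit Types (x y z C al be tau : R).

(** In this section x stands for the norm of the velocity error defined by the
    elasticity form, y for the gradient norm of the pressure error times
    eps^(1/2) h, z for its Darcy norm, and al, be for the norms of the two defects.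
    The Cauchy-Schwarz inequality for the pairs (x, y) lets one divide by the new
    energy norm. *)
Lemma energy_step tau C al be x0 y0 z0 x1 y1 z1 :
  0 < tau -> 1 <= C -> 0 <= al -> 0 <= be ->
  0 <= x0 -> 0 <= y0 -> 0 <= z0 -> 0 <= x1 -> 0 <= y1 -> 0 <= z1 ->
  x1 ^+ 2 + tau * z1 ^+ 2 + y1 ^+ 2 <=
    x1 * x0 + y1 * y0 + C * al * x1 + (C * al + be) * y1 ->
  Num.sqrt (x1 ^+ 2 + tau * z1 ^+ 2 + y1 ^+ 2) <=
    Num.sqrt (x0 ^+ 2 + tau * z0 ^+ 2 + y0 ^+ 2) + 2 * C * (al + be).
Proof.
move=> t0 C1 al0 be0 x00 y00 z00 x10 y10 z10 le.
have C0 : 0 <= C by lra.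
have tz0 : 0 <= tau * z0 ^+ 2 by rewrite mulr_ge0 ?sqr_ge0 // ltW.
have tz1 : 0 <= tau * z1 ^+ 2 by rewrite mulr_ge0 ?sqr_ge0 // ltW.
have s0 : 0 <= x0 ^+ 2 + tau * z0 ^+ 2 + y0 ^+ 2 by rewrite !addr_ge0 ?sqr_ge0.
have s1 : 0 <= x1 ^+ 2 + tau * z1 ^+ 2 + y1 ^+ 2 by rewrite !addr_ge0 ?sqr_ge0.
set N1 := Num.sqrt _; set N0 := Num.sqrt _.
have N1E : N1 ^+ 2 = x1 ^+ 2 + tau * z1 ^+ 2 + y1 ^+ 2 by rewrite sqr_sqrtr.
have N0E : N0 ^+ 2 = x0 ^+ 2 + tau * z0 ^+ 2 + y0 ^+ 2 by rewrite sqr_sqrtr.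
have N10 : 0 <= N1 by exact: sqrtr_ge0.
have N00 : 0 <= N0 by exact: sqrtr_ge0.
have xN : x1 <= N1 by rewrite -(@ler_pXn2r _ 2) ?nnegrE // N1E; have := sqr_ge0 y1; lra.
have yN : y1 <= N1 by rewrite -(@ler_pXn2r _ 2) ?nnegrE // N1E; have := sqr_ge0 x1; lra.
have cs : x1 * x0 + y1 * y0 <= N1 * N0.
  rewrite -(@ler_pXn2r _ 2) ?nnegrE ?addr_ge0 ?mulr_ge0 // exprMn N1E N0E.
  apply: (@le_trans _ _ ((x1 ^+ 2 + y1 ^+ 2) * (x0 ^+ 2 + y0 ^+ 2))).
    rewrite -subr_ge0 (_ : _ - _ = (x1 * y0 - y1 * x0) ^+ 2) ?sqr_ge0 //; ring.
  by apply: ler_pM; rewrite ?addr_ge0 ?sqr_ge0 //; lra.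
have Cal : 0 <= C * al by rewrite mulr_ge0.
have l1 : C * al * x1 <= C * al * N1 by apply: ler_wpM2l.
have l2 : (C * al + be) * y1 <= (C * al + be) * N1.
  by apply: ler_wpM2l => //; rewrite addr_ge0.
have lbe : be <= 2 * C * be by rewrite -[leLHS]mul1r; apply: ler_wpM2r => //; lra.
have : N1 * N1 <= N1 * (N0 + 2 * C * (al + be)).
  rewrite -expr2 N1E; apply: le_trans le _.
  have : be * N1 <= 2 * C * be * N1 by apply: ler_wpM2r.
  by move: cs l1 l2; lra.
have [N1_0|N1_n0] := eqVneq N1 0.
  by rewrite N1_0 addr_ge0 // !mulr_ge0 // addr_ge0.
by rewrite ler_pM2l // lt_neqAle eq_sym N1_n0.
Qed.

Lemma absorb C al be x y : 1 <= C -> 0 <= al -> 0 <= be ->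
  C * al * x + (C * al + be) * y - (x ^+ 2 + y ^+ 2) / 2 <= C ^+ 2 * (al + be) ^+ 2.
Proof.
move=> C1 al0 be0; set A := C * al; set D := C * (al + be).
have A0 : 0 <= A by rewrite mulr_ge0 //; lra.
have AD : A <= D by rewrite ler_wpM2l //; lra.
have BD : A + be <= D.
  by rewrite /A /D mulrDr lerD2l -[leLHS]mul1r ler_wpM2r.
have -> : C ^+ 2 * (al + be) ^+ 2 = D ^+ 2 by rewrite /D exprMn.
have := sqr_ge0 (x - A); have := sqr_ge0 (y - (A + be)).
have h1 : A ^+ 2 <= D ^+ 2 by rewrite ler_pXn2r ?nnegrE //; lra.
have h2 : (A + be) ^+ 2 <= D ^+ 2 by rewrite ler_pXn2r ?nnegrE //; lra.
by nra.
Qed.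

(** The products x1 x0 and y1 y0 are absorbed by Young's inequality, which leaves half
    of the initial energy. *)
Lemma energy_first_step tau C al be x0 y0 z0 x1 y1 z1 :
  0 < tau -> 1 <= C -> 0 <= al -> 0 <= be ->
  x1 ^+ 2 + tau * z1 ^+ 2 + y1 ^+ 2 <=
    x1 * x0 + y1 * y0 + C * al * x1 + (C * al + be) * y1 ->
  z1 ^+ 2 <= (x0 ^+ 2 + tau * z0 ^+ 2 + y0 ^+ 2) / (2 * tau) +
    C ^+ 2 * (al + be) ^+ 2 / tau.
Proof.
move=> t0 C1 al0 be0 le; have ab := absorb x1 y1 C1 al0 be0.
have tz : 0 <= tau * z0 ^+ 2 by rewrite mulr_ge0 ?sqr_ge0 // ltW.
have : tau * z1 ^+ 2 <= (x0 ^+ 2 + tau * z0 ^+ 2 + y0 ^+ 2) / 2 +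
    C ^+ 2 * (al + be) ^+ 2.
  by have := sqr_ge0 (x1 - x0); have := sqr_ge0 (y1 - y0); nra.
rewrite mulrC -ler_pdivlMr // => /le_trans; apply.
rewrite le_eqVlt; apply/orP; left; apply/eqP; field.
by rewrite gt_eqF.
Qed.

(** Here x and y belong to the increments of the errors and c is the Darcy form of the
    new and the old pressure errors, so z1^2 - c is the energy produced by testing
    with the increment; 2 c <= z1^2 + z0^2 makes it telescope. *)
Lemma energy_difference_step tau C al be x y z0 z1 c :
  0 < tau -> 1 <= C -> 0 <= al -> 0 <= be -> c <= z1 * z0 ->
  x ^+ 2 + tau * (z1 ^+ 2 - c) + y ^+ 2 <= C * al * x + (C * al + be) * y ->
  z1 ^+ 2 <= z0 ^+ 2 + 2 * (C ^+ 2 * (al + be) ^+ 2 / tau).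
Proof.
move=> t0 C1 al0 be0 cz le; have ab := absorb x y C1 al0 be0.
have h : tau * (z1 ^+ 2 - c) <= C ^+ 2 * (al + be) ^+ 2.
  by have := sqr_ge0 x; have := sqr_ge0 y; lra.
have h2 : z1 ^+ 2 - c <= C ^+ 2 * (al + be) ^+ 2 / tau.
  by rewrite ler_pdivlMr // mulrC.
by have := sqr_ge0 (z1 - z0); nra.
Qed.

(** * Sums over time steps *)

Lemma sum_steps (N : nat -> R) (g : nat -> R) n :
  (forall j, (j < n)%N -> N j.+1 <= N j + g j) -> N n <= N 0%N + \sum_(j < n) g j.
Proof.
elim: n => [|n ih] le; first by rewrite big_ord0 addr0.
rewrite big_ord_recr /= addrA; apply: le_trans (le n (leqnn _)) _.
by rewrite lerD2r; apply: ih => j jn; apply: le; exact: ltnW.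
Qed.

Lemma sqrt_le_of_sqr (x y : R) : 0 <= y -> x <= y ^+ 2 -> Num.sqrt x <= y.
Proof. by move=> y0 xy; rewrite -[y]ger0_norm // -sqrtr_sqr ler_wsqrtr. Qed.

Section time_steps.
Variable tau : R.
Hypothesis tau0 : 0 < tau.
Local Notation leb := (@lebesgue_measure R).
Local Notation cell j := (`[j%:R * tau, j.+1%:R * tau]%classic).
Local Notation upto n := (`[0, n%:R * tau]%classic).

Lemma cell_sub j n : (j < n)%N -> cell j `<=` upto n.
Proof.
move=> jn t; rewrite /= !in_itv /= => /andP[t0 t1]; apply/andP; split.
  by apply: le_trans t0; rewrite mulr_ge0 // ltW.
by apply: le_trans t1 _; rewrite ler_pM2r // ler_nat.
Qed.

Lemma lfin_cell (f : R -> R) j n : (forall t, 0 <= f t) -> (j < n)%N ->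
  lfin leb (upto n) f -> lfin leb (cell j) f.
Proof.
move=> f0 jn; apply: le_lfin => //; apply/aeW => t /(cell_sub jn) tn.
by split.
Qed.

Lemma sum_cells (f : R -> R) n : (forall t, 0 <= f t) -> lfin leb (upto n) f ->
  \sum_(j < n) \int[leb]_(t in cell j) f t <= \int[leb]_(t in upto n) f t.
Proof.
move=> f0; elim: n => [|n ih] fin; first by rewrite big_ord0 Rint_ge0.
have sub : upto n `<=` upto n.+1.
  move=> t; rewrite /= !in_itv /= => /andP[-> t1] /=.
  by apply: le_trans t1 _; rewrite ler_pM2r // ler_nat.
have fin' : lfin leb (upto n) f.
  by apply: le_lfin fin => //; apply/aeW => t /sub.
rewrite big_ord_recr /=; apply: le_trans (lerD (ih fin') (lexx _)) _.
pose E := (`]n%:R * tau, n.+1%:R * tau]%classic : set R).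
have ES : E `<=` upto n.+1.
  move=> t; rewrite /E /= !in_itv /= => /andP[t0 ->]; rewrite andbT.
  by apply: le_trans (ltW t0); rewrite mulr_ge0 // ltW.
apply: (@le_trans _ _ (\int[leb]_(t in upto n) f t + \int[leb]_(t in E) f t)).
  rewrite lerD2l; apply: le_Rint => //.
    (* closed cells overlap in an end point; removing it changes the cell by a null set *)
    exists [set n%:R * tau]; split; first exact: measurable_set1.
      exact: lebesgue_measure_set1.
    move=> t /= c; apply: contrapT => tn; apply: c => tc; split => //.
    move: tc; rewrite /E /= !in_itv /= => /andP[t0 ->]; rewrite andbT.
    by rewrite lt_neqAle t0 andbT; apply/eqP => e; apply: tn.
  by apply: le_lfin fin => //; apply/aeW => t /ES.
apply: Rint_superadd => // t [].
by rewrite /E /= !in_itv /= => /andP[_ t1] /andP[]; rewrite ltNge t1.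
Qed.

Lemma cell_length j : leb (cell j) = tau%:E.
Proof.
rewrite lebesgue_measure_itv /= lte_fin ltr_pM2r // ltr_nat ltnSn -EFinD.
by rewrite -mulrBl -natrB // subSnn mul1r.
Qed.

(** The Cauchy-Schwarz inequality on each cell, of length tau. *)
Lemma sum_cells_sqr (f : R -> R) n : (forall t, 0 <= f t) ->
  lfin leb (upto n) f -> lfin leb (upto n) (fun t => f t ^+ 2) ->
  \sum_(j < n) (\int[leb]_(t in cell j) f t) ^+ 2 <=
  tau * \int[leb]_(t in upto n) f t ^+ 2.
Proof.
move=> f0 fin fin2; have f20 t : 0 <= f t ^+ 2 by exact: sqr_ge0.
apply: (@le_trans _ _ (\sum_(j < n) tau * \int[leb]_(t in cell j) f t ^+ 2)).
  apply: ler_sum => j _.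
  have mc : measurable (cell j : set (measurableTypeR R)) by exact: measurable_itv.
  exact: (Rint_CS mc (cell_length j) f0 (lfin_cell f0 (ltn_ord j) fin)
    (lfin_cell f20 (ltn_ord j) fin2)).
by rewrite -mulr_sumr ler_pM2l //; exact: sum_cells.
Qed.

End time_steps.
End energy_steps.

(** * Seminorms along differentiable curves *)

Section seminorms_along_curves.
Context {R : realType} {V : lmodType R} (X : set V) (N M : V -> R).
Context (B : V -> V -> R) (C : R).
Hypotheses (sB : semi_inner X B) (N_ge0 : forall u, 0 <= N u) (C0 : 0 <= C).
Hypotheses (M_ge0 : forall u, 0 <= M u) (MB : forall u, X u -> M u = fnorm B u).
Hypothesis MN : forall u, X u -> M u <= C * N u.
Local Notation sX := (symform_sub sB.1).
Local Notation leb := (@lebesgue_measure R).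
Implicit Types (g : R -> V).

Let BN u : X u -> fnorm B u <= C * N u.
Proof. by move=> Xu; rewrite -MB // MN. Qed.

Lemma time_derivative_ae_in (T : R) g g' (a b : R) : time_derivative X N T g g' ->
  0 <= a -> a <= b -> b <= T -> {ae leb, forall t, `[a, b]%classic t -> X (g' t)}.
Proof. by move=> dg a0 ab bT; exact: bochner_integral_ae_in (dg _ _ a0 ab bT). Qed.

Lemma seminorm_increment (T : R) g g' (a b : R) : time_derivative X N T g g' ->
  0 <= a -> a <= b -> b <= T -> lfin leb `[a, b] (fun t => M (g' t)) ->
  M (g b - g a) <= \int[leb]_(t in `[a, b]) M (g' t).
Proof.
move=> dg a0 ab bT fin; have ae := time_derivative_ae_in dg a0 ab bT.
have [Xgg _] := dg a b a0 ab bT; rewrite MB //.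
have aeM : {ae leb, forall t, `[a, b]%classic t ->
    `[a, b]%classic t /\ fnorm B (g' t) <= M (g' t)}.
  by apply: ae_mono ae => t Xt tD; split => //; rewrite MB //; exact: Xt.
have finB : lfin leb `[a, b] (fun t => fnorm B (g' t)).
  by apply: le_lfin fin => // t; exact: fnorm_ge0.
apply: le_trans (fnorm_increment sB N_ge0 C0 BN dg a0 ab bT finB) _.
by apply: le_Rint => // t; exact: fnorm_ge0.
Qed.

Lemma seminorm_taylor (T : R) g g' (g'' : R -> V) (a b : R) :
  time_derivative X N T g g' -> time_derivative X N T g' g'' ->
  0 <= a -> a < b -> b <= T -> lfin leb `[a, b] (fun t => M (g'' t)) ->
  M (g b - g a - (b - a) *: g' b) <= (b - a) * \int[leb]_(t in `[a, b]) M (g'' t).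
Proof.
move=> dg dg' a0 ab bT fin; have ae := time_derivative_ae_in dg' a0 (ltW ab) bT.
have [Xgg _] := dg a b a0 (ltW ab) bT.
have Xb : X (g' b) by apply: (derivative_in sB dg dg'); rewrite bT (le_lt_trans a0 ab).
rewrite MB; last by apply: (subB sX) => //; exact: (subZ sX).
have aeM : {ae leb, forall t, `[a, b]%classic t ->
    `[a, b]%classic t /\ fnorm B (g'' t) <= M (g'' t)}.
  by apply: ae_mono ae => t Xt tD; split => //; rewrite MB //; exact: Xt.
have finB : lfin leb `[a, b] (fun t => fnorm B (g'' t)).
  by apply: le_lfin fin => // t; exact: fnorm_ge0.
apply: le_trans (fnorm_taylor sB N_ge0 C0 BN dg dg' a0 ab bT finB) _.
apply: ler_wpM2l; first by rewrite subr_ge0 ltW.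
by apply: le_Rint => // t; exact: fnorm_ge0.
Qed.

Definition ae_measurable (D : set R) (f : R -> R) : Prop :=
  exists m : R -> R, [/\ forall t, 0 <= m t, measurable_fun setT m &
    {ae leb, forall t, D t -> f t = m t}].

(** What separates sums of seminorms along curves from the general nonnegative functions
    above: their integrals add up. *)
Lemma seminorm_ae_measurable (D : set (measurableTypeR R)) g (s : nat -> step_function) :
  measurable D ->
  step_approx X N D g s -> ae_measurable D (fun t => M (g t)).
Proof.
move=> mD sg; have [z' [hz' z'E]] := const_step (sub0 sX).
have [m [m0 mm ae]] := fnorm_ae_measurable sB N_ge0 C0 BN mD sg hz'.
have [_ gs] := sg; exists m; split => //.
apply: ae_mono2 ae gs => t h gt Dt; have [Xt _] := gt Dt.
by rewrite MB // -h // z'E subr0.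
Qed.

End seminorms_along_curves.

Section finiteness.
Context {R : realType}.
Local Notation leb := (@lebesgue_measure R).
Implicit Types (f g : R -> R).

Lemma ae_measurable_sqrZ (D : set R) f : ae_measurable D f ->
  ae_measurable D (fun t => 2 * f t ^+ 2).
Proof.
move=> [m [m0 mm ae]]; exists (fun t => 2 * m t ^+ 2); split.
- by move=> t; rewrite mulr_ge0 ?sqr_ge0.
- by apply: measurable_funM; [exact: measurable_cst|exact: measurable_funX].
- by apply: ae_mono ae => t h Dt; rewrite h.
Qed.

Lemma lfin_le_add (D : set (measurableTypeR R)) f g k : measurable D ->
  (forall t, 0 <= f t) -> (forall t, 0 <= g t) -> (forall t, 0 <= k t) ->
  ae_measurable D f -> ae_measurable D g ->
  lfin leb D f -> lfin leb D g -> (forall t, k t <= f t + g t) -> lfin leb D k.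
Proof.
move=> mD f0 g0 k0 [m1 [m10 mm1 ae1]] [m2 [m20 mm2 ae2]] ff fg kfg.
apply: le_lt_trans (_ : _ <= \int[leb]_(t in D) (f t)%:E + \int[leb]_(t in D) (g t)%:E)%E _.
  apply: (lint_subadd mD _ _ _ m10 m20) => //.
  - exact: (measurable_funS measurableT (@subsetT _ _) mm1).
  - exact: (measurable_funS measurableT (@subsetT _ _) mm2).
  - by apply/aeW => t Dt; exact: kfg.
by rewrite lte_add_pinfty.
Qed.

Lemma lfin_sqrZ (D : set R) f : (forall t, 0 <= f t) ->
  lfin leb D (fun t => f t ^+ 2) -> lfin leb D (fun t => 2 * f t ^+ 2).
Proof.
move=> f0 fin.
have [] := @le_RintZ _ _ _ leb D D (fun t => 2 * f t ^+ 2) (fun t => f t ^+ 2) 2 => //.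
- by move=> t; rewrite mulr_ge0 ?sqr_ge0.
- by move=> t; rewrite sqr_ge0.
- exact/aeW.
Qed.

Lemma lfin_add (D : set (measurableTypeR R)) f g : measurable D ->
  (forall t, 0 <= f t) -> (forall t, 0 <= g t) ->
  ae_measurable D f -> ae_measurable D g ->
  lfin leb D f -> lfin leb D g -> lfin leb D (fun t => f t + g t).
Proof.
move=> mD f0 g0 af ag ff fg.
by apply: (lfin_le_add mD f0 g0) => // t; rewrite addr_ge0.
Qed.

Lemma lfin_add_sqr (D : set (measurableTypeR R)) f g : measurable D ->
  (forall t, 0 <= f t) -> (forall t, 0 <= g t) ->
  ae_measurable D f -> ae_measurable D g ->
  lfin leb D (fun t => f t ^+ 2) -> lfin leb D (fun t => g t ^+ 2) ->
  lfin leb D (fun t => (f t + g t) ^+ 2).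
Proof.
move=> mD f0 g0 af ag ff fg.
apply: (lfin_le_add mD (f := fun t => 2 * f t ^+ 2) (g := fun t => 2 * g t ^+ 2)).
- by move=> t; rewrite mulr_ge0 ?sqr_ge0.
- by move=> t; rewrite mulr_ge0 ?sqr_ge0.
- by move=> t; rewrite sqr_ge0.
- exact: ae_measurable_sqrZ.
- exact: ae_measurable_sqrZ.
- exact: lfin_sqrZ.
- exact: lfin_sqrZ.
- by move=> t; have := sqr_ge0 (f t - g t); nra.
Qed.

Lemma lfin_scale (D : set R) f (s : R) : 0 <= s -> (forall t, 0 <= f t) ->
  lfin leb D f -> lfin leb D (fun t => s * f t).
Proof.
move=> s0 f0 fin.
have [] := @le_RintZ _ _ _ leb D D (fun t => s * f t) f s => //.
- by move=> t; rewrite mulr_ge0.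
- exact/aeW.
Qed.

Lemma Rint_scale_ge (D : set R) f (s : R) : 0 <= s -> (forall t, 0 <= f t) ->
  lfin leb D f -> s * \int[leb]_(t in D) f t <= \int[leb]_(t in D) (s * f t).
Proof.
move=> s0 f0 fin; have [->|sn0] := eqVneq s 0.
  by rewrite mul0r; apply: Rint_ge0 => t; rewrite mul0r.
have sp : 0 < s by rewrite lt_neqAle eq_sym sn0.
have [] := @le_RintZ _ _ _ leb D D f (fun t => s * f t) s^-1 => //.
- by rewrite invr_ge0.
- by move=> t; rewrite mulr_ge0.
- by apply/aeW => t Dt; split => //; rewrite mulKf.
- exact: lfin_scale.
- by move=> _; rewrite ler_pdivlMl.
Qed.

Context {V : lmodType R} (X : set V) (N : V -> R).
Hypothesis N_ge0 : forall u, 0 <= N u.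

Lemma bochner_L1_fin (D : set R) (g : R -> V) : bochner_Lq X N 1 D g ->
  lfin leb D (fun t => N (g t)).
Proof.
move=> [_]; rewrite Lnorm1; apply: le_lt_trans; rewrite integral_mkcond.
rewrite (_ : _ \_ D = EFin \o ((fun t => N (g t)) \_ D)); last by rewrite restrict_EFin.
apply: le_lint => [x|x|].
- by rewrite patchE; case: ifP.
- exact: normr_ge0.
- by apply/aeW => x _; split => //; exact: ler_norm.
Qed.

Lemma bochner_L2_fin (D : set R) (g : R -> V) : bochner_Lq X N 2%:E D g ->
  lfin leb D (fun t => N (g t) ^+ 2).
Proof.
move=> [_ /(poweR_lty 2)]; rewrite poweR_Lnorm // => Jfin.
apply: le_lt_trans Jfin; rewrite integral_mkcond.
rewrite (_ : _ \_ D = EFin \o ((fun t => N (g t) ^+ 2) \_ D)); last by rewrite restrict_EFin.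
rewrite [X in (_ <= X)%E](_ : _ = \int[leb]_x (`|((fun t => N (g t)) \_ D) x| `^ 2)%:E)%E //.
apply: le_lint => [x|x|].
- by rewrite patchE; case: ifP => // _; exact: sqr_ge0.
- exact: powR_ge0.
- apply/aeW => x _; split => //; rewrite !patchE; case: ifP => _ /=.
    by rewrite powR_mulrn ?normr_ge0 // real_normK ?num_real.
  exact: powR_ge0.
Qed.

End finiteness.

(** * Summing the defects of all time steps *)

Section rates.
Context {R : realType}.
Local Notation leb := (@lebesgue_measure R).
(* [g j] will be the defect of step j, [a] and [b] the norms of the second time
   derivatives of displacement and pressure, [d] and [e] those of the first ones that
   bound the projection errors, [m] the largest gradient of the first time derivative
   of the pressure *)
Variables (tau h K m : R) (n : nat) (a b d e : R -> R) (g : nat -> R).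
Hypotheses (tau0 : 0 < tau) (h0 : 0 <= h) (K0 : 0 <= K) (m0 : 0 <= m).
Hypotheses (a0 : forall t, 0 <= a t) (b0 : forall t, 0 <= b t)
  (d0 : forall t, 0 <= d t) (e0 : forall t, 0 <= e t).
Local Notation cell j := (`[j%:R * tau, j.+1%:R * tau]%classic).
Local Notation upto := (`[0, n%:R * tau]%classic).
Hypotheses (fa : lfin leb upto a) (fb : lfin leb upto b)
  (fd : lfin leb upto d) (fe : lfin leb upto e).
Local Notation J f j := (\int[leb]_(t in cell j) f t).
Local Notation I f := (\int[leb]_(t in upto) f t).
Local Notation I2 f := (Num.sqrt (\int[leb]_(t in upto) (f t) ^+ 2)).
Hypothesis g0 : forall j, 0 <= g j.
Hypothesis gle : forall j, (j < n)%N ->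
  g j <= K * (tau * (J a j + J b j) + h * (J d j + J e j) + tau * m).

Lemma rate1 : \sum_(j < n) g j <=
  K * (tau * (I a + I b) + h * (I d + I e) + n%:R * tau * m).
Proof.
apply: (@le_trans _ _ (\sum_(j < n) K * (tau * (J a j + J b j) + h * (J d j + J e j) + tau * m))).
  by apply: ler_sum => j _; exact: gle.
rewrite -mulr_sumr; apply: ler_wpM2l => //.
rewrite !big_split /= -!mulr_sumr !big_split /=; apply: lerD.
  by apply: lerD; (apply: ler_wpM2l; first (by rewrite ?(ltW tau0))); apply: lerD;
    exact: sum_cells.
by rewrite sumr_const card_ord -[m *+ n]mulr_natl mulrA [tau * _]mulrC.
Qed.

Hypotheses (fa2 : lfin leb upto (fun t => a t ^+ 2)) (fb2 : lfin leb upto (fun t => b t ^+ 2))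
  (fd2 : lfin leb upto (fun t => d t ^+ 2)) (fe2 : lfin leb upto (fun t => e t ^+ 2)).

Lemma sqr_sum5 (x y z u v : R) :
  (x + y + (z + u) + v) ^+ 2 <= 5 * (x ^+ 2 + y ^+ 2 + (z ^+ 2 + u ^+ 2) + v ^+ 2).
Proof.
rewrite -subr_ge0.
have -> : 5 * (x ^+ 2 + y ^+ 2 + (z ^+ 2 + u ^+ 2) + v ^+ 2) - (x + y + (z + u) + v) ^+ 2 =
  (x - y) ^+ 2 + (x - z) ^+ 2 + (x - u) ^+ 2 + (x - v) ^+ 2 + (y - z) ^+ 2 +
  (y - u) ^+ 2 + (y - v) ^+ 2 + (z - u) ^+ 2 + (z - v) ^+ 2 + (u - v) ^+ 2 by ring.
by rewrite !addr_ge0 ?sqr_ge0.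
Qed.

Lemma sum5_sqr (x y z u v : R) : 0 <= x -> 0 <= y -> 0 <= z -> 0 <= u -> 0 <= v ->
  x ^+ 2 + y ^+ 2 + (z ^+ 2 + u ^+ 2) + v ^+ 2 <= (x + y + (z + u) + v) ^+ 2.
Proof.
move=> x0 y0 z0 u0 v0; rewrite -subr_ge0.
have -> : (x + y + (z + u) + v) ^+ 2 - (x ^+ 2 + y ^+ 2 + (z ^+ 2 + u ^+ 2) + v ^+ 2) =
  2 * (x * y + x * z + x * u + x * v + y * z + y * u + y * v + z * u + z * v + u * v) by ring.
by rewrite mulr_ge0 // !addr_ge0 // mulr_ge0.
Qed.

(** The square of a sum of five terms is at most 5 <= 3^2 times the sum of their squares,
    and each square is summed by the Cauchy-Schwarz inequality on the cells. *)
Lemma rate2 : \sum_(j < n) (g j ^+ 2 / tau) <=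
  (3 * K * (tau * (I2 a + I2 b) + h * (I2 d + I2 e) + Num.sqrt (n%:R * tau) * m)) ^+ 2.
Proof.
have n0 : 0 <= n%:R * tau by rewrite mulr_ge0 // ltW.
have S f : (I2 f) ^+ 2 = \int[leb]_(t in upto) (f t) ^+ 2.
  by rewrite sqr_sqrtr // Rint_ge0 // => t; exact: sqr_ge0.
set A := I2 a; set Bb := I2 b; set Dd := I2 d; set E := I2 e.
have A0 : 0 <= A by exact: sqrtr_ge0.
have B0 : 0 <= Bb by exact: sqrtr_ge0.
have D0 : 0 <= Dd by exact: sqrtr_ge0.
have E0 : 0 <= E by exact: sqrtr_ge0.
have t0 := ltW tau0.
pose q j := (tau * J a j) ^+ 2 + (tau * J b j) ^+ 2 +
  ((h * J d j) ^+ 2 + (h * J e j) ^+ 2) + (tau * m) ^+ 2.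
apply: (@le_trans _ _ (\sum_(j < n) 5 * K ^+ 2 / tau * q j)).
  apply: ler_sum => j _; rewrite [leRHS]mulrAC ler_wpM2r ?invr_ge0 //.
  apply: (@le_trans _ _ ((K * (tau * (J a j + J b j) + h * (J d j + J e j) + tau * m)) ^+ 2)).
    rewrite ler_pXn2r ?nnegrE ?gle // mulr_ge0 //.
    by rewrite !addr_ge0 ?mulr_ge0 ?addr_ge0 ?Rint_ge0.
  rewrite [leLHS]exprMn [5 * K ^+ 2]mulrC -[leRHS]mulrA.
  apply: ler_wpM2l; first exact: sqr_ge0.
  rewrite [X in (X + _ + _) ^+ 2]mulrDr [X in (_ + X + _) ^+ 2]mulrDr.
  exact: sqr_sum5.
rewrite -mulr_sumr.
have sq : \sum_(j < n) q j <= tau * ((tau * A) ^+ 2 + (tau * Bb) ^+ 2 +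
    ((h * Dd) ^+ 2 + (h * E) ^+ 2) + (Num.sqrt (n%:R * tau) * m) ^+ 2).
  have cellsq f c : (forall t, 0 <= f t) -> lfin leb upto f ->
      lfin leb upto (fun t => f t ^+ 2) ->
      \sum_(j < n) (c * J f j) ^+ 2 <= tau * (c * I2 f) ^+ 2.
    move=> f0 ff ff2; under eq_bigr do rewrite exprMn.
    rewrite -mulr_sumr exprMn S mulrCA; apply: ler_wpM2l; first exact: sqr_ge0.
    exact: sum_cells_sqr.
  rewrite /q !big_split /= !mulrDr; apply: lerD; first by apply: lerD; apply: lerD; exact: cellsq.
  rewrite sumr_const card_ord !exprMn sqr_sqrtr // -[_ *+ n]mulr_natl.
  by rewrite le_eqVlt; apply/orP; left; apply/eqP; ring.
have k0 : 0 <= 5 * K ^+ 2 / tau by rewrite divr_ge0 // mulr_ge0 // sqr_ge0.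
apply: le_trans (ler_wpM2l k0 sq) _.
rewrite mulrA -[X in X * _](_ : 5 * K ^+ 2 = _); last by field; rewrite gt_eqF.
rewrite [leRHS]exprMn; apply: ler_pM.
- by rewrite mulr_ge0 // sqr_ge0.
- by rewrite !addr_ge0 ?sqr_ge0.
- by rewrite exprMn ler_wpM2r ?sqr_ge0 // -natrX ler_nat.
- by rewrite !mulrDr; apply: sum5_sqr; rewrite mulr_ge0 ?sqrtr_ge0.
Qed.

End rates.

(** * Stability of the discrete scheme *)

Lemma consistency_arith (R : realFieldType) (C al x s gw gq B g : R) :
  B <= al * (C * (x + s * gq)) -> s ^+ 2 * - g <= s ^+ 2 * (gw * gq) ->
  B - s ^+ 2 * g <= C * al * x + (C * al + s * gw) * (s * gq).
Proof. nra. Qed.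

Lemma energy_arith (R : realFieldType) (t s C al W B g a11 a10 p11 g11 g01 X1 X0 Y1 Y0 : R) :
  a11 - a10 + t * p11 + s ^+ 2 * (g11 - g01) = B - s ^+ 2 * g ->
  a10 <= X1 * X0 -> s ^+ 2 * g01 <= s ^+ 2 * (Y0 * Y1) ->
  B - s ^+ 2 * g <= C * al * X1 + (C * al + s * W) * (s * Y1) ->
  a11 + t * p11 + s ^+ 2 * g11 <=
  X1 * X0 + s * Y1 * (s * Y0) + C * al * X1 + (C * al + s * W) * (s * Y1).
Proof. nra. Qed.

Section discrete_stability.
Context {R : realType} {V Q : lmodType R}.
Variables (XV Vh : set V) (XQ Qh : set Q).
(* [A] is the elasticity form, [AP] the Darcy form, [G] the inner product of the
   gradients, [b] the pairing of the divergence with the pressure, [nQ] the L^2 norm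
   and [sh] stands for eps^(1/2) h *)
Variables (A : V -> V -> R) (AP G : Q -> Q -> R) (b : V -> Q -> R) (nQ : Q -> R).
Variables (tau sh C : R).
Hypotheses (sA : semi_inner XV A) (sAP : semi_inner XQ AP) (sG : semi_inner XQ G).
Hypotheses (sV : lsubspace Vh) (sQ : lsubspace Qh) (VX : Vh `<=` XV) (QX : Qh `<=` XQ).
Hypothesis bBl : forall u v q, XV u -> XV v -> XQ q -> b (u - v) q = b u q - b v q.
Hypothesis bBr : forall v p q, XV v -> XQ p -> XQ q -> b v (p - q) = b v p - b v q.
Hypotheses (tau0 : 0 < tau) (sh0 : 0 <= sh) (C1 : 1 <= C).

Definition momentum_balance (v : V) (q : Q) : Prop := forall w, Vh w -> A v w = b w q.

Hypothesis stable : forall v q, Vh v -> Qh q -> momentum_balance v q ->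
  nQ q <= C * (fnorm A v + sh * fnorm G q).

Definition energy_norm (v : V) (q : Q) : R :=
  Num.sqrt (fnorm A v ^+ 2 + tau * fnorm AP q ^+ 2 + (sh * fnorm G q) ^+ 2).

Section one_step.
Variables (v0 v1 r : V) (q0 q1 w : Q) (al : R).
Hypotheses (Vv0 : Vh v0) (Vv1 : Vh v1) (Qq0 : Qh q0) (Qq1 : Qh q1) (Qw : Qh w).
Hypothesis al0 : 0 <= al.
Hypothesis br : forall q, Qh q -> `|b r q| <= al * nQ q.
Hypothesis mass : forall q, Qh q ->
  b (v1 - v0) q + tau * AP q1 q + sh ^+ 2 * G (q1 - q0) q = b r q - sh ^+ 2 * G w q.
Hypothesis mom1 : momentum_balance v1 q1.

Local Notation be := (sh * fnorm G w).
Local Notation x0 := (fnorm A v0).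
Local Notation x1 := (fnorm A v1).
Local Notation y0 := (sh * fnorm G q0).
Local Notation y1 := (sh * fnorm G q1).
Local Notation z0 := (fnorm AP q0).
Local Notation z1 := (fnorm AP q1).

Lemma consistency_bound v q : Vh v -> Qh q -> momentum_balance v q ->
  b r q - sh ^+ 2 * G w q <= C * al * fnorm A v + (C * al + be) * (sh * fnorm G q).
Proof.
move=> Vv Qq mvq.
have h1 : b r q <= al * (C * (fnorm A v + sh * fnorm G q)).
  apply: le_trans (ler_norm _) _; apply: le_trans (br Qq) _.
  by apply: ler_wpM2l => //; exact: stable.
have h2 : - G w q <= fnorm G w * fnorm G q.
  apply: le_trans (ler_norm _) _; rewrite normrN.
  exact: (semi_inner_CS sG (QX Qw) (QX Qq)).
exact: consistency_arith h1 (ler_wpM2l (sqr_ge0 sh) h2).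
Qed.

(** Energy identity of the implicit Euler method: the mass balance tested with the new
    pressure [q1], the term b (v1 - v0) q1 being A v1 (v1 - v0) by momentum balance. *)
Lemma energy_identity : x1 ^+ 2 + tau * z1 ^+ 2 + y1 ^+ 2 <=
  x1 * x0 + y1 * y0 + C * al * x1 + (C * al + be) * y1.
Proof.
have cb := consistency_bound Vv1 Qq1 mom1; have := mass Qq1.
rewrite bBl; try by [exact: VX|exact: QX].
rewrite (symformBl sG.1); try exact: QX.
rewrite -(mom1 Vv1) -(mom1 Vv0) exprMn.
rewrite (fnorm_sqr sA (VX Vv1)) (fnorm_sqr sAP (QX Qq1)) (fnorm_sqr sG (QX Qq1)) => E.
have hA := le_trans (ler_norm _) (semi_inner_CS sA (VX Vv1) (VX Vv0)).
have hG := le_trans (ler_norm _) (semi_inner_CS sG (QX Qq0) (QX Qq1)).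
exact: energy_arith E hA (ler_wpM2l (sqr_ge0 sh) hG) cb.
Qed.

Lemma stability_step :
  energy_norm v1 q1 <= energy_norm v0 q0 + 2 * C * (al + be).
Proof.
apply: energy_step => //; rewrite ?mulr_ge0 ?fnorm_ge0 //.
exact: energy_identity.
Qed.

Lemma pressure_first_step : z1 ^+ 2 <= energy_norm v0 q0 ^+ 2 / (2 * tau) +
  C ^+ 2 * (al + be) ^+ 2 / tau.
Proof.
rewrite [energy_norm _ _ ^+ 2]sqr_sqrtr; last first.
  by rewrite !addr_ge0 ?sqr_ge0 // mulr_ge0 ?sqr_ge0 // ltW.
apply: (energy_first_step z0 tau0 C1 al0 _ energy_identity).
by rewrite mulr_ge0 ?fnorm_ge0.
Qed.

(** The mass balance tested with [q1 - q0]. Momentum balance at both time levels is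
    needed to read b (v1 - v0) (q1 - q0) as the energy of [v1 - v0]. *)
Lemma pressure_difference_step : momentum_balance v0 q0 ->
  z1 ^+ 2 <= z0 ^+ 2 + 2 * (C ^+ 2 * (al + be) ^+ 2 / tau).
Proof.
move=> mom0; have Vd := subB sV Vv1 Vv0; have Qd := subB sQ Qq1 Qq0.
have momd : momentum_balance (v1 - v0) (q1 - q0).
  move=> v Vv; rewrite (symformBl sA.1); try exact: VX.
  by rewrite bBr ?mom1 ?mom0 //; [exact: VX|exact: QX|exact: QX].
apply: (energy_difference_step (x := fnorm A (v1 - v0)) (y := sh * fnorm G (q1 - q0))
  (c := AP q1 q0)) => //.
- by rewrite mulr_ge0 ?fnorm_ge0.
- by apply: le_trans (ler_norm _) _; exact: (semi_inner_CS sAP (QX Qq1) (QX Qq0)).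
- apply: le_trans (consistency_bound Vd Qd momd).
  rewrite -mass // -(momd _ Vd) (symformBr sAP.1); try exact: QX.
  rewrite exprMn (fnorm_sqr sA (VX Vd)) (fnorm_sqr sG (QX Qd)).
  by rewrite (fnorm_sqr sAP (QX Qq1)).
Qed.

End one_step.

Section many_steps.
Variables (n : nat) (v r : nat -> V) (q w : nat -> Q) (al : nat -> R).
Hypotheses (Vv : forall j, (j <= n)%N -> Vh (v j)) (Qq : forall j, (j <= n)%N -> Qh (q j)).
Hypotheses (Qw : forall j, (j < n)%N -> Qh (w j)) (al0 : forall j, 0 <= al j).
Hypothesis br : forall j, (j < n)%N -> forall p, Qh p -> `|b (r j) p| <= al j * nQ p.
Hypothesis mass : forall j, (j < n)%N -> forall p, Qh p ->
  b (v j.+1 - v j) p + tau * AP (q j.+1) p + sh ^+ 2 * G (q j.+1 - q j) p =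
  b (r j) p - sh ^+ 2 * G (w j) p.
Hypothesis mom : forall j, (j < n)%N -> momentum_balance (v j.+1) (q j.+1).

Local Notation g j := (al j + sh * fnorm G (w j)).

Lemma energy_stability :
  energy_norm (v n) (q n) <= energy_norm (v 0%N) (q 0%N) + 2 * C * \sum_(j < n) g j.
Proof.
rewrite mulr_sumr.
apply: (@sum_steps _ (fun j => energy_norm (v j) (q j)) (fun j => 2 * C * g j)) => j jn.
have jn' := ltnW jn.
by apply: (stability_step (r := r j)); auto.
Qed.

Let S := \sum_(j < n) (g j ^+ 2 / tau).

Lemma pressure_sum (z : nat -> R) : 
  (forall j, (j < n)%N -> z j.+1 <= z j + 2 * C ^+ 2 * (g j ^+ 2 / tau)) ->
  z n <= z 0%N + 2 * C ^+ 2 * S.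
Proof.
move=> H; rewrite mulr_sumr.
exact: (@sum_steps _ z (fun j => 2 * C ^+ 2 * (g j ^+ 2 / tau))).
Qed.

Lemma pressure_stability : momentum_balance (v 0%N) (q 0%N) ->
  fnorm AP (q n) ^+ 2 <= fnorm AP (q 0%N) ^+ 2 + 2 * C ^+ 2 * S.
Proof.
move=> mom0; apply: (pressure_sum (z := fun j => fnorm AP (q j) ^+ 2)) => j jn.
have jn' := ltnW jn.
rewrite -mulrA [C ^+ 2 * _]mulrA.
apply: (pressure_difference_step (v0 := v j) (v1 := v j.+1) (r := r j)); auto.
by case: j jn {jn'} => // j jn; apply: mom; exact: ltnW.
Qed.

(** The first step uses the energy identity, because the initial errors need not be in
    momentum balance; the other steps use differences. *)
Lemma pressure_smoothing : (0 < n)%N ->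
  fnorm AP (q n) ^+ 2 <= energy_norm (v 0%N) (q 0%N) ^+ 2 / (2 * tau) + 2 * C ^+ 2 * S.
Proof.
move=> n0.
(* replacing the zeroth term makes the first step an instance of the recursion *)
pose z j := if j is 0%N then energy_norm (v 0%N) (q 0%N) ^+ 2 / (2 * tau)
            else fnorm AP (q j) ^+ 2.
have -> : fnorm AP (q n) ^+ 2 = z n by case: (n) n0.
apply: (pressure_sum (z := z)) => j jn; have jn' := ltnW jn.
rewrite -mulrA [C ^+ 2 * _]mulrA; case: j jn jn' => [|j] jn jn' /=.
  apply: le_trans (pressure_first_step (v0 := v 0%N) (v1 := v 1%N) (q0 := q 0%N) (r := r 0%N)
    (w := w 0%N) _ _ _ _ _ _ _ _ _) _; auto.
  rewrite lerD2l -[leLHS]mul1r; apply: ler_wpM2r; last by rewrite ler1n.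
  by rewrite divr_ge0 ?(ltW tau0) // mulr_ge0 ?sqr_ge0.
apply: (pressure_difference_step (v0 := v j.+1) (v1 := v j.+2) (r := r j.+1)); auto.
Qed.

Lemma pressure_L2_stability : (0 < n)%N ->
  nQ (q n) <= 2 * C * energy_norm (v n) (q n).
Proof.
move=> n0; have momn : momentum_balance (v n) (q n).
  by case: (n) n0 mom => // k _; apply.
have C0 : 0 <= C by exact: le_trans C1.
apply: le_trans (stable (Vv (leqnn n)) (Qq (leqnn n)) momn) _.
rewrite [2 * C]mulrC -[leRHS]mulrA; apply: ler_wpM2l => //.
rewrite mulr_natl mulr2n.
have z0 : 0 <= tau * fnorm AP (q n) ^+ 2 by rewrite mulr_ge0 ?sqr_ge0 // ltW.
apply: lerD.
  rewrite -[leLHS]ger0_norm ?fnorm_ge0 // -sqrtr_sqr ler_wsqrtr //.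
  by rewrite -addrA lerDl addr_ge0 ?sqr_ge0.
rewrite -[leLHS]ger0_norm ?mulr_ge0 ?fnorm_ge0 // -sqrtr_sqr ler_wsqrtr //.
by rewrite lerDr addr_ge0 ?sqr_ge0.
Qed.

End many_steps.
End discrete_stability.

(** * Consistency of the scheme *)

Section half_open_interval.
Context {R : realType}.
Local Notation leb := (@lebesgue_measure R).
Implicit Types (f : R -> R) (T s : R).

Lemma ae_neq0 : {ae leb, forall t : R, t != 0}.
Proof.
exists [set 0]; split; first exact: measurable_set1.
  exact: lebesgue_measure_set1.
by move=> t /= /negP; rewrite negbK => /eqP.
Qed.

(** The estimates on the solution hold on ]0, T], the integrals run over [0, s]. *)
Lemma ae_half_open T s : s <= T ->
  {ae leb, forall t, `[0, s]%classic t -> `]0, T]%classic t}.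
Proof.
move=> sT; apply: ae_mono ae_neq0 => t t0; rewrite /= !in_itv /= => /andP[t1 t2].
by rewrite lt_neqAle eq_sym t0 t1 (le_trans t2 sT).
Qed.

Lemma lfin_closed T s f g : s <= T -> (forall t, 0 <= f t) ->
  (forall t, f t <= g t) -> lfin leb `]0, T] g -> lfin leb `[0, s] f.
Proof.
move=> sT f0 fg; apply: le_lfin => //; first by move=> t; exact: le_trans (fg t).
by apply: ae_mono (ae_half_open sT) => t h /h.
Qed.

Lemma ae_measurable_closed T s f : s <= T -> ae_measurable `]0, T] f ->
  ae_measurable `[0, s] f.
Proof.
move=> sT [m [m0 mm ae]]; exists m; split => //.
by apply: ae_mono2 (ae_half_open sT) ae => t h1 h2 /h1 /h2.
Qed.

End half_open_interval.

Section sobolev_norms.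
Context {R : realType} {d : nat} (Omega : set 'rV[R]_d).
Implicit Types (q : 'rV[R]_d -> R) (w : 'I_d -> 'rV[R]_d -> R).

Lemma le_sqrtDr (x y : R) : 0 <= y -> y <= Num.sqrt (x ^+ 2 + y ^+ 2).
Proof. by move=> y0; rewrite -[leLHS]ger0_norm // -sqrtr_sqr ler_wsqrtr // lerDr sqr_ge0. Qed.

Lemma semi1_le_norm1 q : semi1 Omega q <= norm1 Omega q.
Proof. by apply: le_sqrtDr; exact: sqrtr_ge0. Qed.

Lemma semi2_le_norm2 q : semi2 Omega q <= norm2 Omega q.
Proof. by apply: le_sqrtDr; exact: sqrtr_ge0. Qed.

Lemma vsemi2_le_vnorm2 w : vsemi2 Omega w <= vnorm2 Omega w.
Proof.
apply: ler_wsqrtr; apply: ler_sum => i _.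
by rewrite ler_pXn2r ?nnegrE ?sqrtr_ge0 // semi2_le_norm2.
Qed.

End sobolev_norms.

Lemma consistency_decomposition (V : zmodType) (ua ub ba bb s : V) :
  s - (bb - ba) = (ub - bb - (ua - ba)) - (ub - ua - s).
Proof.
rewrite !opprB [RHS](AC ((2*2)*(1*2)) ((5*(3*2))*((1*7)*(4*6)))) /=.
by rewrite subrr addNr !addr0.
Qed.

Lemma increment_decomposition (V : zmodType) (ua ub ba bb s : V) :
  bb - ba = s + (ub - ua - s) - (ub - bb - (ua - ba)).
Proof.
rewrite [s + _]addrC subrK !opprB.
rewrite [RHS](AC (2*(2*2)) ((5*4)*((1*6)*(2*3)))) /=.
by rewrite subrr addNr !addr0.
Qed.

Section consistency.
Context {R : realType} {d : nat} (Omega : set 'rV[R]_d).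
Context (lambda mu : R) (K : 'rV[R]_d -> 'M[R]_d).
Hypotheses (oO : open Omega) (bO : bounded_set Omega).
Hypotheses (mu0 : 0 < mu) (lm0 : 0 < d%:R * lambda + 2 * mu) (d0 : (0 < d)%N).
Local Notation leb := (@lebesgue_measure R).
Local Notation vfield := ('I_d -> 'rV[R]_d -> R).
Local Notation field := ('rV[R]_d -> R).
Local Notation norm_a := (norm_a Omega lambda mu).
Local Notation vH10 := (vH10_space Omega).
Local Notation H10 := (H10_space Omega).
Local Notation Cd := (Num.sqrt (2 * mu / d%:R + lambda)^-1).
Local Notation Ca := (Num.sqrt (2 * mu + `|lambda| * d%:R)).
Local Notation sVX := (vH10_subspace oO bO).
Local Notation sQX := (H10_subspace oO bO).

Lemma vform1_vH10 : semi_inner vH10 (vform1 Omega).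
Proof. exact: (semi_inner_subset sVX (@vH10_vH1 _ _ Omega) (vform1_semi_inner oO bO)). Qed.

Lemma form_a_vH10 : semi_inner vH10 (form_a Omega lambda mu).
Proof.
exact: (semi_inner_subset sVX (@vH10_vH1 _ _ Omega) (form_a_semi_inner oO bO mu0 lm0 d0)).
Qed.

Lemma inner_grad_H10 : semi_inner H10 (inner_grad Omega).
Proof. exact: (semi_inner_subset sQX (@H10_H1 _ _ Omega) (inner_grad_semi_inner oO bO)). Qed.

Variables (T h ca : R) (u ut utt : R -> vfield) (p pt ptt : R -> field).
Variables (ub : R -> vfield) (pb : R -> field) (rut : R -> vfield) (rpt : R -> field).
Hypotheses (du : time_derivative vH10 (vnorm1 Omega) T u ut)
  (dut : time_derivative vH10 (vnorm1 Omega) T ut utt)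
  (dp : time_derivative H10 (norm1 Omega) T p pt)
  (dpt : time_derivative H10 (norm1 Omega) T pt ptt).
Hypotheses
  (dru : time_derivative vH10 (vnorm1 Omega) T (fun t => u t - ub t) rut)
  (drp : time_derivative H10 (norm1 Omega) T (fun t => p t - pb t) rpt)
  (aer : {ae leb, forall t, 0 < t <= T -> approximation_bounds Omega lambda mu K ca h
     (rut t) (rpt t) (ut t) (pt t)}).
Hypothesis h0 : 0 <= h.
Variables (a b : R).
Hypotheses (a0 : 0 <= a) (ab : a < b) (bT : b <= T).
Local Notation cell := (`[a, b]%classic).
Local Notation rate_u := (fun t => vsemi2 Omega (ut t) + semi1 Omega (pt t)).
Local Notation rate_p := (fun t => semi2 Omega (pt t)).
Hypotheses (fu : lfin leb cell rate_u) (fp : lfin leb cell rate_p).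
Hypotheses (futt : lfin leb cell (fun t => vnorm1 Omega (utt t)))
  (fptt : lfin leb cell (fun t => semi1 Omega (ptt t))).

Lemma cell_half_open : {ae leb, forall t, cell t -> 0 < t <= T}.
Proof.
apply: ae_mono ae_neq0 => t t0; rewrite /= !in_itv /= => /andP[t1 t2].
by rewrite lt_neqAle eq_sym t0 (le_trans a0 t1) (le_trans t2 bT).
Qed.

(** The increment of the projection error is the integral of its derivative, to which the
    approximation property of the elliptic projection applies. *)
Lemma projection_increment_u : norm_a (u b - ub b - (u a - ub a)) <=
  `|ca| * h * \int[leb]_(t in cell) rate_u t.
Proof.
have k0 : 0 <= `|ca| * h by rewrite mulr_ge0.
have [fr le] : lfin leb cell (fun t => norm_a (rut t)) /\
    \int[leb]_(t in cell) norm_a (rut t) <= `|ca| * h * \int[leb]_(t in cell) rate_u t.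
  apply: le_RintZ => //.
  - by move=> t; exact: sqrtr_ge0.
  - by move=> t; rewrite addr_ge0 ?sqrtr_ge0.
  - apply: ae_mono2 cell_half_open aer => t h1 h2 ct; split => //.
    have [h3 _ _ _] := h2 (h1 ct); apply: le_trans h3 _.
    apply: ler_wpM2r; first by rewrite addr_ge0 ?sqrtr_ge0.
    by apply: ler_wpM2r => //; exact: ler_norm.
apply: le_trans le.
apply: (seminorm_increment form_a_vH10 _ _ _ _ _ dru a0 (ltW ab) bT fr).
- by move=> w; exact: sqrtr_ge0.
- exact: (sqrtr_ge0 (2 * mu + `|lambda| * d%:R)).
- by move=> w; exact: sqrtr_ge0.
- by [].
- by move=> w Xw; apply: (norm_a_le_vnorm1 oO bO lambda mu0); exact: vH10_vH1.
Qed.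

Lemma projection_increment_p : semi1 Omega (p b - pb b - (p a - pb a)) <=
  `|ca| * h * \int[leb]_(t in cell) rate_p t.
Proof.
have k0 : 0 <= `|ca| * h by rewrite mulr_ge0.
have [fr le] : lfin leb cell (fun t => semi1 Omega (rpt t)) /\
    \int[leb]_(t in cell) semi1 Omega (rpt t) <= `|ca| * h * \int[leb]_(t in cell) rate_p t.
  apply: le_RintZ => //.
  - by move=> t; exact: sqrtr_ge0.
  - by move=> t; exact: sqrtr_ge0.
  - apply: ae_mono2 cell_half_open aer => t h1 h2 ct; split => //.
    have [_ h3 _ _] := h2 (h1 ct).
    apply: le_trans (semi1_le_norm1 _ _) _; apply: le_trans h3 _.
    apply: ler_wpM2r; first exact: sqrtr_ge0.
    by apply: ler_wpM2r => //; exact: ler_norm.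
apply: le_trans le.
apply: (seminorm_increment (C := 1) inner_grad_H10 _ _ _ _ _ drp a0 (ltW ab) bT fr).
- by move=> w; exact: sqrtr_ge0.
- by [].
- by move=> w; exact: sqrtr_ge0.
- by move=> w Xw; apply: (semi1E oO bO); exact: H10_H1.
- by move=> w Xw; rewrite mul1r semi1_le_norm1.
Qed.

Lemma taylor_u : norm_a (u b - u a - (b - a) *: ut b) <=
  Ca * ((b - a) * \int[leb]_(t in cell) vnorm1 Omega (utt t)).
Proof.
have [Xu _] := du a0 (ltW ab) bT.
have Xub : vH10 (ut b).
  by apply: (derivative_in vform1_vH10 du dut); rewrite bT (le_lt_trans a0 ab).
have Xw : vH10 (u b - u a - (b - a) *: ut b) := subB sVX Xu (subZ sVX _ Xub).
apply: le_trans (norm_a_le_vnorm1 oO bO lambda mu0 (vH10_vH1 Xw)) _.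
apply: ler_wpM2l; first exact: (sqrtr_ge0 (2 * mu + `|lambda| * d%:R)).
apply: (seminorm_taylor (C := 1) vform1_vH10 _ _ _ _ _ du dut a0 ab bT futt).
- by move=> w; exact: sqrtr_ge0.
- by [].
- by move=> w; exact: sqrtr_ge0.
- by move=> w Hw; apply: (vnorm1E oO bO); exact: vH10_vH1.
- by move=> w _; rewrite mul1r.
Qed.

Lemma taylor_p : semi1 Omega (p b - p a - (b - a) *: pt b) <=
  (b - a) * \int[leb]_(t in cell) semi1 Omega (ptt t).
Proof.
apply: (seminorm_taylor (C := 1) inner_grad_H10 _ _ _ _ _ dp dpt a0 ab bT fptt).
- by move=> w; exact: sqrtr_ge0.
- by [].
- by move=> w; exact: sqrtr_ge0.
- by move=> w Xw; apply: (semi1E oO bO); exact: H10_H1.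
- by move=> w Xw; rewrite mul1r semi1_le_norm1.
Qed.

Hypotheses (ubX : vH10 (ub b - ub a)) (pbX : H10 (pb b - pb a)).

Lemma velocity_consistency :
  L2norm Omega (div Omega ((b - a) *: ut b - (ub b - ub a))) <=
  Cd * (Ca * ((b - a) * \int[leb]_(t in cell) vnorm1 Omega (utt t))
        + `|ca| * h * \int[leb]_(t in cell) rate_u t).
Proof.
have [Xu _] := du a0 (ltW ab) bT; have [Xr _] := dru a0 (ltW ab) bT.
have Xub : vH10 (ut b).
  by apply: (derivative_in vform1_vH10 du dut); rewrite bT (le_lt_trans a0 ab).
have Xw := subB sVX Xu (subZ sVX (b - a) Xub); have X := subB sVX Xr Xw.
rewrite (consistency_decomposition (u a) (u b)).
apply: le_trans (div_le_norm_a oO bO mu0 lm0 d0 (vH10_vH1 X)) _.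
apply: ler_wpM2l; first exact: sqrtr_ge0.
apply: le_trans (fnormB form_a_vH10 Xr Xw) _; rewrite addrC.
by apply: lerD; [exact: taylor_u|exact: projection_increment_u].
Qed.

Lemma pressure_increment : semi1 Omega (pb b - pb a) <=
  (b - a) * semi1 Omega (pt b)
  + (b - a) * \int[leb]_(t in cell) semi1 Omega (ptt t)
  + `|ca| * h * \int[leb]_(t in cell) rate_p t.
Proof.
have [Xp _] := dp a0 (ltW ab) bT; have [Xr _] := drp a0 (ltW ab) bT.
have Xpt : H10 (pt b).
  by apply: (derivative_in inner_grad_H10 dp dpt); rewrite bT (le_lt_trans a0 ab).
have Xs := subZ sQX (b - a) Xpt; have Xw := subB sQX Xp Xs.
have S q : H10 q -> semi1 Omega q = fnorm (inner_grad Omega) q.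
  by move=> Hq; apply: (semi1E oO bO); exact: H10_H1.
have l1 := taylor_p; have l2 := projection_increment_p.
have X1 := subD sQX Xs Xw.
rewrite (S _ pbX) (increment_decomposition (p a) (p b) _ _ ((b - a) *: pt b)).
apply: le_trans (fnormB inner_grad_H10 X1 Xr) _.
rewrite (S _ Xr) in l2; apply: lerD l2.
apply: le_trans (fnormD inner_grad_H10 Xs Xw) _.
rewrite (S _ Xw) in l1; apply: lerD l1.
rewrite (fnormZ inner_grad_H10 _ Xpt) ger0_norm; last by rewrite subr_ge0 ltW.
by rewrite (S _ Xpt).
Qed.

End consistency.

(** * Integrability in time of the solution *)

Section solution_regularity.
Context {R : realType} {d : nat} (Omega : set 'rV[R]_d).
Hypotheses (oO : open Omega) (bO : bounded_set Omega).
Local Notation leb := (@lebesgue_measure R).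
Variables (T s : R) (u ut utt : R -> 'I_d -> 'rV[R]_d -> R).
Variables (p pt ptt : R -> 'rV[R]_d -> R).
Hypotheses (reg : biot_regularity Omega T u ut utt p pt ptt) (sT : s <= T).
Local Notation upto := (`[0, s]%classic).

Definition lfin12 (f : R -> R) : Prop :=
  lfin leb upto f /\ lfin leb upto (fun t => f t ^+ 2).

Lemma bochner_lfin12 (V : lmodType R) (X : set V) (N : V -> R) (g : R -> V) (f : R -> R) :
  (forall v, 0 <= N v) -> (forall t, 0 <= f t) -> (forall t, f t <= N (g t)) ->
  bochner_Lq X N 1 `]0, T] g -> bochner_Lq X N 2%:E `]0, T] g -> lfin12 f.
Proof.
move=> N0 f0 fN b1 b2; split.
  exact: lfin_closed sT f0 fN (bochner_L1_fin N0 b1).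
apply: (lfin_closed (g := fun t => N (g t) ^+ 2) sT); last exact: bochner_L2_fin b2.
  by move=> t; exact: sqr_ge0.
by move=> t; rewrite ler_pXn2r ?nnegrE.
Qed.

Lemma lfin12_utt : lfin12 (fun t => vnorm1 Omega (utt t)).
Proof.
have [_ _ H _] := reg; have [_ h1 _ _] := H 1%E (or_introl erefl).
have [_ h2 _ _] := H 2%:E (or_intror erefl).
by apply: (bochner_lfin12 _ _ _ h1 h2) => [v|t|t//]; exact: sqrtr_ge0.
Qed.

Lemma lfin12_ptt : lfin12 (fun t => norm1 Omega (ptt t)).
Proof.
have [_ _ H _] := reg; have [_ _ _ h1] := H 1%E (or_introl erefl).
have [_ _ _ h2] := H 2%:E (or_intror erefl).
by apply: (bochner_lfin12 _ _ _ h1 h2) => [v|t|t//]; exact: sqrtr_ge0.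
Qed.

Lemma lfin12_semi1_ptt : lfin12 (fun t => semi1 Omega (ptt t)).
Proof.
have [_ _ H _] := reg; have [_ _ _ h1] := H 1%E (or_introl erefl).
have [_ _ _ h2] := H 2%:E (or_intror erefl).
apply: (bochner_lfin12 _ _ _ h1 h2) => [v|t|t]; [exact: sqrtr_ge0|exact: sqrtr_ge0|].
exact: semi1_le_norm1.
Qed.

Lemma lfin12_semi2_pt : lfin12 (fun t => semi2 Omega (pt t)).
Proof.
have [_ _ H _] := reg; have [_ _ h1 _] := H 1%E (or_introl erefl).
have [_ _ h2 _] := H 2%:E (or_intror erefl).
apply: (bochner_lfin12 _ _ _ h1 h2) => [v|t|t]; [exact: sqrtr_ge0|exact: sqrtr_ge0|].
exact: semi2_le_norm2.
Qed.

Lemma lfin12_first_order :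
  lfin12 (fun t => vsemi2 Omega (ut t) + semi1 Omega (pt t)).
Proof.
have [_ _ H Hq] := reg; have [h1 _ _ _] := H 1%E (or_introl erefl).
have [h2 _ _ _] := H 2%:E (or_intror erefl).
have k1 : bochner_Lq (H10_space Omega) (norm1 Omega) 1 `]0, T] pt by apply: Hq; constructor.
have k2 : bochner_Lq (H10_space Omega) (norm1 Omega) 2%:E `]0, T] pt by apply: Hq; constructor.
have m0 : measurable (`]0, T]%classic : set (measurableTypeR R)) by exact: measurable_itv.
have m1 : measurable (upto : set (measurableTypeR R)) by exact: measurable_itv.
have [f1 f2] : lfin12 (fun t => vsemi2 Omega (ut t)).
  apply: (bochner_lfin12 _ _ _ h1 h2) => [v|t|t]; [exact: sqrtr_ge0|exact: sqrtr_ge0|].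
  exact: vsemi2_le_vnorm2.
have [g1 g2] : lfin12 (fun t => semi1 Omega (pt t)).
  apply: (bochner_lfin12 _ _ _ k1 k2) => [v|t|t]; [exact: sqrtr_ge0|exact: sqrtr_ge0|].
  exact: semi1_le_norm1.
have mf : ae_measurable upto (fun t => vsemi2 Omega (ut t)).
  apply: (ae_measurable_closed sT); have [[st sta] _] := h1.
  apply: (seminorm_ae_measurable (C := 1) (vform2_semi_inner oO bO) _ _ _ _ m0 sta).
  - by move=> w; exact: sqrtr_ge0.
  - by [].
  - by move=> w Hw; exact: (vsemi2E oO bO).
  - by move=> w _; rewrite mul1r vsemi2_le_vnorm2.
have mg : ae_measurable upto (fun t => semi1 Omega (pt t)).
  apply: (ae_measurable_closed sT); have [[st sta] _] := k1.
  apply: (seminorm_ae_measurable (C := 1) (inner_grad_H10 oO bO) _ _ _ _ m0 sta).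
  - by move=> w; exact: sqrtr_ge0.
  - by [].
  - by move=> w Xw; apply: (semi1E oO bO); exact: H10_H1.
  - by move=> w Xw; rewrite mul1r semi1_le_norm1.
have p1 t : 0 <= vsemi2 Omega (ut t) by exact: sqrtr_ge0.
have p2 t : 0 <= semi1 Omega (pt t) by exact: sqrtr_ge0.
by split; [exact: lfin_add|exact: lfin_add_sqr].
Qed.

Lemma lfin12_scale (k : R) (f : R -> R) : 0 <= k -> (forall t, 0 <= f t) ->
  lfin12 f -> lfin12 (fun t => k * f t).
Proof.
move=> k0 f0 [f1 f2]; split; first exact: lfin_scale.
under [X in lfin _ _ X]eq_fun do rewrite exprMn.
by apply: lfin_scale => // [|t]; exact: sqr_ge0.
Qed.

End solution_regularity.

(** * The error equations *)

Lemma subr_exchange (V : zmodType) (x y z w : V) : x - y - (z - w) = x - z - (y - w).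
Proof. by rewrite opprD addrACA -opprD. Qed.

Section weakly_linear_theory.
Context {R : realType} {V W : lmodType R} {X : set V} {Y : set W}.
Context {B : W -> W -> R} {D : V -> W}.
Hypotheses (sX : lsubspace X) (wD : weakly_linear X Y B D) (sB : symform Y B).

Lemma weakly_linearZE a u w : X u -> Y w -> B (D (a *: u)) w = a * B (D u) w.
Proof.
move=> Xu Yw; have E v : X v -> B (D (a *: u + v)) w = a * B (D u) w + B (D v) w.
  by move=> Xv; exact: wD.2.
have X0 := sub0 sX.
have D0 : B (D 0) w = 0.
  have := wD.2 1 0 0 w X0 X0 Yw; rewrite scale1r add0r mul1r => /eqP.
  by rewrite -subr_eq0 opprD addrA subrr sub0r oppr_eq0 => /eqP.
by have := E 0 X0; rewrite D0 !addr0.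
Qed.

Lemma weakly_linearBE u v w : X u -> X v -> Y w ->
  B (D (u - v)) w = B (D u) w - B (D v) w.
Proof.
move=> Xu Xv Yw; have := wD.2 (-1) v u w Xv Xu Yw.
by rewrite scaleN1r addrC mulN1r [RHS]addrC.
Qed.

End weakly_linear_theory.

Section sup_bound.
Context {R : realType}.

(** The absolute value is taken because the supremum will be multiplied by a constant of
    unknown sign; the supremum of the empty set is 0. *)
Lemma normr_sup_le (S : set R) (x : R) : 0 <= x -> (forall r, S r -> `|r| <= x) ->
  `|sup S| <= x.
Proof.
move=> x0 Sx; have [->|/set0P[r Sr]] := eqVneq S set0; first by rewrite sup0 normr0.
have ubS : ubound S x by move=> y /Sx; apply: le_trans; exact: ler_norm.
rewrite ler_norml; apply/andP; split; last by apply: ge_sup => //; exists r.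
have : - x <= r by have := Sx r Sr; rewrite ler_norml => /andP[].
by move/le_trans; apply; apply: ub_le_sup => //; exists x.
Qed.

End sup_bound.

Section error_equations.
Context {R : realType} {d : nat} (Omega : set 'rV[R]_d).
Context (lambda mu : R) (K : 'rV[R]_d -> 'M[R]_d).
Hypotheses (oO : open Omega) (bO : bounded_set Omega).
Hypotheses (mu0 : 0 < mu) (lm0 : 0 < d%:R * lambda + 2 * mu) (d0 : (0 < d)%N).
Hypothesis (HK : conductivity Omega K).
Local Notation vH10 := (vH10_space Omega).
Local Notation H10 := (H10_space Omega).
Local Notation form_a := (form_a Omega lambda mu).
Local Notation form_ap := (form_ap Omega K).
Local Notation inner_grad := (inner_grad Omega).
Local Notation inner := (inner Omega).
Local Notation div := (div Omega).
Local Notation vfield := ('I_d -> 'rV[R]_d -> R).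
Local Notation field := ('rV[R]_d -> R).
Local Notation b := (fun (v : vfield) (q : field) => inner (div v) q).
Local Notation sA := (form_a_vH10 oO bO mu0 lm0 d0).
Local Notation sVX := (vH10_subspace oO bO).
Local Notation sQX := (H10_subspace oO bO).
Local Notation sf := (inner_semi_inner oO bO).1.

Lemma form_ap_H10 : semi_inner H10 form_ap.
Proof. exact: (semi_inner_subset sQX (@H10_H1 _ _ Omega) (form_ap_semi_inner oO bO HK)). Qed.

Lemma H10_L2 q : H10 q -> L2_space Omega q.
Proof. by move=> /H10_H1/H1_L2. Qed.

Lemma div_pairingBl v w q : vH10 v -> vH10 w -> H10 q -> b (v - w) q = b v q - b w q.
Proof.
move=> /vH10_vH1 Xv /vH10_vH1 Xw /H10_L2 Lq.
exact: (weakly_linearBE (div_weakly_linear oO bO) Xv Xw Lq).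
Qed.

Lemma div_pairingZl a v q : vH10 v -> H10 q -> b (a *: v) q = a * b v q.
Proof.
move=> /vH10_vH1 Xv /H10_L2 Lq.
exact: (weakly_linearZE (vH1_subspace oO bO) (div_weakly_linear oO bO) a Xv Lq).
Qed.

Lemma div_pairingBr v p q : vH10 v -> H10 p -> H10 q -> b v (p - q) = b v p - b v q.
Proof.
move=> /vH10_vH1 Xv /H10_L2 Lp /H10_L2 Lq.
exact: (symformBr sf Lp Lq (div_L2 oO bO Xv)).
Qed.

Variables (Vh : set vfield) (Qh : set field).
Hypotheses (VX : Vh `<=` vH10) (QX : Qh `<=` H10).

(** The elliptic projection of the displacement is defined through the full momentum
    equation, projected pressure included, so the data cancel. *)
Lemma momentum_error (F : vfield -> R) u p ub pb uh ph :
  Vh ub -> Qh pb -> Vh uh -> Qh ph ->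
  (forall v, Vh v -> form_a uh v - b v ph = F v) ->
  (forall v, Vh v -> form_a u v - b v p = F v) ->
  (forall v, Vh v -> form_a ub v - b v pb = form_a u v - b v p) ->
  momentum_balance Vh form_a b (uh - ub) (ph - pb).
Proof.
move=> Vub Qpb Vuh Qph Eh Ec Eb v Vv.
rewrite (symformBl sA.1 (VX Vuh) (VX Vub) (VX Vv)).
rewrite (div_pairingBr (VX Vv) (QX Qph) (QX Qpb)).
have := Eh v Vv; have := Ec v Vv; have := Eb v Vv.
move: (form_a uh v) (form_a ub v) (form_a u v) (b v ph) (b v pb) (b v p) (F v).
move=> {Eh Ec Eb} x y z bx bY bz Fv /= e1 e2 e3.
have -> : x = Fv + bx by rewrite -e3 subrK.
have -> : y = Fv + bY by rewrite -e2 -e1 subrK.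
by rewrite opprD addrACA subrr add0r.
Qed.

Lemma mass_arith (tau s2 buh but bub aph apb gph gpb : R) : 0 < tau ->
  - (tau^-1 * buh) - aph - s2 * (tau^-1 * gph) = 0 -> - but - apb = 0 ->
  buh - bub + tau * (aph - apb) + s2 * (gph - gpb) = tau * but - bub - s2 * gpb.
Proof.
move=> t0 e1 /eqP; rewrite subr_eq0 => /eqP <-.
have tn0 : tau != 0 by rewrite gt_eqF.
have : tau * (- (tau^-1 * buh) - aph - s2 * (tau^-1 * gph)) = 0 by rewrite e1 mulr0.
rewrite !mulrBr mulrN mulVKf // mulrCA mulVKf // => e.
have -> : buh = - (tau * aph) - s2 * gph.
  move/eqP: e; rewrite -addrA addrC subr_eq0 => /eqP <-.
  by rewrite addrC.
ring.
Qed.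

Lemma mass_error (tau s2 : R) ut p ub0 ub1 pb0 pb1 uh0 uh1 ph0 ph1 : 0 < tau ->
  vH10 ut -> Vh ub0 -> Vh ub1 -> Vh uh0 -> Vh uh1 ->
  Qh pb0 -> Qh pb1 -> Qh ph0 -> Qh ph1 ->
  (forall q, Qh q -> - b (tau^-1 *: (uh1 - uh0)) q - form_ap ph1 q
     - s2 * inner_grad (tau^-1 *: (ph1 - ph0)) q = 0) ->
  (forall q, Qh q -> - b ut q - form_ap p q = 0) ->
  (forall q, Qh q -> form_ap pb1 q = form_ap p q) ->
  forall q, Qh q ->
  b (uh1 - ub1 - (uh0 - ub0)) q + tau * form_ap (ph1 - pb1) q
    + s2 * inner_grad (ph1 - pb1 - (ph0 - pb0)) q =
  b (tau *: ut - (ub1 - ub0)) q - s2 * inner_grad (pb1 - pb0) q.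
Proof.
move=> t0 Xut /VX X0 /VX X1 /VX Xh0 /VX Xh1 /QX Y0 /QX Y1 /QX Yh0 /QX Yh1 Eh Ec Eb q Qq.
have := Eh q Qq; have := Ec q Qq; rewrite -(Eb q Qq) => e1 e2.
have Yq := QX Qq; have sG := (inner_grad_H10 oO bO).1.
have Xb := subB sVX X1 X0; have Xh := subB sVX Xh1 Xh0.
have Yb := subB sQX Y1 Y0; have Yh := subB sQX Yh1 Yh0.
rewrite (subr_exchange uh1) (subr_exchange ph1) (div_pairingBl Xh Xb Yq) (symformBl form_ap_H10.1 Yh1 Y1 Yq).
rewrite (symformBl sG Yh Yb Yq) (div_pairingBl (subZ sVX tau Xut) Xb Yq).
rewrite (div_pairingZl tau Xut Yq); rewrite (div_pairingZl _ Xh Yq) in e2.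
rewrite (symformZl sG _ Yh Yq) in e2.
exact: mass_arith e2 e1.
Qed.

Variables (c_is c1 eps h : R).
Hypothesis (h0 : 0 <= h).

(** Momentum balance turns the quotients of the inf-sup condition into
    a(v, w) / |w|_a, bounded by |v|_a. *)
Lemma inf_sup_stability : inf_sup Omega lambda mu Vh Qh c_is c1 eps h ->
  forall v q, Vh v -> Qh q -> momentum_balance Vh form_a b v q ->
  L2norm Omega q <= (1 + `|c_is| + `|c1|) *
    (fnorm form_a v + Num.sqrt eps * h * fnorm inner_grad q).
Proof.
move=> infsup v q Vv Qq mvq; apply: le_trans (infsup q Qq) _.
set S := [set r | _].
have x0 : 0 <= fnorm form_a v by exact: fnorm_ge0.
have S1 : `|sup S| <= fnorm form_a v.
  apply: normr_sup_le => // _ [w [Vw _ ->]]; rewrite -(mvq w Vw) normrM normfV.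
  have n0 : 0 <= norm_a Omega lambda mu w by exact: sqrtr_ge0.
  rewrite (ger0_norm n0); have [->|nn0] := eqVneq (norm_a Omega lambda mu w) 0.
    rewrite invr0 mulr0; exact: x0.
  rewrite ler_pdivrMr; last (rewrite lt_neqAle eq_sym nn0; exact: n0).
  exact: (semi_inner_CS sA (VX Vv) (VX Vw)).
rewrite (semi1E oO bO (H10_H1 (QX Qq))).
have : c_is * sup S <= `|c_is| * fnorm form_a v.
  by apply: le_trans (ler_norm _) _; rewrite normrM ler_wpM2l.
have y0 : 0 <= Num.sqrt eps * h * fnorm inner_grad q.
  by rewrite mulr_ge0 ?fnorm_ge0 // mulr_ge0 ?sqrtr_ge0.
have := ler_wpM2r y0 (ler_norm c1).
rewrite -!(mulrA c1).
move: (fnorm form_a v) (Num.sqrt eps * h * _) (c_is * _) x0 y0 => x y z x0 y0 l1 l2.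
move: (normr_ge0 c_is) (normr_ge0 c1); move: (`|c_is|) (`|c1|) l1 l2 => a k l1 l2 a0 k0.
apply: le_trans (lerD l2 l1) _; rewrite mulrDr; apply: lerD; apply: ler_wpM2r => //.
- by rewrite addrAC lerDr addr_ge0.
- by rewrite lerDr addr_ge0.
Qed.

End error_equations.

(** * Elementary inequalities for the final estimates *)

Section real_estimates.
Context {R : realType}.

(** The triangle inequality for the energy norm, from those of its three parts. *)
Lemma weighted_minkowski (t x y z x1 y1 z1 x2 y2 z2 : R) : 0 <= t ->
  0 <= x -> 0 <= y -> 0 <= z -> 0 <= x1 -> 0 <= y1 -> 0 <= z1 ->
  0 <= x2 -> 0 <= y2 -> 0 <= z2 ->
  x <= x1 + x2 -> y <= y1 + y2 -> z <= z1 + z2 ->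
  Num.sqrt (x ^+ 2 + t * z ^+ 2 + y ^+ 2) <=
  Num.sqrt (x1 ^+ 2 + t * z1 ^+ 2 + y1 ^+ 2) + Num.sqrt (x2 ^+ 2 + t * z2 ^+ 2 + y2 ^+ 2).
Proof.
move=> t0 x0 y0 z0 x10 y10 z10 x20 y20 z20 lx ly lz.
have P a b c : 0 <= a ^+ 2 + t * b ^+ 2 + c ^+ 2 :> R.
  by rewrite !addr_ge0 ?sqr_ge0 // mulr_ge0 ?sqr_ge0.
apply: sqrt_le_of_sqr; first by rewrite addr_ge0 ?sqrtr_ge0.
set N1 := Num.sqrt _; set N2 := Num.sqrt _.
have E1 : N1 ^+ 2 = x1 ^+ 2 + t * z1 ^+ 2 + y1 ^+ 2 by rewrite sqr_sqrtr.
have E2 : N2 ^+ 2 = x2 ^+ 2 + t * z2 ^+ 2 + y2 ^+ 2 by rewrite sqr_sqrtr.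
have cs : x1 * x2 + t * (z1 * z2) + y1 * y2 <= N1 * N2.
  rewrite -(@ler_pXn2r _ 2) ?nnegrE ?addr_ge0 ?mulr_ge0 ?sqrtr_ge0 // exprMn E1 E2.
  (* Lagrange's identity *)
  rewrite -subr_ge0 (_ : _ - _ = t * (x1 * z2 - z1 * x2) ^+ 2 + (x1 * y2 - y1 * x2) ^+ 2 +
    t * (z1 * y2 - y1 * z2) ^+ 2); last by ring.
  by rewrite !addr_ge0 ?sqr_ge0 // mulr_ge0 ?sqr_ge0.
have sq (a b : R) : 0 <= a -> a <= b -> a ^+ 2 <= b ^+ 2.
  by move=> a0 ab; rewrite ler_pXn2r ?nnegrE //; exact: le_trans ab.
have hx := sq _ _ x0 lx; have hy := sq _ _ y0 ly.
have hz := ler_wpM2l t0 (sq _ _ z0 lz).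
have -> : (N1 + N2) ^+ 2 = N1 ^+ 2 + N2 ^+ 2 + 2 * (N1 * N2) by ring.
rewrite E1 E2.
apply: (@le_trans _ _ ((x1 + x2) ^+ 2 + t * (z1 + z2) ^+ 2 + (y1 + y2) ^+ 2)).
  by rewrite !lerD.
rewrite -subr_ge0 (_ : _ - _ = 2 * (N1 * N2 - (x1 * x2 + t * (z1 * z2) + y1 * y2))).
  by rewrite mulr_ge0 // subr_ge0.
ring.
Qed.

Lemma weighted_norm_le (t x y z : R) : 0 <= t -> 0 <= x -> 0 <= y -> 0 <= z ->
  Num.sqrt (x ^+ 2 + t * z ^+ 2 + y ^+ 2) <= x + Num.sqrt t * z + y.
Proof.
move=> t0 x0 y0 z0; have s0 := sqrtr_ge0 t; have E := sqr_sqrtr t0.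
have w0 : 0 <= Num.sqrt t * z by rewrite mulr_ge0.
apply: sqrt_le_of_sqr; first by rewrite !addr_ge0.
rewrite -{1}E -exprMn; move: (Num.sqrt t * z) w0 => w w0.
rewrite -subr_ge0 (_ : _ - _ = 2 * (x * w + x * y + w * y)); last by ring.
by rewrite mulr_ge0 // !addr_ge0 // mulr_ge0.
Qed.

Lemma cell_rate (Cd Ca cA h tau sh al w s m Ja Jb Jd Je jb je : R) :
  0 <= Cd -> 0 <= Ca -> 0 <= cA -> 0 <= h -> 0 <= tau -> 0 <= sh ->
  0 <= m -> 0 <= Ja -> 0 <= Jb -> 0 <= Jd -> 0 <= Je ->
  al <= Cd * (Ca * (tau * Ja) + cA * h * Jd) ->
  w <= tau * s + tau * jb + cA * h * je ->
  sh * jb <= Jb -> sh * je <= Je -> sh * s <= m ->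
  al + sh * w <= (Cd * Ca + Cd * cA + 1 + cA) *
    (tau * (Ja + Jb) + h * (Jd + Je) + tau * m).
Proof.
move=> Cd0 Ca0 cA0 h0 t0 sh0 m0 Ja0 Jb0 Jd0 Je0 hal hw hjb hje hs.
have q1 : 0 <= Cd * Ca by rewrite mulr_ge0.
have q2 : 0 <= Cd * cA by rewrite mulr_ge0.
set k := _ + cA.
have M c r : 0 <= r -> c <= k -> c * r <= k * r by move=> r0 ck; exact: ler_wpM2r.
have e1 := M (Cd * Ca) (tau * Ja); have e2 := M (Cd * cA) (h * Jd).
have e3 := M 1 (tau * m); have e4 := M 1 (tau * Jb); have e5 := M cA (h * Je).
have hw' := ler_wpM2l sh0 hw.
have hjb' := ler_wpM2l t0 hjb; have hs' := ler_wpM2l t0 hs.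
have hch : 0 <= cA * h by rewrite mulr_ge0.
have hje' := ler_wpM2l hch hje.
have {}e1 := e1 (mulr_ge0 t0 Ja0) ltac:(rewrite /k; lra).
have {}e2 := e2 (mulr_ge0 h0 Jd0) ltac:(rewrite /k; lra).
have {}e3 := e3 (mulr_ge0 t0 m0) ltac:(rewrite /k; lra).
have {}e4 := e4 (mulr_ge0 t0 Jb0) ltac:(rewrite /k; lra).
have {}e5 := e5 (mulr_ge0 h0 Je0) ltac:(rewrite /k; lra).
move: k e1 e2 e3 e4 e5 {M} => k e1 e2 e3 e4 e5.
apply: le_trans (lerD hal hw') _.
rewrite !mulrDr -!mulrA in hal e1 e2 e3 e4 e5 hjb' hs' hje' *.
rewrite !mul1r ![sh * (tau * _)]mulrCA ![sh * (cA * _)]mulrCA ![sh * (h * _)]mulrCA in e3 e4 *.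
lra.
Qed.

(** The factors fit because 2 * 3^2 <= 5^2. *)
Lemma sqrt_energy_growth (z e S k C X : R) : 0 <= z -> 0 <= e -> 0 <= C -> 0 <= k -> 0 <= X ->
  S <= (3 * k * X) ^+ 2 -> z ^+ 2 <= e ^+ 2 + 2 * C ^+ 2 * S -> z <= e + 5 * C * k * X.
Proof.
move=> z0 e0 C0 k0 X0 hS hz.
have Q0 : 0 <= C * k * X by rewrite !mulr_ge0.
rewrite -(@ler_pXn2r _ 2) ?nnegrE //; last by rewrite addr_ge0 // -!mulrA mulr_ge0 // mulrA.
apply: le_trans hz _.
have hS' := ler_wpM2l (mulr_ge0 (ler0n R 2) (sqr_ge0 C)) hS.
apply: (@le_trans _ _ (e ^+ 2 + 18 * (C * k * X) ^+ 2)).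
  by rewrite lerD2l; apply: le_trans hS' _; rewrite le_eqVlt; apply/orP; left; apply/eqP; ring.
have -> : 5 * C * k * X = 5 * (C * k * X) by ring.
move: (C * k * X) Q0 => Q Q0; have := mulr_ge0 e0 Q0; have := sqr_ge0 Q; nra.
Qed.

Lemma estimate_energy (c cA h U N0 k r t A B D P M : R) : 0 <= h -> 0 <= U ->
  cA <= c -> 0 <= k -> 0 <= r -> 5 * k * r <= c -> 0 <= t * (A + B) + h * (D + P) + M ->
  cA * h * U + (N0 + 2 * k * (r * (t * (A + B) + h * (D + P) + M))) <=
  N0 + c * (t * (A + B) + h * (U + D + P) + M).
Proof.
move=> h0 U0 cAc k0 r0 krc Y0; have q := mulr_ge0 k0 r0.
have l1 := ler_wpM2r (mulr_ge0 h0 U0) cAc.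
have krc2 : 2 * k * r <= c by apply: le_trans krc; move: q; lra.
have l2 := ler_wpM2r Y0 krc2.
rewrite addrCA lerD2l; apply: le_trans (_ : _ <= c * (h * U) +
  c * (t * (A + B) + h * (D + P) + M)) _.
  apply: lerD; first by rewrite -[cA * h * U]mulrA.
  by rewrite [X in X <= _]mulrA.
by rewrite le_eqVlt; apply/orP; left; apply/eqP; ring.
Qed.

Lemma estimate_pressure (c cA h S N0 k t A B D P M : R) : 0 <= h -> 0 <= S ->
  cA <= c -> k <= c -> 0 <= t * (A + B) + h * (D + P) + M ->
  cA * h * S + (N0 + k * (t * (A + B) + h * (D + P) + M)) <=
  N0 + c * (t * (A + B) + h * (S + D + P) + M).
Proof.
move=> h0 S0 cAc kc Y0; have l1 := ler_wpM2r (mulr_ge0 h0 S0) cAc.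
have l2 := ler_wpM2r Y0 kc.
rewrite addrCA lerD2l; apply: le_trans (_ : _ <= c * (h * S) +
  c * (t * (A + B) + h * (D + P) + M)) _.
  by apply: lerD => //; rewrite -[cA * h * S]mulrA.
by rewrite le_eqVlt; apply/orP; left; apply/eqP; ring.
Qed.

Lemma estimate_L2 (c cA h2 S N0 k r Y1 Y2 Y3 : R) : 0 <= h2 -> 0 <= S ->
  cA <= c -> 0 <= k -> 0 <= r -> 2 * k <= c -> 5 * k ^+ 2 * r <= c -> 0 <= N0 ->
  0 <= Y1 + Y2 + Y3 ->
  cA * h2 * S + 2 * k * (N0 + 2 * k * (r * (Y1 + Y2 + Y3))) <=
  c * N0 + c * (Y1 + h2 * S + Y2 + Y3).
Proof.
move=> h0 S0 cAc k0 r0 kc krc N00 Y0; have q : 0 <= k ^+ 2 * r by rewrite mulr_ge0 ?sqr_ge0.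
have l1 := ler_wpM2r (mulr_ge0 h0 S0) cAc; have l3 := ler_wpM2r N00 kc.
have krc2 : 4 * k ^+ 2 * r <= c by apply: le_trans krc; move: q; lra.
have l2 := ler_wpM2r Y0 krc2.
apply: le_trans (_ : _ <= c * (h2 * S) + (c * N0 + c * (Y1 + Y2 + Y3))) _.
  rewrite -[cA * h2 * S]mulrA [leLHS](_ : _ = cA * (h2 * S) +
    (2 * k * N0 + 4 * k ^+ 2 * r * (Y1 + Y2 + Y3))); last by ring.
  by rewrite !lerD.
by rewrite le_eqVlt; apply/orP; left; apply/eqP; ring.
Qed.

End real_estimates.

(** * Error estimates *)

Section convergence.
Context {R : realType} {d : nat} (Omega : set 'rV[R]_d).
Context (lambda mu : R) (K : 'rV[R]_d -> 'M[R]_d) (c_is c_1 c_ap : R).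
Hypotheses (oO : open Omega) (bO : bounded_set Omega) (d0 : (0 < d)%N).
Hypotheses (mu0 : 0 < mu) (lm0 : 0 < d%:R * lambda + 2 * mu) (HK : conductivity Omega K).
Variables (T : R) (f u ut utt : R -> 'I_d -> 'rV[R]_d -> R)
  (p pt ptt : R -> 'rV[R]_d -> R)
  (Vh : set ('I_d -> 'rV[R]_d -> R)) (Qh : set ('rV[R]_d -> R)) (tau eps h : R)
  (uh : nat -> 'I_d -> 'rV[R]_d -> R) (ph : nat -> 'rV[R]_d -> R)
  (ub : R -> 'I_d -> 'rV[R]_d -> R) (pb : R -> 'rV[R]_d -> R).
Hypotheses (sV : lsubspace Vh) (sQ : lsubspace Qh).
Hypotheses (VX : Vh `<=` vH10_space Omega) (QX : Qh `<=` H10_space Omega).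
Hypotheses (tau0 : 0 < tau) (eps0 : 0 <= eps) (h0 : 0 <= h).
Hypotheses (sol : biot_solution Omega lambda mu K T f u ut p)
  (reg : biot_regularity Omega T u ut utt p pt ptt)
  (infsup : inf_sup Omega lambda mu Vh Qh c_is c_1 eps h)
  (proj : forall t, 0 <= t <= T ->
     elliptic_projection Omega lambda mu K Vh Qh (u t) (p t) (ub t) (pb t))
  (appr : projection_approximation Omega lambda mu K c_ap h T u ut p pt ub pb)
  (Vuh0 : Vh (uh 0%N)) (Qph0 : Qh (ph 0%N))
  (scheme : discrete_scheme Omega lambda mu K Vh Qh T tau eps h f uh ph).
Variable n : nat.
Hypotheses (n0 : (0 < n)%N) (nT : n%:R * tau <= T).

Local Notation leb := (@lebesgue_measure R).
Local Notation vH10 := (vH10_space Omega).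
Local Notation H10 := (H10_space Omega).
Local Notation form_a := (form_a Omega lambda mu).
Local Notation form_ap := (form_ap Omega K).
Local Notation inner_grad := (inner_grad Omega).
Local Notation b := (fun (v : 'I_d -> 'rV[R]_d -> R) (q : 'rV[R]_d -> R) =>
  inner Omega (div Omega v) q).
Local Notation sh := (Num.sqrt eps * h).
Local Notation time j := (j%:R * tau).
Local Notation tn := (n%:R * tau).
Local Notation Cd := (Num.sqrt (2 * mu / d%:R + lambda)^-1).
Local Notation Ca := (Num.sqrt (2 * mu + `|lambda| * d%:R)).
Local Notation cA := (`|c_ap|).
Local Notation Cs := (1 + `|c_is| + `|c_1|).
Local Notation Cr := (Cd * Ca + Cd * cA + 1 + cA).

Definition err_u j := uh j - ub (time j).
Definition err_p j := ph j - pb (time j).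
(** Up to sign, the increment of the projected displacement minus its prediction by the
    time derivative at the new time level. *)
Definition defect_u j := tau *: ut (time j.+1) - (ub (time j.+1) - ub (time j)).
Definition defect_p j := pb (time j.+1) - pb (time j).
Definition defect_norm j := L2norm Omega (div Omega (defect_u j)).

Lemma sh_ge0 : 0 <= sh. Proof. by rewrite mulr_ge0 ?sqrtr_ge0. Qed.

Lemma sh_sqr : sh ^+ 2 = eps * h ^+ 2. Proof. by rewrite exprMn sqr_sqrtr. Qed.

Lemma time_ge0 j : 0 <= time j. Proof. by rewrite mulr_ge0 // ltW. Qed.

Lemma time_le j : (j <= n)%N -> time j <= T.
Proof. by move=> jn; apply: le_trans nT; rewrite ler_pM2r // ler_nat. Qed.

Lemma time_in j : (j <= n)%N -> 0 <= time j <= T.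
Proof. by move=> jn; rewrite time_ge0 time_le. Qed.

Lemma time_gt0 j : (j < n)%N -> 0 < time j.+1 <= T.
Proof. by move=> jn; rewrite time_le // mulr_gt0. Qed.

Lemma ub_in j : (j <= n)%N -> Vh (ub (time j)).
Proof. by move=> jn; have [] := proj (time_in jn). Qed.

Lemma pb_in j : (j <= n)%N -> Qh (pb (time j)).
Proof. by move=> jn; have [] := proj (time_in jn). Qed.

Lemma uh_in j : (j <= n)%N -> Vh (uh j).
Proof. by case: j => // j jn; have [] := scheme (ltn0Sn j) (time_le jn). Qed.

Lemma ph_in j : (j <= n)%N -> Qh (ph j).
Proof. by case: j => // j jn; have [] := scheme (ltn0Sn j) (time_le jn). Qed.

Lemma err_u_in j : (j <= n)%N -> Vh (err_u j).
Proof. by move=> jn; exact: (subB sV (uh_in jn) (ub_in jn)). Qed.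

Lemma err_p_in j : (j <= n)%N -> Qh (err_p j).
Proof. by move=> jn; exact: (subB sQ (ph_in jn) (pb_in jn)). Qed.

Lemma defect_p_in j : (j < n)%N -> Qh (defect_p j).
Proof. by move=> jn; exact: (subB sQ (pb_in jn) (pb_in (ltnW jn))). Qed.

Lemma ut_in j : (j < n)%N -> vH10 (ut (time j.+1)).
Proof.
move=> jn; have [[du dut _ _] _ _ _] := reg.
exact: (derivative_in (vform1_vH10 oO bO) du dut (time_gt0 jn)).
Qed.

Lemma defect_u_in j : (j < n)%N -> vH10 (defect_u j).
Proof.
move=> jn; have sX := vH10_subspace oO bO; apply: (subB sX (subZ sX _ (ut_in jn))).
exact: (subB sX (VX (ub_in jn)) (VX (ub_in (ltnW jn)))).
Qed.

Lemma defect_bound j : (j < n)%N -> forall q, Qh q ->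
  `|b (defect_u j) q| <= defect_norm j * L2norm Omega q.
Proof.
move=> jn q Qq.
exact: (semi_inner_CS (inner_semi_inner oO bO)
  (div_L2 oO bO (vH10_vH1 (defect_u_in jn))) (H10_L2 (QX Qq))).
Qed.

Lemma momentum_balance_step j : (j < n)%N ->
  momentum_balance Vh form_a b (err_u j.+1) (err_p j.+1).
Proof.
move=> jn; have [Vu Qp E1 _] := scheme (ltn0Sn j) (time_le jn).
have [_ E2 _ _] := sol; have [Vb Qb _ E3] := proj (time_in jn).
apply: (momentum_error oO bO mu0 lm0 d0 VX QX Vb Qb Vu Qp E1 _ E3) => v Vv.
exact: E2 (time_gt0 jn) v (VX Vv).
Qed.

Lemma momentum_balance_initial :
  initial_data_I Omega lambda mu Vh Qh eps h (f 0) (uh 0%N) (ph 0%N) ->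
  momentum_balance Vh form_a b (err_u 0) (err_p 0).
Proof.
move=> [E1 _]; have [_ _ _ [_ _ E2 _]] := sol.
have [Vb Qb _ E3] := proj (time_in (leq0n n)).
rewrite mul0r in Vb Qb E3.
rewrite /err_u /err_p mul0r.
apply: (momentum_error oO bO mu0 lm0 d0 VX QX Vb Qb Vuh0 Qph0 E1 _ E3) => v Vv.
exact: E2 v (VX Vv).
Qed.

Lemma mass_balance_step j : (j < n)%N -> forall q, Qh q ->
  b (err_u j.+1 - err_u j) q + tau * form_ap (err_p j.+1) q
    + sh ^+ 2 * inner_grad (err_p j.+1 - err_p j) q =
  b (defect_u j) q - sh ^+ 2 * inner_grad (defect_p j) q.
Proof.
move=> jn; have jn' := ltnW jn; have [_ _ _ E1] := scheme (ltn0Sn j) (time_le jn).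
have [_ _ E2 _] := sol; have [_ _ E3 _] := proj (time_in jn).
rewrite sh_sqr.
apply: (mass_error oO bO HK VX QX tau0 (ut_in jn) (ub_in jn') (ub_in jn) (uh_in jn')
  (uh_in jn) (pb_in jn') (pb_in jn) (ph_in jn') (ph_in jn) E1 _ E3) => q Qq.
exact: E2 (time_gt0 jn) q (QX Qq).
Qed.

Local Notation cell j := (`[j%:R * tau, j.+1%:R * tau]%classic).
Local Notation upto := (`[0, tn]%classic).
Local Notation rate_u := (fun t => vsemi2 Omega (ut t) + semi1 Omega (pt t)).
Local Notation rate_p := (fun t => sh * semi2 Omega (pt t)).
Local Notation acc_u := (fun t => vnorm1 Omega (utt t)).
Local Notation acc_p := (fun t => sh * semi1 Omega (ptt t)).
Local Notation acc_p1 := (fun t => sh * norm1 Omega (ptt t)).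
Local Notation maxpt := (\big[Num.max/0]_(1 <= j < n.+1) (sh * semi1 Omega (pt (time j)))).

Definition defect j := defect_norm j + sh * fnorm inner_grad (defect_p j).

Lemma defect_ge0 j : 0 <= defect j.
Proof. by rewrite addr_ge0 ?sqrtr_ge0 // mulr_ge0 ?sqrtr_ge0 ?sh_ge0. Qed.

Lemma maxpt_ge0 : 0 <= maxpt. Proof. exact: bigmax_ge_id. Qed.

Lemma le_maxpt j : (j < n)%N -> sh * semi1 Omega (pt (time j.+1)) <= maxpt.
Proof.
move=> jn; have jI : j.+1 \in index_iota 1 n.+1 by rewrite mem_index_iota.
exact: (le_bigmax_seq 0 _ xpredT (fun i => sh * semi1 Omega (pt (time i))) jI isT).
Qed.

Lemma time_step j : time j.+1 - time j = tau.
Proof. by rewrite -mulrBl -natrB // subSnn mul1r. Qed.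

Lemma Cs_ge1 : 1 <= Cs. Proof. by rewrite -addrA lerDl addr_ge0. Qed.

Lemma Cr_ge0 : 0 <= Cr. Proof. by rewrite !addr_ge0 // mulr_ge0 ?sqrtr_ge0. Qed.

Let su := lfin12_first_order oO bO reg nT.
Let sp := lfin12_semi2_pt reg nT.
Let sutt := lfin12_utt reg nT.
Let sptt := lfin12_semi1_ptt reg nT.
Let sptt1 := lfin12_ptt reg nT.
Let u0 t : 0 <= vsemi2 Omega (ut t) + semi1 Omega (pt t).
Proof. by rewrite addr_ge0 ?sqrtr_ge0. Qed.
Let p0 t : 0 <= semi2 Omega (pt t). Proof. exact: sqrtr_ge0. Qed.
Let utt0 t : 0 <= vnorm1 Omega (utt t). Proof. exact: sqrtr_ge0. Qed.
Let ptt0 t : 0 <= semi1 Omega (ptt t). Proof. exact: sqrtr_ge0. Qed.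
Let ptt10 t : 0 <= norm1 Omega (ptt t). Proof. exact: sqrtr_ge0. Qed.
Let shp0 t : 0 <= sh * semi2 Omega (pt t). Proof. by rewrite mulr_ge0 ?sh_ge0. Qed.
Let shptt0 t : 0 <= sh * semi1 Omega (ptt t). Proof. by rewrite mulr_ge0 ?sh_ge0. Qed.
Let shptt10 t : 0 <= sh * norm1 Omega (ptt t). Proof. by rewrite mulr_ge0 ?sh_ge0. Qed.
Let shp : lfin12 tn rate_p := lfin12_scale sh_ge0 p0 sp.
Let shptt : lfin12 tn acc_p := lfin12_scale sh_ge0 ptt0 sptt.
Let shptt1 : lfin12 tn acc_p1 := lfin12_scale sh_ge0 ptt10 sptt1.

Lemma defect_rate j : (j < n)%N -> defect j <= Cr *
  (tau * (\int[leb]_(t in cell j) acc_u t + \int[leb]_(t in cell j) acc_p t)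
   + h * (\int[leb]_(t in cell j) rate_u t + \int[leb]_(t in cell j) rate_p t)
   + tau * maxpt).
Proof.
move=> jn; have [[du dut dp dpt] _ _ _] := reg.
have [_ [rut [rpt [dru drp aer]]]] := appr.
have ab : time j < time j.+1 by rewrite ltr_pM2r // ltr_nat.
have cu := lfin_cell tau0 u0 jn su.1; have cp := lfin_cell tau0 p0 jn sp.1.
have cutt := lfin_cell tau0 utt0 jn sutt.1; have cptt := lfin_cell tau0 ptt0 jn sptt.1.
have vc := velocity_consistency oO bO mu0 lm0 d0 du dut dru aer h0 (time_ge0 j) ab
  (time_le jn) cu cutt.
have pX := subB (H10_subspace oO bO) (QX (pb_in jn)) (QX (pb_in (ltnW jn))).
have pc := pressure_increment oO bO dp dpt drp aer h0 (time_ge0 j) ab (time_le jn) cp cptt pX.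
rewrite time_step in vc pc.
have e1 := Rint_scale_ge sh_ge0 ptt0 cptt; have e2 := Rint_scale_ge sh_ge0 p0 cp.
rewrite /defect -(semi1E oO bO (H10_H1 pX)).
have Cd0 : 0 <= Cd by exact: sqrtr_ge0.
have Ca0 : 0 <= Ca by exact: (sqrtr_ge0 (2 * mu + `|lambda| * d%:R)).
have J1 := Rint_ge0 leb (cell j) utt0; have J2 := Rint_ge0 leb (cell j) shptt0.
have J3 := Rint_ge0 leb (cell j) u0; have J4 := Rint_ge0 leb (cell j) shp0.
exact: (cell_rate Cd0 Ca0 (normr_ge0 c_ap) h0 (ltW tau0) sh_ge0 maxpt_ge0 J1 J2 J3 J4
  vc pc e1 e2 (le_maxpt jn)).
Qed.

Lemma defect_rate1 j : (j < n)%N -> defect j <= Cr *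
  (tau * (\int[leb]_(t in cell j) acc_u t + \int[leb]_(t in cell j) acc_p1 t)
   + h * (\int[leb]_(t in cell j) rate_u t + \int[leb]_(t in cell j) rate_p t)
   + tau * maxpt).
Proof.
move=> jn; apply: le_trans (defect_rate jn) _; apply: ler_wpM2l; first exact: Cr_ge0.
rewrite !lerD2r; apply: ler_wpM2l; first exact: ltW; rewrite lerD2l.
apply: le_Rint => //; last exact: lfin_cell shptt1.1.
by apply/aeW => t ct; split => //; apply: ler_wpM2l (semi1_le_norm1 _ _); exact: sh_ge0.
Qed.

Local Notation X1 := (tau * (\int[leb]_(t in upto) acc_u t + \int[leb]_(t in upto) acc_p t)
   + h * (\int[leb]_(t in upto) rate_u t + \int[leb]_(t in upto) rate_p t) + tn * maxpt).
Local Notation I2 g := (Num.sqrt (\int[leb]_(t in upto) (g t) ^+ 2)).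
Local Notation X2 := (tau * (I2 acc_u + I2 acc_p1) + h * (I2 rate_u + I2 rate_p)
   + Num.sqrt tn * maxpt).

Lemma defect_sum : \sum_(j < n) defect j <= Cr * X1.
Proof.
exact: (rate1 tau0 h0 Cr_ge0 utt0 shptt0 u0 shp0 sutt.1 shptt.1 su.1 shp.1 defect_rate).
Qed.

Lemma defect_sum_sqr : \sum_(j < n) (defect j ^+ 2 / tau) <= (3 * Cr * X2) ^+ 2.
Proof.
exact: (rate2 tau0 h0 Cr_ge0 maxpt_ge0 utt0 shptt10 u0 shp0 sutt.1 shptt1.1 su.1 shp.1
  defect_ge0 defect_rate1 sutt.2 shptt1.2 su.2 shp.2).
Qed.

Local Notation E j := (energy_norm form_a form_ap inner_grad tau sh (err_u j) (err_p j)).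
Local Notation bBl := (div_pairingBl oO bO).
Local Notation bBr := (div_pairingBr oO bO).
Local Notation sA := (form_a_vH10 oO bO mu0 lm0 d0).
Local Notation sAP := (form_ap_H10 oO bO HK).
Local Notation sG := (inner_grad_H10 oO bO).
Let stable := inf_sup_stability oO bO mu0 lm0 d0 VX QX h0 infsup.

Lemma norm_tau_hE v q : H10 q -> norm_tau_h Omega lambda mu K eps tau h v q =
  energy_norm form_a form_ap inner_grad tau sh v q.
Proof.
move=> Hq; rewrite /norm_tau_h /energy_norm (semi1E oO bO (H10_H1 Hq)).
by rewrite [(sh * _) ^+ 2]exprMn sh_sqr.
Qed.

Lemma defect_norm_ge0 j : 0 <= defect_norm j. Proof. exact: sqrtr_ge0. Qed.

Lemma error_energy : E n <= E 0 + 2 * Cs * (Cr * X1).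
Proof.
apply: le_trans (energy_stability sA sAP sG VX QX bBl tau0 sh_ge0 Cs_ge1 stable err_u_in err_p_in
  defect_p_in defect_norm_ge0 defect_bound mass_balance_step momentum_balance_step) _.
rewrite lerD2l; apply: ler_wpM2l defect_sum.
by rewrite mulr_ge0 // (le_trans _ Cs_ge1).
Qed.

Let Cs_ge0 : 0 <= Cs. Proof. exact: le_trans Cs_ge1. Qed.

Lemma X2_ge0 : 0 <= X2.
Proof. by rewrite !addr_ge0 ?mulr_ge0 ?addr_ge0 ?sqrtr_ge0 ?(ltW tau0) ?maxpt_ge0. Qed.

Lemma error_pressure :
  initial_data_I Omega lambda mu Vh Qh eps h (f 0) (uh 0%N) (ph 0%N) ->
  fnorm form_ap (err_p n) <= fnorm form_ap (err_p 0) + 5 * Cs * Cr * X2.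
Proof.
move=> /momentum_balance_initial mom0.
have le := pressure_stability sA sAP sG sV sQ VX QX bBr tau0 sh_ge0 Cs_ge1 stable
  err_u_in err_p_in defect_p_in defect_norm_ge0 defect_bound mass_balance_step
  momentum_balance_step mom0.
exact: (sqrt_energy_growth (fnorm_ge0 _) (fnorm_ge0 _) Cs_ge0 Cr_ge0 X2_ge0
  defect_sum_sqr le).
Qed.

Lemma error_pressure_smoothing :
  fnorm form_ap (err_p n) <= (Num.sqrt (2 * tau))^-1 * E 0 + 5 * Cs * Cr * X2.
Proof.
have le := pressure_smoothing sA sAP sG sV sQ VX QX bBl bBr tau0 sh_ge0 Cs_ge1 stable
  err_u_in err_p_in defect_p_in defect_norm_ge0 defect_bound mass_balance_step
  momentum_balance_step n0.
have t20 : 0 <= 2 * tau by rewrite mulr_ge0 // ltW.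
have sq : E 0 ^+ 2 / (2 * tau) = ((Num.sqrt (2 * tau))^-1 * E 0) ^+ 2.
  by rewrite [RHS]exprMn exprVn (sqr_sqrtr t20) [RHS]mulrC.
rewrite sq in le.
have e0 : 0 <= (Num.sqrt (2 * tau))^-1 * E 0 by rewrite mulr_ge0 ?invr_ge0 ?sqrtr_ge0.
exact: (sqrt_energy_growth (fnorm_ge0 _) e0 Cs_ge0 Cr_ge0 X2_ge0 defect_sum_sqr le).
Qed.

Lemma error_pressure_L2 : L2norm Omega (err_p n) <= 2 * Cs * E n.
Proof.
exact: (pressure_L2_stability form_ap tau0 sh_ge0 Cs_ge1 stable err_u_in err_p_in
  momentum_balance_step n0).
Qed.

Local Notation rho_u := (u tn - ub tn).
Local Notation rho_p := (p tn - pb tn).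

Let tn_gt0 : 0 < tn <= T. Proof. by rewrite nT mulr_gt0 // ltr0n. Qed.

Let u_in : vH10 (u tn) /\ H10 (p tn).
Proof. by have [S _ _ _] := sol; exact: S tn_gt0. Qed.

Lemma rho_u_in : vH10 rho_u.
Proof. exact: (subB (vH10_subspace oO bO) u_in.1 (VX (ub_in (leqnn n)))). Qed.

Lemma rho_p_in : H10 rho_p.
Proof. exact: (subB (H10_subspace oO bO) u_in.2 (QX (pb_in (leqnn n)))). Qed.

Lemma error_u_split : u tn - uh n = rho_u - err_u n.
Proof. by rewrite /err_u opprB addrA subrK. Qed.

Lemma error_p_split : p tn - ph n = rho_p - err_p n.
Proof. by rewrite /err_p opprB addrA subrK. Qed.

(** The absolute value of the approximation constant appears because that constant is not
    assumed to be nonnegative. *)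
Lemma projection_error :
  [/\ norm_a Omega lambda mu rho_u <= cA * h * (vsemi2 Omega (u tn) + semi1 Omega (p tn)),
      semi1 Omega rho_p <= cA * h * semi2 Omega (p tn),
      norm_ap Omega K rho_p <= cA * h * semi2 Omega (p tn) &
      L2norm Omega rho_p <= cA * h ^+ 2 * semi2 Omega (p tn)].
Proof.
have [/(_ _ tn_gt0)[e1 e2 e3 e4] _] := appr.
have s2 : 0 <= semi2 Omega (p tn) by exact: sqrtr_ge0.
have mono x y : 0 <= x -> 0 <= y -> c_ap * x * y <= cA * x * y.
  by move=> x0 y0; apply: ler_wpM2r => //; apply: ler_wpM2r => //; exact: ler_norm.
split.
- apply: le_trans e1 (mono _ _ h0 _); exact: (addr_ge0 (sqrtr_ge0 _) (sqrtr_ge0 _)).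
- exact: le_trans (semi1_le_norm1 _ _) (le_trans e2 (mono _ _ h0 s2)).
- exact: le_trans e3 (mono _ _ h0 s2).
- exact: le_trans e4 (mono _ _ (sqr_ge0 h) s2).
Qed.

Lemma energy_error_total :
  norm_tau_h Omega lambda mu K eps tau h (u tn - uh n) (p tn - ph n) <=
  cA * h * (vsemi2 Omega (u tn) + semi1 Omega (p tn)
            + (Num.sqrt tau + sh) * semi2 Omega (p tn)) + E n.
Proof.
have [e1 e2 e3 _] := projection_error.
have Hu := VX (err_u_in (leqnn n)); have Hp := QX (err_p_in (leqnn n)).
rewrite error_u_split error_p_split.
rewrite norm_tau_hE; last exact: (subB (H10_subspace oO bO) rho_p_in Hp).
have l1 := fnormB sA rho_u_in Hu; have l2 := fnormB sAP rho_p_in Hp.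
have l3 := ler_wpM2l sh_ge0 (fnormB sG rho_p_in Hp).
rewrite mulrDr in l3.
rewrite (semi1E oO bO (H10_H1 rho_p_in)) in e2.
have y0 q : 0 <= sh * fnorm inner_grad q by rewrite mulr_ge0 ?fnorm_ge0 ?sh_ge0.
apply: le_trans (weighted_minkowski (ltW tau0) (fnorm_ge0 _) (y0 _) (fnorm_ge0 _)
  (fnorm_ge0 _) (y0 _) (fnorm_ge0 _) (fnorm_ge0 _) (y0 _) (fnorm_ge0 _) l1 l3 l2) _.
rewrite lerD2r.
apply: le_trans (weighted_norm_le (ltW tau0) (fnorm_ge0 _) (y0 _) (fnorm_ge0 _)) _.
have e3' := ler_wpM2l (sqrtr_ge0 tau) e3; have e2' := ler_wpM2l sh_ge0 e2.
apply: le_trans (lerD (lerD e1 e3') e2') _.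
rewrite le_eqVlt; apply/orP; left; apply/eqP.
move: (vsemi2 _ _) (semi1 _ _) (semi2 _ _) (Num.sqrt tau) sh => A B S t s.
ring.
Qed.

Lemma pressure_error_total :
  norm_ap Omega K (p tn - ph n) <= cA * h * semi2 Omega (p tn) + fnorm form_ap (err_p n).
Proof.
have [_ _ e3 _] := projection_error; have Hp := QX (err_p_in (leqnn n)).
by rewrite error_p_split; apply: le_trans (fnormB sAP rho_p_in Hp) _; rewrite lerD2r.
Qed.

Lemma pressure_L2_error_total :
  L2norm Omega (p tn - ph n) <= cA * h ^+ 2 * semi2 Omega (p tn) + L2norm Omega (err_p n).
Proof.
have [_ _ _ e4] := projection_error; have Hp := QX (err_p_in (leqnn n)).
rewrite error_p_split.
apply: le_trans (fnormB (inner_semi_inner oO bO) (H10_L2 rho_p_in) (H10_L2 Hp)) _.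
by rewrite lerD2r.
Qed.

Lemma X1_ge0 : 0 <= X1.
Proof.
have J1 := Rint_ge0 leb upto utt0; have J2 := Rint_ge0 leb upto shptt0.
have J3 := Rint_ge0 leb upto u0; have J4 := Rint_ge0 leb upto shp0.
have h1 := mulr_ge0 (ltW tau0) (addr_ge0 J1 J2); have h2 := mulr_ge0 h0 (addr_ge0 J3 J4).
exact: (addr_ge0 (addr_ge0 h1 h2) (mulr_ge0 (time_ge0 n) maxpt_ge0)).
Qed.

Variable c : R.
Hypotheses (cAc : cA <= c) (Csc : 2 * Cs <= c) (Crc : 5 * Cs ^+ 2 * Cr <= c).

Let c0 : 0 <= c. Proof. exact: le_trans cAc. Qed.

Let CsCrc : 5 * Cs * Cr <= c.
Proof.
apply: le_trans Crc; apply: ler_wpM2r; first exact: Cr_ge0.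
apply: ler_wpM2l => //; rewrite -[leLHS]mulr1 expr2; apply: ler_wpM2l => //.
exact: Cs_ge1.
Qed.

Lemma initial_energy :
  norm_tau_h Omega lambda mu K eps tau h (uh 0%N - ub 0) (ph 0%N - pb 0) = E 0.
Proof.
rewrite -norm_tau_hE; last exact: (QX (err_p_in (leq0n n))).
by rewrite /err_u /err_p mul0r.
Qed.

Lemma energy_estimate :
  norm_tau_h Omega lambda mu K eps tau h (u tn - uh n) (p tn - ph n) <=
  norm_tau_h Omega lambda mu K eps tau h (uh 0%N - ub 0) (ph 0%N - pb 0) +
  c * (tau * (\int[leb]_(t in upto) acc_u t + \int[leb]_(t in upto) acc_p t)
       + h * (vsemi2 Omega (u tn) + semi1 Omega (p tn)
              + (Num.sqrt tau + sh) * semi2 Omega (p tn)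
              + \int[leb]_(t in upto) rate_u t + \int[leb]_(t in upto) rate_p t)
       + tn * maxpt).
Proof.
rewrite initial_energy; apply: le_trans energy_error_total _.
apply: le_trans (lerD (lexx _) error_energy) _.
have U0 : 0 <= vsemi2 Omega (u tn) + semi1 Omega (p tn)
    + (Num.sqrt tau + sh) * semi2 Omega (p tn).
  exact: (addr_ge0 (addr_ge0 (sqrtr_ge0 _) (sqrtr_ge0 _))
    (mulr_ge0 (addr_ge0 (sqrtr_ge0 _) sh_ge0) (sqrtr_ge0 _))).
exact: (estimate_energy _ h0 U0 cAc Cs_ge0 Cr_ge0 CsCrc X1_ge0).
Qed.

Lemma pressure_estimate (N0 : R) :
  fnorm form_ap (err_p n) <= N0 + 5 * Cs * Cr * X2 ->
  norm_ap Omega K (p tn - ph n) <= N0 +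
  c * (tau * (I2 acc_u + I2 acc_p1)
       + h * (semi2 Omega (p tn) + I2 rate_u + I2 rate_p) + Num.sqrt tn * maxpt).
Proof.
move=> le; apply: le_trans pressure_error_total _; apply: le_trans (lerD (lexx _) le) _.
exact: (estimate_pressure _ h0 (sqrtr_ge0 _) cAc CsCrc X2_ge0).
Qed.

Lemma pressure_estimate_stokes_data :
  initial_data_I Omega lambda mu Vh Qh eps h (f 0) (uh 0%N) (ph 0%N) ->
  norm_ap Omega K (p tn - ph n) <= norm_ap Omega K (ph 0%N - pb 0) +
  c * (tau * (I2 acc_u + I2 acc_p1)
       + h * (semi2 Omega (p tn) + I2 rate_u + I2 rate_p) + Num.sqrt tn * maxpt).
Proof.
move=> dI; apply: pressure_estimate.
by have := error_pressure dI; rewrite {1}/err_p [err_p 0]/err_p mul0r.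
Qed.

Lemma pressure_estimate_any_data :
  norm_ap Omega K (p tn - ph n) <= (Num.sqrt (2 * tau))^-1 *
    norm_tau_h Omega lambda mu K eps tau h (uh 0%N - ub 0) (ph 0%N - pb 0) +
  c * (tau * (I2 acc_u + I2 acc_p1)
       + h * (semi2 Omega (p tn) + I2 rate_u + I2 rate_p) + Num.sqrt tn * maxpt).
Proof.
by rewrite initial_energy; apply: pressure_estimate; exact: error_pressure_smoothing.
Qed.

Lemma pressure_L2_estimate :
  L2norm Omega (p tn - ph n) <=
  c * norm_tau_h Omega lambda mu K eps tau h (uh 0%N - ub 0) (ph 0%N - pb 0) +
  c * (tau * (\int[leb]_(t in upto) acc_u t + \int[leb]_(t in upto) acc_p t)
       + h ^+ 2 * semi2 Omega (p tn)
       + h * (\int[leb]_(t in upto) rate_u t + \int[leb]_(t in upto) rate_p t)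
       + tn * maxpt).
Proof.
rewrite initial_energy; apply: le_trans pressure_L2_error_total _.
apply: le_trans (lerD (lexx _) error_pressure_L2) _.
apply: le_trans (lerD (lexx _) (ler_wpM2l (mulr_ge0 (ler0n _ 2) Cs_ge0) error_energy)) _.
exact: (estimate_L2 (sqr_ge0 h) (sqrtr_ge0 _) cAc Cs_ge0 Cr_ge0 Csc Crc (sqrtr_ge0 _) X1_ge0).
Qed.

End convergence.

(** * The convergence theorem *)

Lemma inf_sup_monotone (R : realType) (d : nat) (Omega : set 'rV[R]_d) (lambda mu : R)
    Vh Qh (c c1 c1' eps h : R) : 0 <= h -> c1 <= c1' ->
  inf_sup Omega lambda mu Vh Qh c c1 eps h -> inf_sup Omega lambda mu Vh Qh c c1' eps h.
Proof.
move=> h0 le is1 q Qq; apply: le_trans (is1 q Qq) _; rewrite lerD2l -!(mulrA _ _ h).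
apply: ler_wpM2r; first exact: sqrtr_ge0.
by apply: ler_wpM2r => //; rewrite mulr_ge0 ?sqrtr_ge0.
Qed.

Theorem theorem7 (R : realType) (d : nat) (Omega : set 'rV[R]_d)
  (lambda mu : R) (K : 'rV[R]_d -> 'M[R]_d) (c_is c_1 c_ap : R) :
  (0 < d)%N -> domain Omega ->
  0 < mu -> 0 < d%:R * lambda + 2 * mu -> conductivity Omega K ->
  exists c : R, 0 < c /\
  forall (T : R) (f u ut utt : R -> 'I_d -> 'rV[R]_d -> R)
    (p pt ptt : R -> 'rV[R]_d -> R)
    (E : element) (Th : seq 'M[R]_(d.+1, d)) (tau eps : R)
    (uh : nat -> 'I_d -> 'rV[R]_d -> R) (ph : nat -> 'rV[R]_d -> R)
    (ub : R -> 'I_d -> 'rV[R]_d -> R) (pb : R -> 'rV[R]_d -> R),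
  let h := mesh_size Th in
  let Vh := velocity_space Omega E Th in
  let Qh := pressure_space Omega Th in
  let sh := Num.sqrt eps * h in
  let nrm := norm_tau_h Omega lambda mu K eps tau h in
  let eu0 := uh 0%N - ub 0 in
  let ep0 := ph 0%N - pb 0 in
  let dataI := initial_data_I Omega lambda mu Vh Qh eps h (f 0) (uh 0%N) (ph 0%N) in
  let dataII := initial_data_II Omega (uh 0%N) (ph 0%N) in
  0 < T -> (forall t, 0 <= t <= T -> vL2_space Omega (f t)) ->
  biot_solution Omega lambda mu K T f u ut p ->
  biot_regularity Omega T u ut utt p pt ptt ->
  simplicial_mesh Omega Th -> 0 < tau -> stabilization E eps ->
  inf_sup Omega lambda mu Vh Qh c_is (if E is MINI then 0 else c_1) eps h ->
  (forall t, 0 <= t <= T ->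
     elliptic_projection Omega lambda mu K Vh Qh (u t) (p t) (ub t) (pb t)) ->
  projection_approximation Omega lambda mu K c_ap h T u ut p pt ub pb ->
  Vh (uh 0%N) -> Qh (ph 0%N) -> dataI \/ dataII ->
  discrete_scheme Omega lambda mu K Vh Qh T tau eps h f uh ph ->
  forall n : nat, (1 <= n)%N -> n%:R * tau <= T ->
  let tn := n%:R * tau in
  let maxpt := \big[Num.max/0]_(1 <= j < n.+1)
                 (sh * semi1 Omega (pt (j%:R * tau))) in
  let I1 (g : R -> R) : R := \int[lebesgue_measure]_(t in `[0, tn]) g t in
  let I2 (g : R -> R) : R := Num.sqrt (\int[lebesgue_measure]_(t in `[0, tn]) (g t) ^+ 2) in
  let rhs2 :=
    c * (tau * (I2 (fun t => vnorm1 Omega (utt t))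
                + I2 (fun t => sh * norm1 Omega (ptt t)))
         + h * (semi2 Omega (p tn)
                + I2 (fun t => vsemi2 Omega (ut t) + semi1 Omega (pt t))
                + I2 (fun t => sh * semi2 Omega (pt t)))
         + Num.sqrt tn * maxpt) in
  [/\ nrm (u tn - uh n) (p tn - ph n)
      <= nrm eu0 ep0
         + c * (tau * (I1 (fun t => vnorm1 Omega (utt t))
                       + I1 (fun t => sh * semi1 Omega (ptt t)))
                + h * (vsemi2 Omega (u tn) + semi1 Omega (p tn)
                       + (Num.sqrt tau + sh) * semi2 Omega (p tn)
                       + I1 (fun t => vsemi2 Omega (ut t) + semi1 Omega (pt t))
                       + I1 (fun t => sh * semi2 Omega (pt t)))
                + tn * maxpt),
      dataI ->
      norm_ap Omega K (p tn - ph n) <= norm_ap Omega K ep0 + rhs2,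
      dataII ->
      norm_ap Omega K (p tn - ph n)
      <= (Num.sqrt (2 * tau))^-1 * nrm eu0 ep0 + rhs2 &
      L2norm Omega (p tn - ph n)
      <= c * nrm eu0 ep0
         + c * (tau * (I1 (fun t => vnorm1 Omega (utt t))
                       + I1 (fun t => sh * semi1 Omega (ptt t)))
                + h ^+ 2 * semi2 Omega (p tn)
                + h * (I1 (fun t => vsemi2 Omega (ut t) + semi1 Omega (pt t))
                       + I1 (fun t => sh * semi2 Omega (pt t)))
                + tn * maxpt)].
Proof.
move=> d0 [oO _ _ bO] mu0 lm0 HK.
pose Cd := Num.sqrt (2 * mu / d%:R + lambda)^-1.
pose Ca := Num.sqrt (2 * mu + `|lambda| * d%:R).
pose Cs := 1 + `|c_is| + `|(`|c_1|)|.
pose Cr := Cd * Ca + Cd * `|c_ap| + 1 + `|c_ap|.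
have Cd0 : 0 <= Cd by exact: sqrtr_ge0.
have Ca0 : 0 <= Ca by exact: sqrtr_ge0.
have Cs0 : 0 <= Cs by rewrite !addr_ge0.
have Cr0 : 0 <= Cr by rewrite !addr_ge0 ?mulr_ge0.
have B0 : 0 <= 5 * Cs ^+ 2 * Cr by rewrite mulr_ge0 // mulr_ge0 ?sqr_ge0.
have A0 : 0 <= 2 * Cs by rewrite mulr_ge0.
have N0 := normr_ge0 c_ap.
pose c := 1 + `|c_ap| + 2 * Cs + 5 * Cs ^+ 2 * Cr.
have cAc : `|c_ap| <= c by rewrite /c; lra.
have Csc : 2 * Cs <= c by rewrite /c; lra.
have Crc : 5 * Cs ^+ 2 * Cr <= c by rewrite /c; lra.
exists c; split; first by rewrite /c; lra.
move=> T f u ut utt p pt ptt E Th tau eps uh ph ub pb h Vh Qh sh nrm eu0 ep0 dataI dataII.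
move=> T0 _ sol reg _ tau0 stab infsup proj appr Vuh0 Qph0 _ scheme n n0 nT tn maxpt I1 I2 rhs2.
have h0 : 0 <= h by exact: bigmax_ge_id.
have eps0 : 0 <= eps by case: (E) stab => //= /ltW.
have sV : lsubspace Vh := velocity_subspace oO bO Th E.
have sQ : lsubspace Qh := P1_subspace oO bO Th.
have VX : Vh `<=` vH10_space Omega := @velocity_vH10 R d Omega Th E.
have QX : Qh `<=` H10_space Omega := @P1_H10 R d Omega Th.
(* both elements are covered by the larger stabilization constant *)
have infsup' : inf_sup Omega lambda mu Vh Qh c_is `|c_1| eps h.
  by apply: inf_sup_monotone infsup => //; case: (E); rewrite ?ler_norm.
split.
- exact: (energy_estimate oO bO d0 mu0 lm0 HK sV sQ VX QX tau0 eps0 h0 sol reg infsup'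
    proj appr Vuh0 Qph0 scheme n0 nT cAc Crc).
- exact: (pressure_estimate_stokes_data oO bO d0 mu0 lm0 HK sV sQ VX QX tau0 eps0 h0 sol
    reg infsup' proj appr Vuh0 Qph0 scheme n0 nT cAc Crc).
- move=> _; exact: (pressure_estimate_any_data oO bO d0 mu0 lm0 HK sV sQ VX QX tau0 eps0 h0
    sol reg infsup' proj appr Vuh0 Qph0 scheme n0 nT cAc Crc).
- exact: (pressure_L2_estimate oO bO d0 mu0 lm0 HK sV sQ VX QX tau0 eps0 h0 sol reg infsup'
    proj appr Vuh0 Qph0 scheme n0 nT cAc Csc Crc).
Qed.
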